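(* (a) Let $\Omega\subseteq\mathbb{R}^2$ be a smooth bounded simply connected domain. Then $$\tilde H(a)=2\,e^{2H(a,a)}\qquad\text{for all } a\in\Omega .$$ (b) For multiply connected domains there does not exist in general a function $F$ such that $\tilde H(a)=F(H(a,a))$; that is, there exist smooth bounded multiply connected domains $\Omega\subseteq\mathbb{R}^2$ for which there is no function $F:\mathbb{R}\to\mathbb{R}$ with $\tilde H(a)=F(H(a,a))$ for all $a\in\Omega$. In particular, there exists $\rho>1$ such that for the annulus $\Omega=\{z\in\mathbb{C}:\rho^{-1}<|z|<\rho\}$ the set of critical points of $a\mapsto H(a,a)$ and the set of critical points of $a\mapsto\tilde H(a)$ do not coincide.
   Context: For a smooth bounded domain $\Omega\subseteq\mathbb{R}^2$, $G(a,\xi)$ ($a,\xi\in\Omega$) denotes the Green's function of the Dirichlet Laplacian on $\Omega$, normalized so that $G(a,\xi)\sim-\log|a-\xi|$ as $\xi\to a$ (and $G(a,\cdot)=0$ on $\partial\Omega$, $G(a,\cdot)$ harmonic in $\Omega\setminus\{a\}$). Its regular part $H$ is defined by $G(a,\xi)=-\log|a-\xi|-H(a,\xi)$; thus $H(a,\cdot)$ is harmonic in $\Omega$ with $H(a,\xi)=-\log|a-\xi|$ for $\xi\in\partial\Omega$. The function $a\mapsto H(a,a)$ is the Robin function. Write $a=(a_1,a_2)$, $\xi=(x,y)=(\xi_1,\xi_2)$. For $i=1,2$ let $h_i(a,\cdot)$ be the harmonic function in $\Omega$ with boundary values $h_i(a,\xi)=\frac{\xi_i-a_i}{|\xi-a|^2}$,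 $\xi\in\partial\Omega$; equivalently $h_i(a,\xi)=\frac{\partial H(a,\xi)}{\partial a_i}$. Define $$\tilde H(a)=\left(\frac{\partial h_1}{\partial x}(a,\xi)+\frac{\partial h_2}{\partial y}(a,\xi)\right)\Big|_{\xi=a},$$ where the derivatives are taken with respect to the second variable $\xi=(x,y)$. *)

(* Defs.v *)
From mathcomp Require Import all_boot all_order all_algebra.
From mathcomp Require Import all_classical all_reals all_analysis.

Set Implicit Arguments.
Unset Strict Implicit.
Unset Printing Implicit Defensive.

Import Order.TTheory GRing.Theory Num.Theory.
Import numFieldNormedType.Exports.

Local Open Scope classical_set_scope.
Local Open Scope ring_scope.

Section Plane.
Variable R : realType.

(* The library norm on [R * R] is the sup norm; it gives the right topology
   and the right bounded sets, but not the Euclidean distance. *)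
Definition eucl_dist (p q : R * R) : R :=
  Num.sqrt ((p.1 - q.1) ^+ 2 + (p.2 - q.2) ^+ 2).

Definition pd1 (f : R * R -> R) : R * R -> R := 'D_((1, 0) : R * R) f.
Definition pd2 (f : R * R -> R) : R * R -> R := 'D_((0, 1) : R * R) f.

(* Only meant for open [U]. *)
Fixpoint Ck_on (k : nat) (U : set (R * R)) (f : R * R -> R) : Prop :=
  match k with
  | 0 => forall p, U p -> {for p, continuous f}
  | k'.+1 =>
      [/\ forall p, U p ->
            derivable f p ((1, 0) : R * R) /\ derivable f p ((0, 1) : R * R),
          Ck_on k' U (pd1 f) & Ck_on k' U (pd2 f)]
  end.

Definition smooth_on (U : set (R * R)) (f : R * R -> R) : Prop :=
  forall k, Ck_on k U f.

Definition harmonic_on (U : set (R * R)) (u : R * R -> R) : Prop :=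
  Ck_on 2 U u /\ forall p, U p -> pd1 (pd1 u) p + pd2 (pd2 u) p = 0.

Definition boundary (A : set (R * R)) : set (R * R) := closure A `\` A°.

(* Local C^oo defining functions: the domain lies on one side of its boundary,
   which is locally a regular level set. *)
Definition smooth_boundary (Omega : set (R * R)) : Prop :=
  forall p, boundary Omega p ->
    exists (U : set (R * R)) (phi : R * R -> R),
      [/\ open U, U p, smooth_on U phi,
          pd1 phi p <> 0 \/ pd2 phi p <> 0 &
          forall q, U q -> (Omega q <-> phi q < 0)].

Definition smooth_bounded_domain (Omega : set (R * R)) : Prop :=
  [/\ Omega !=set0, open Omega, connected Omega, bounded_set Omega &
      smooth_boundary Omega].

Definition unit_itv : set R := `[0, 1].

Definition path_in (A : set (R * R)) (g : R -> R * R) : Prop :=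
  {within unit_itv, continuous g} /\ g @` unit_itv `<=` A.

Definition path_connected (A : set (R * R)) : Prop :=
  forall p q, A p -> A q -> exists g, [/\ path_in A g, g 0 = p & g 1 = q].

(* Homotopy [K (s, t)]: [s] is the deformation parameter, [t] runs along the
   loop, and the base point stays fixed. *)
Definition contractible_loop (A : set (R * R)) (g : R -> R * R) : Prop :=
  exists K : R * R -> R * R,
    [/\ {within unit_itv `*` unit_itv, continuous K},
        K @` (unit_itv `*` unit_itv) `<=` A,
        (forall t, unit_itv t -> K (0, t) = g t),
        (forall t, unit_itv t -> K (1, t) = g 0) &
        (forall s, unit_itv s -> K (s, 0) = g 0 /\ K (s, 1) = g 0)].

Definition simply_connected (A : set (R * R)) : Prop :=
  path_connected A /\
  forall g, path_in A g -> g 0 = g 1 -> contractible_loop A g.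

Definition dirichlet_solution (Omega : set (R * R)) (b u : R * R -> R) : Prop :=
  [/\ harmonic_on Omega u, {within closure Omega, continuous u} &
      forall xi, boundary Omega xi -> u xi = b xi].

(* Values of [G a xi] for [a] outside [Omega] or [xi] outside the closure of
   [Omega], and on the diagonal, are irrelevant. *)
Definition green_function (Omega : set (R * R)) (G : R * R -> R * R -> R) :
    Prop :=
  forall a, Omega a ->
    [/\ harmonic_on (Omega `\ a) (G a),
        {within closure Omega `\ a, continuous (G a)},
        (forall xi, boundary Omega xi -> G a xi = 0) &
        G a xi / (- ln (eucl_dist a xi)) @[xi --> a^'] --> (1 : R)].

(* Harmonicity across [xi = a] is what determines [H a a]; the boundary values
   [H a xi = - ln (eucl_dist a xi)] follow from those of [G]. *)
Definition regular_part (Omega : set (R * R)) (G H : R * R -> R * R -> R) :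
    Prop :=
  forall a, Omega a ->
    harmonic_on Omega (H a) /\
    forall xi, closure Omega xi -> xi <> a ->
      G a xi = - ln (eucl_dist a xi) - H a xi.

Definition is_h1 (Omega : set (R * R)) (h1 : R * R -> R * R -> R) : Prop :=
  forall a, Omega a ->
    dirichlet_solution Omega (fun xi => (xi.1 - a.1) / eucl_dist xi a ^+ 2) (h1 a).

Definition is_h2 (Omega : set (R * R)) (h2 : R * R -> R * R -> R) : Prop :=
  forall a, Omega a ->
    dirichlet_solution Omega (fun xi => (xi.2 - a.2) / eucl_dist xi a ^+ 2) (h2 a).

Definition green_data (Omega : set (R * R)) (G H h1 h2 : R * R -> R * R -> R) :
    Prop :=
  [/\ green_function Omega G, regular_part Omega G H, is_h1 Omega h1 &
      is_h2 Omega h2].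

Definition robin (H : R * R -> R * R -> R) (a : R * R) : R := H a a.

Definition Htilde (h1 h2 : R * R -> R * R -> R) (a : R * R) : R :=
  pd1 (h1 a) a + pd2 (h2 a) a.

Definition critical_points (Omega : set (R * R)) (f : R * R -> R) :
    set (R * R) :=
  [set a | Omega a /\ is_diff a f (cst 0)].

Definition annulus (rho : R) : set (R * R) :=
  [set z | rho^-1 < eucl_dist z (0, 0) < rho].

End Plane.

(* Main.v *)
(* Simply connected case: complete H(a,.) to a holomorphic function with real
   part H(a,.), and let f be (z - a) times its exponential, so that
   |f| = exp(-G(a,.)) and, with the conjugate of H(a,.) vanishing at a,
   f'(a) = c := exp(H(a,a)).  On the boundary |f| = 1, hence
   1/(z - a) = k + c * conj f there, where k := 1/(z - a) - c/f stays bounded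
   near a.  The maximum principle, with G(a,.) dominating the bounded singularity at a, then gives
   h1 - i h2 = k + c * conj f on the domain minus a.  The holomorphic part k
   drops out of d_x h1 + d_y h2, which is therefore 2 c Re f'; at a this is
   2 c^2.

   Annulus: with Q = rho^2, both H(a,.) and h1 - i h2 are explicit Laurent
   series in the products conj(a) xi, xi/(Q a), 1/(conj(a) xi), a/(Q xi), plus
   a multiple of ln |xi|.  Hence H(a,a) and Htilde(a) are functions of |a|^2
   alone.  For a large rho the first one has derivatives of opposite signs at
   |a|^2 = 1 and |a|^2 = Q/512, so it is not injective in between and has a
   critical point there, while the second one has a negative derivative on the
   whole range. *)

From HB Require Import structures.
Require Import Defs.
From mathcomp Require Import all_boot all_order all_algebra.
From mathcomp Require Import all_classical all_reals all_analysis.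
From mathcomp Require Import ring lra zify.

Set Implicit Arguments.
Unset Strict Implicit.
Unset Printing Implicit Defensive.

Import Order.TTheory GRing.Theory Num.Theory.
Import numFieldNormedType.Exports.

Local Open Scope classical_set_scope.
Local Open Scope ring_scope.

(** * Differential calculus in the plane *)

(** Simple connectedness serves to produce harmonic conjugates. It is stated here through loops
    contractible with a fixed base point, so a conjugate has to be built by continuing local
    primitives along paths and across homotopies; the lifts below do this. The part k leaves the
    divergence because h1 = Re k, h2 = - Im k give d_x h1 + d_y h2 = 0 by Cauchy-Riemann, whereas
    conj f contributes h1 = Re f, h2 = Im f, of divergence 2 Re f'.

    The series of the annulus come from the method of images: a is reflected alternately in both
    circles, and summing over the number of reflections yields the coefficients 1 / (Q^n - Q^-n).

    Two competing inequalities fix rho. Put L = ln rho. At |a|^2 = Q/512 the slope of H(a,a), times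
    |a|^2, is about 1/512 - ln 512 / (4 L), which asks for a large L. For Htilde the term - 1/(2 L)
    must outweigh a series that, for |a|^2 <= Q/256, has a bound independent of rho; this limits L
    from above. A power of 2 is taken for rho so that every logarithm is a multiple of ln 2. *)

Section Differentials.
Context {R : realType} {V W : normedModType R}.

(** The expansion characterises the differential because a continuous linear map with this property
    is unique. Here [df] is a bare function, so that explicit formulas can serve as
    differentials. *)
Lemma is_diff_epsP (f df : V -> W) (x : V) :
  linear df -> continuous df ->
  is_diff x f df <->
  (forall e, 0 < e -> \forall h \near (0 : V), `|f (h + x) - f x - df h| <= e * `|h|).
Proof.
move=> ldf cdf.
pose scallM := GRing.isLinear.Build _ _ _ _ _ ldf.
pose L : {linear V -> W} := HB.pack df scallM.
split=> [[dfx dv] e e0|H].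
  have /eqaddoP := diff_locally dfx.
  move=> /(_ e e0); apply: filterS => h.
  by rewrite !fctE /= dv opprD addrA.
have E : f \o shift x = cst (f x) + L +o_ 0 id.
  apply/eqaddoP => e e0; apply: filterS (H e e0) => h.
  by rewrite !fctE /= opprD addrA.
have dE : 'd f x = L :> (V -> W) by apply: diff_unique.
apply: DiffDef; last by rewrite dE.
by apply/diff_locallyP; rewrite dE.
Qed.

Lemma is_diff_near (f g df : V -> W) (x : V) :
  (\forall y \near x, f y = g y) -> is_diff x f df -> is_diff x g df.
Proof.
move=> fg hf.
have [dfx dv] := hf.
have ldf : linear df by rewrite -dv; exact: linearP.
have cdf : continuous df by rewrite -dv; exact: diff_continuous.
apply/is_diff_epsP => // e e0.
have /is_diff_epsP-/(_ ldf cdf) := hf => /(_ e e0).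
have fgx := nbhs_singleton fg.
have fg0 : \forall h \near (0 : V), f (h + x) = g (h + x).
  by move: fg; rewrite (near_shift 0); apply: filterS => h /=; rewrite subr0.
apply: filterS2 fg0 => h -> ; by rewrite fgx.
Qed.

End Differentials.

Section PlaneCalculus.
Context {R : realType}.
Implicit Types (u v : R * R -> R) (p q h : R * R) (a b c d : R).

(** Frechet differentiability, with the gradient given by two numbers. Existence of the partial
    derivatives alone would neither survive composition nor imply continuity. *)
Definition has_grad u a b p := is_diff p u (fun h : R * R => a * h.1 + b * h.2).

Lemma linear_form_linear a b : linear (fun h : R * R => a * h.1 + b * h.2 : R^o).
Proof. by move=> k x y /=; rewrite /GRing.scale /=; ring. Qed.

Lemma continuous_fst : continuous (fst : R * R -> R).
Proof. by move=> x; exact: cvg_fst. Qed.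

Lemma continuous_snd : continuous (snd : R * R -> R).
Proof. by move=> x; exact: cvg_snd. Qed.

Lemma linear_form_continuous a b : continuous (fun h : R * R => a * h.1 + b * h.2).
Proof.
move=> x; apply: cvgD; apply: cvgM; [exact: cvg_cst|exact: continuous_fst|
  exact: cvg_cst|exact: continuous_snd].
Qed.

Lemma has_gradP u a b p : has_grad u a b p <->
  forall e, 0 < e -> \forall h \near (0 : R * R),
    `|u (h + p) - u p - (a * h.1 + b * h.2)| <= e * `|h|.
Proof.
by apply: is_diff_epsP; [exact: linear_form_linear|exact: linear_form_continuous].
Qed.

Lemma has_grad_eq u v a b c d p : has_grad u a b p -> u =1 v -> a = c -> b = d ->
  has_grad v c d p.
Proof. by move=> hu /funext <- <- <-. Qed.

Lemma has_grad_near u v a b p : (\forall q \near p, u q = v q) ->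
  has_grad u a b p -> has_grad v a b p.
Proof. exact: is_diff_near. Qed.

Lemma has_grad_linear a b p : has_grad (fun q => a * q.1 + b * q.2) a b p.
Proof.
apply/has_gradP => e e0; near=> h.
by rewrite (_ : _ - _ = 0) ?normr0 ?mulr_ge0 ?(ltW e0)//=; ring.
Unshelve. all: by end_near. Qed.

Lemma has_grad_cst c p : has_grad (cst c) 0 0 p.
Proof.
apply/has_gradP => e e0; near=> h.
by rewrite (_ : _ - _ = 0) ?normr0 ?mulr_ge0 ?(ltW e0)//=; ring.
Unshelve. all: by end_near. Qed.

Lemma has_grad_fst p : has_grad fst 1 0 p.
Proof. by apply: has_grad_eq (has_grad_linear 1 0 p) _ _ _ => //= q; ring. Qed.

Lemma has_grad_snd p : has_grad snd 0 1 p.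
Proof. by apply: has_grad_eq (has_grad_linear 0 1 p) _ _ _ => //= q; ring. Qed.

Lemma has_gradD u v a b c d p : has_grad u a b p -> has_grad v c d p ->
  has_grad (fun q => u q + v q) (a + c) (b + d) p.
Proof.
move=> hu hv; rewrite /has_grad.
refine (is_diff_eq (is_diffD hu hv) _).
apply/funext => h /=; by rewrite !fctE /=; ring.
Qed.

Lemma has_gradB u v a b c d p : has_grad u a b p -> has_grad v c d p ->
  has_grad (fun q => u q - v q) (a - c) (b - d) p.
Proof.
move=> hu hv; rewrite /has_grad.
refine (is_diff_eq (is_diffB hu hv) _).
apply/funext => h /=; by rewrite !fctE /=; ring.
Qed.

Lemma has_gradM u v a b c d p : has_grad u a b p -> has_grad v c d p ->
  has_grad (fun q => u q * v q) (a * v p + u p * c) (b * v p + u p * d) p.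
Proof.
move=> hu hv; rewrite /has_grad.
refine (is_diff_eq (is_diffM hu hv) _).
by apply/funext => h /=; rewrite !fctE /= /GRing.scale /=; ring.
Qed.

Lemma has_grad_comp1 (g : R -> R) (g' : R) u a b p :
  is_derive (u p) 1 g g' -> has_grad u a b p ->
  has_grad (fun q => g (u q)) (g' * a) (g' * b) p.
Proof.
move=> hg hu; rewrite /has_grad.
have hg' : is_diff (u p) g (fun h : R => g' * h).
  have dg : differentiable g (u p) by apply/derivable1_diffP; exact: ex_derive.
  apply: DiffDef => //.
  by rewrite diff1E // derive1E derive_val; apply/funext => h; rewrite mulrC.
refine (is_diff_eq (is_diff_comp hu hg') _).
by apply/funext => h /=; ring.
Qed.

Lemma has_grad_comp2 u a b (f g : R * R -> R) c d c' d' p :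
  has_grad u a b (f p, g p) -> has_grad f c d p -> has_grad g c' d' p ->
  has_grad (fun q => u (f q, g q)) (a * c + b * c') (a * d + b * d') p.
Proof.
move=> hu hf hg; rewrite /has_grad.
have hfg := is_diff_pair hf hg.
refine (is_diff_eq (is_diff_comp hfg hu) _).
by apply/funext => h /=; ring.
Qed.

Lemma has_grad_continuous u a b p : has_grad u a b p -> {for p, continuous u}.
Proof. by rewrite /has_grad => hu; apply: differentiable_continuous. Qed.

Lemma has_grad_is_derive u a b p (v : R * R) : has_grad u a b p ->
  is_derive p v u (a * v.1 + b * v.2).
Proof.
rewrite /has_grad => hu; apply: DeriveDef; first exact: diff_derivable.
by rewrite deriveE // diff_val.
Qed.

Lemma has_grad_pd1 u a b p : has_grad u a b p ->
  derivable u p (1, 0) /\ pd1 u p = a.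
Proof.
move=> /(has_grad_is_derive (1, 0))[? dE]; split=> //.
by rewrite /pd1 dE /= mulr1 mulr0 addr0.
Qed.

Lemma has_grad_pd2 u a b p : has_grad u a b p ->
  derivable u p (0, 1) /\ pd2 u p = b.
Proof.
move=> /(has_grad_is_derive (0, 1))[? dE]; split=> //.
by rewrite /pd2 dE /= mulr1 mulr0 add0r.
Qed.

Lemma has_grad_curve u a b (f g : R -> R) (f' g' t : R) :
  has_grad u a b (f t, g t) -> is_derive t 1 f f' -> is_derive t 1 g g' ->
  is_derive t 1 (fun s => u (f s, g s)) (a * f' + b * g').
Proof.
move=> hu hf hg.
have tod (k : R -> R) k' : is_derive t 1 k k' -> is_diff t k (fun h : R => k' * h).
  move=> hk; have dk : differentiable k t by apply/derivable1_diffP; exact: ex_derive.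
  apply: DiffDef => //.
  by rewrite diff1E // derive1E derive_val; apply/funext => h; rewrite mulrC.
have := is_diff_comp (is_diff_pair (tod _ _ hf) (tod _ _ hg)) hu => hc.
apply: DeriveDef; first exact/derivable1_diffP/(@ex_diff _ _ _ _ _ _ _ hc).
have dd : differentiable (fun s : R => u (f s, g s)) t.
  exact: (@ex_diff _ _ _ _ _ _ _ hc).
rewrite deriveE //.
by rewrite (@diff_val _ _ _ _ _ _ _ hc) /=; ring.
Qed.

End PlaneCalculus.

(** * Partial derivatives, the C^1 criterion, equality of mixed partials *)

Section PartialDerivatives.
Context {R : realType}.
Implicit Types (u v f g : R * R -> R) (p q : R * R) (U : set (R * R)).

Lemma slice1P u p d : is_derive p.1 1 (fun t : R => u (t, p.2)) d <->
  derivable u p (1, 0) /\ pd1 u p = d.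
Proof.
have E : (fun h : R => h^-1 *: ((u \o shift p) (h *: ((1, 0) : R * R)) - u p)) =
         (fun h : R => h^-1 *: (((fun t : R => u (t, p.2)) \o shift p.1) (h *: (1 : R)) - u (p.1, p.2))).
  apply/funext => h /=; congr (_ *: (u _ - u _)); last by case: (p).
  by apply/pair_eqP; rewrite /= scaler0 add0r !eqxx.
split=> [[dd dE]|[dd dE]].
  by split; [rewrite /derivable E|rewrite /pd1 /derive E].
by apply: DeriveDef; [rewrite /derivable -E|rewrite /derive -E].
Qed.

Lemma slice2P u p d : is_derive p.2 1 (fun t : R => u (p.1, t)) d <->
  derivable u p (0, 1) /\ pd2 u p = d.
Proof.
have E : (fun h : R => h^-1 *: ((u \o shift p) (h *: ((0, 1) : R * R)) - u p)) =
         (fun h : R => h^-1 *: (((fun t : R => u (p.1, t)) \o shift p.2) (h *: (1 : R)) - u (p.1, p.2))).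
  apply/funext => h /=; congr (_ *: (u _ - u _)); last by case: (p).
  by apply/pair_eqP; rewrite /= scaler0 add0r !eqxx.
split=> [[dd dE]|[dd dE]].
  by split; [rewrite /derivable E|rewrite /pd2 /derive E].
by apply: DeriveDef; [rewrite /derivable -E|rewrite /derive -E].
Qed.

Lemma slice1_derive u x y : derivable u (x, y) (1, 0) ->
  is_derive x 1 (fun t : R => u (t, y)) (pd1 u (x, y)).
Proof. by move=> du; apply: (iffRL (slice1P u (x, y) _)). Qed.

Lemma slice2_derive u x y : derivable u (x, y) (0, 1) ->
  is_derive y 1 (fun t : R => u (x, t)) (pd2 u (x, y)).
Proof. by move=> du; apply: (iffRL (slice2P u (x, y) _)). Qed.

Lemma mean_value (f df : R -> R) (x h : R) :
  (forall t, `|t - x| <= `|h| -> is_derive t 1 f (df t)) ->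
  exists2 t, `|t - x| <= `|h| & f (x + h) - f x = df t * h.
Proof.
move=> H.
have [h0|h0|->] := ltgtP h 0; last first.
- by exists x; rewrite ?subrr ?normr0// addr0 subrr mulr0.
- have [|||t] := @MVT _ f df x (x + h); first by rewrite ltrDl.
  + move=> t; rewrite in_itv /= => /andP[t1 t2]; apply: H.
    by rewrite (gtr0_norm h0) ger0_norm; lra.
  + apply: derivable_within_continuous => t; rewrite in_itv /= => /andP[t1 t2].
    suff: is_derive t 1 f (df t) by [].
    by apply: H; rewrite (gtr0_norm h0) ger0_norm; lra.
  + rewrite in_itv /= => /andP[t1 t2] E; exists t.
      by rewrite (gtr0_norm h0) ger0_norm; lra.
    by rewrite E; congr (_ * _); ring.
- have [|||t] := @MVT _ f df (x + h) x; first by rewrite gtrDl.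
  + move=> t; rewrite in_itv /= => /andP[t1 t2]; apply: H.
    by rewrite (ltr0_norm h0) ler0_norm; lra.
  + apply: derivable_within_continuous => t; rewrite in_itv /= => /andP[t1 t2].
    suff: is_derive t 1 f (df t) by [].
    by apply: H; rewrite (ltr0_norm h0) ler0_norm; lra.
  + rewrite in_itv /= => /andP[t1 t2] E; exists t.
      by rewrite (ltr0_norm h0) ler0_norm; lra.
    by rewrite -opprB E; ring.
Qed.

Lemma mean_value1 u (x y h : R) :
  (forall t, `|t - x| <= `|h| -> derivable u (t, y) (1, 0)) ->
  exists2 t, `|t - x| <= `|h| & u (x + h, y) - u (x, y) = pd1 u (t, y) * h.
Proof.
move=> H; apply: (@mean_value (fun t => u (t, y)) (fun t => pd1 u (t, y))) => t tx.
exact: slice1_derive (H t tx).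
Qed.

Lemma mean_value2 u (x y h : R) :
  (forall t, `|t - y| <= `|h| -> derivable u (x, t) (0, 1)) ->
  exists2 t, `|t - y| <= `|h| & u (x, y + h) - u (x, y) = pd2 u (x, t) * h.
Proof.
move=> H; apply: (@mean_value (fun t => u (x, t)) (fun t => pd2 u (x, t))) => t tx.
exact: slice2_derive (H t tx).
Qed.

Lemma norm_fst_le (h : R * R) : `|h.1| <= `|h|.
Proof. by rewrite prod_normE le_max lexx. Qed.

Lemma norm_snd_le (h : R * R) : `|h.2| <= `|h|.
Proof. by rewrite prod_normE le_max lexx orbT. Qed.

Lemma continuous_near_dist u p e : {for p, continuous u} -> 0 < e ->
  \forall q \near p, `|u q - u p| < e.
Proof.
move=> /cvgrPdist_lt cu e0; apply: filterS (cu e e0) => q.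
by rewrite distrC.
Qed.

Lemma split_increment (a b c k l m n h1 h2 : R) : a - b = k * h1 -> b - c = m * h2 ->
  a - c - (l * h1 + n * h2) = (k - l) * h1 + (m - n) * h2.
Proof. by rewrite !mulrBl => <- <-; ring. Qed.

(** The increment is split into a vertical step at abscissa [p.1] and a horizontal one at height
    [p.2 + h.2]. The mean value theorem on each leaves only the variation of the two partials near
    [p], which is below e/2. *)
Lemma C1_has_grad u p :
  (\forall q \near p, derivable u q (1, 0) /\ derivable u q (0, 1)) ->
  {for p, continuous (pd1 u)} -> {for p, continuous (pd2 u)} ->
  has_grad u (pd1 u p) (pd2 u p) p.
Proof.
move=> du c1 c2; apply/has_gradP => e e0.
have e20 : 0 < e / 2 by rewrite divr_gt0.
have {}c1 := continuous_near_dist c1 e20.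
have {}c2 := continuous_near_dist c2 e20.
have [r /= r0 H] := (iffLR (nbhs_ballP _ _)) (filterI du (filterI c1 c2)).
have := @nbhs0_lt _ (R * R)%type _ r0; apply: filterS => h hr.
have near_h q : `|q.1 - p.1| <= `|h.1| -> `|q.2 - p.2| <= `|h.2| -> 
    ball p r q.
  move=> q1 q2; split; rewrite /ball /= distrC.
    by rewrite (le_lt_trans q1)// (le_lt_trans _ hr) ?norm_fst_le.
  by rewrite (le_lt_trans q2)// (le_lt_trans _ hr) ?norm_snd_le.
have near_h1 : `|p.1 - p.1| <= `|h.1| by rewrite subrr normr0.
have near_h2 : `|p.2 + h.2 - p.2| <= `|h.2| by rewrite addrC addKr.
have [t th|x xh E1] := @mean_value1 u p.1 (p.2 + h.2) h.1.
  by have [[Hd _] _] := H (t, p.2 + h.2) (near_h (t, p.2 + h.2) th near_h2).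
have [t th|y yh E2] := @mean_value2 u p.1 p.2 h.2.
  by have [[_ Hd] _] := H (p.1, t) (near_h (p.1, t) near_h1 th).
have [_ [F1 _]] := H (x, p.2 + h.2) (near_h (x, p.2 + h.2) xh near_h2).
have [_ [_ F2]] := H (p.1, y) (near_h (p.1, y) near_h1 yh).
rewrite (_ : _ - _ - _ = (pd1 u (x, p.2 + h.2) - pd1 u p) * h.1 + (pd2 u (p.1, y) - pd2 u p) * h.2).
  apply: le_trans (ler_normD _ _) _; rewrite !normrM (splitr e) mulrDl.
  apply: lerD; apply: ler_pM (normr_ge0 _) (normr_ge0 _) _ _.
  - exact: ltW F1.
  - exact: norm_fst_le.
  - exact: ltW F2.
  - exact: norm_snd_le.
have -> : h + p = (p.1 + h.1, p.2 + h.2) by apply/pair_eqP; rewrite /= ![p.1 + _]addrC ![p.2 + _]addrC !eqxx.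
have -> : u p = u (p.1, p.2) by case: (p).
exact: (split_increment _ _ E1 E2).
Qed.

Lemma close_both_ways (k k' m m' : R) :
  `|k - m| < `|m - m'| / 2 -> `|k' - m'| < `|m - m'| / 2 -> k = k' -> False.
Proof.
move=> + + kk; rewrite -{}kk => l1 l2; have := ler_distD k m m'.
by apply/negP; rewrite -ltNge [ltRHS]splitr ltrD // distrC.
Qed.

(* Both mixed partials are limits of the same second difference quotient. *)
Lemma mixed_partials u p :
  (\forall q \near p, [/\ derivable u q (1, 0), derivable u q (0, 1),
     derivable (pd1 u) q (0, 1) & derivable (pd2 u) q (1, 0)]) ->
  {for p, continuous (pd2 (pd1 u))} -> {for p, continuous (pd1 (pd2 u))} ->
  pd2 (pd1 u) p = pd1 (pd2 u) p.
Proof.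
move=> du c1 c2; apply/eqP/negPn/negP => neq.
pose e := `|pd2 (pd1 u) p - pd1 (pd2 u) p| / 2.
have e0 : 0 < e by rewrite divr_gt0 // normr_gt0 subr_eq0.
have {}c1 := continuous_near_dist c1 e0.
have {}c2 := continuous_near_dist c2 e0.
have [r /= r0 H] := (iffLR (nbhs_ballP _ _)) (filterI du (filterI c1 c2)).
pose h := r / 2.
have h0 : 0 < h by rewrite divr_gt0.
have near_h x y : `|x - p.1| <= `|h| -> `|y - p.2| <= `|h| -> ball p r (x, y).
  have hr : `|h| < r by rewrite gtr0_norm // /h; lra.
  by move=> q1 q2; split; rewrite /ball /= distrC (le_lt_trans _ hr).
have h0h : `|p.1 - p.1| <= `|h| by rewrite subrr normr0.
have h0h' : `|p.2 - p.2| <= `|h| by rewrite subrr normr0.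
have hh1 : `|p.1 + h - p.1| <= `|h| by rewrite addrC addKr.
have hh2 : `|p.2 + h - p.2| <= `|h| by rewrite addrC addKr.
have Hd x y (hx : `|x - p.1| <= `|h|) (hy : `|y - p.2| <= `|h|) := (H (x, y) (near_h x y hx hy)).1.
have D1 t : `|t - p.1| <= `|h| ->
    is_derive t 1 (fun s => u (s, p.2 + h) - u (s, p.2)) (pd1 u (t, p.2 + h) - pd1 u (t, p.2)).
  move=> th; apply: is_deriveB.
    by have [? _ _ _] := Hd t _ th hh2; exact: slice1_derive.
  by have [? _ _ _] := Hd t _ th h0h'; exact: slice1_derive.
have D2 t : `|t - p.2| <= `|h| ->
    is_derive t 1 (fun s => u (p.1 + h, s) - u (p.1, s)) (pd2 u (p.1 + h, t) - pd2 u (p.1, t)).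
  move=> th; apply: is_deriveB.
    by have [_ ? _ _] := Hd _ t hh1 th; exact: slice2_derive.
  by have [_ ? _ _] := Hd _ t h0h th; exact: slice2_derive.
have [x xh E1] := mean_value D1.
have [y yh E2] := mean_value D2.
have [|y' yh' F1] := @mean_value2 (pd1 u) x p.2 h.
  by move=> t th; have [_ _ ? _] := Hd _ t xh th.
have [|x' xh' F2] := @mean_value1 (pd2 u) p.1 y h.
  by move=> t th; have [_ _ _ ?] := Hd t _ th yh.
rewrite F1 in E1; rewrite F2 in E2.
have AB : u (p.1 + h, p.2 + h) - u (p.1 + h, p.2) - (u (p.1, p.2 + h) - u (p.1, p.2)) =
    u (p.1 + h, p.2 + h) - u (p.1, p.2 + h) - (u (p.1 + h, p.2) - u (p.1, p.2)) by ring.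
have E : pd2 (pd1 u) (x, y') = pd1 (pd2 u) (x', y).
  have hn : h != 0 by rewrite gt_eqF.
  apply: (mulIf hn); apply: (mulIf hn).
  exact: etrans (esym E1) (etrans AB E2).
have [_ [G1 _]] := H (x, y') (near_h _ _ xh yh').
have [_ [_ G2]] := H (x', y) (near_h _ _ xh' yh).
exact: close_both_ways G1 G2 E.
Qed.

End PartialDerivatives.

(** * C^k and harmonic functions on open sets *)

Section HarmonicOn.
Context {R : realType}.
Implicit Types (u v f g : R * R -> R) (p q : R * R) (U V : set (R * R)).

Lemma eq_on_near U p f g : open U -> (forall q, U q -> f q = g q) -> U p ->
  \forall q \near p, f q = g q.
Proof.
move=> oU fg Up; have := open_nbhs_nbhs (conj oU Up).
by apply: filterS => q /fg.
Qed.

Lemma derivable_eq_on U p f g (d : R * R) : open U ->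
  (forall q, U q -> f q = g q) -> U p ->
  derivable f p d -> derivable g p d.
Proof. move=> oU fg Up; exact/near_eq_derivable/(eq_on_near oU). Qed.

Lemma derive_eq_on U p f g (d : R * R) : open U ->
  (forall q, U q -> f q = g q) -> U p -> 'D_d f p = 'D_d g p.
Proof. move=> oU fg Up; exact/near_eq_derive/(eq_on_near oU). Qed.

Lemma pd1_eq_on U f g : open U -> (forall q, U q -> f q = g q) ->
  forall p, U p -> pd1 f p = pd1 g p.
Proof. move=> oU fg p Up; exact: (derive_eq_on _ oU fg Up). Qed.

Lemma pd2_eq_on U f g : open U -> (forall q, U q -> f q = g q) ->
  forall p, U p -> pd2 f p = pd2 g p.
Proof. move=> oU fg p Up; exact: (derive_eq_on _ oU fg Up). Qed.

Lemma pd1_comb f g (a b : R) p : derivable f p (1, 0) -> derivable g p (1, 0) ->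
  derivable (fun q => a * f q + b * g q) p (1, 0) /\ pd1 (fun q => a * f q + b * g q) p = a * pd1 f p + b * pd1 g p.
Proof.
move=> df dg.
by have [] := is_deriveD (is_deriveZ a (derivableP df)) (is_deriveZ b (derivableP dg)).
Qed.

Lemma pd2_comb f g (a b : R) p : derivable f p (0, 1) -> derivable g p (0, 1) ->
  derivable (fun q => a * f q + b * g q) p (0, 1) /\ pd2 (fun q => a * f q + b * g q) p = a * pd2 f p + b * pd2 g p.
Proof.
move=> df dg.
by have [] := is_deriveD (is_deriveZ a (derivableP df)) (is_deriveZ b (derivableP dg)).
Qed.

#[local] Opaque pd1 pd2.

Lemma continuous_eq_on U p f g : open U ->
  (forall q, U q -> f q = g q) -> U p ->
  {for p, continuous f} -> {for p, continuous g}.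
Proof.
move=> oU fg Up cf; have fgp := eq_on_near oU fg Up.
suff: g q @[q --> p] --> g p by [].
rewrite -(fg _ Up); apply: cvg_trans cf.
by apply: near_eq_cvg; apply: filterS fgp => q ->.
Qed.

(** Derivatives are local and [U] is open, so the values of [f] and [g] outside [U] have no
    influence at any order. *)
Lemma Ck_on_ext k U f g : open U -> (forall p, U p -> f p = g p) ->
  Ck_on k U f -> Ck_on k U g.
Proof.
move=> oU; elim: k f g => [|k IH] f g fg /=.
  by move=> cf p Up; apply: (continuous_eq_on oU fg Up); exact: cf.
case=> df c1 c2; split.
- by move=> p Up; have [d1 d2] := df p Up; split; exact: derivable_eq_on fg Up _.
- by apply: IH c1 => p Up; exact: (pd1_eq_on oU fg).
- by apply: IH c2 => p Up; exact: (pd2_eq_on oU fg).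
Qed.

Lemma Ck_on_sub k U V f : U `<=` V -> Ck_on k V f -> Ck_on k U f.
Proof.
move=> UV; elim: k f => [|k IH] f /=; first by move=> cf p /UV; exact: cf.
by case=> df c1 c2; split; [move=> p /UV/df|exact: IH|exact: IH].
Qed.

Lemma Ck_on_comb k U f g (a b : R) : open U -> Ck_on k U f -> Ck_on k U g ->
  Ck_on k U (fun q => a * f q + b * g q).
Proof.
move=> oU; elim: k f g => [|k IH] f g /=.
  move=> cf cg p Up; apply: cvgD; apply: cvgM; [exact: cvg_cst|exact: cf|exact: cvg_cst|exact: cg].
case=> df cf1 cf2 [dg cg1 cg2]; split.
- move=> p Up; have [f1 f2] := df p Up; have [g1 g2] := dg p Up.
  by split; [have [] := pd1_comb a b f1 g1|have [] := pd2_comb a b f2 g2].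
- apply: (Ck_on_ext oU _ (IH _ _ cf1 cg1)) => p Up.
  have [f1 _] := df p Up; have [g1 _] := dg p Up.
  exact: esym (pd1_comb a b f1 g1).2.
- apply: (Ck_on_ext oU _ (IH _ _ cf2 cg2)) => p Up.
  have [_ f2] := df p Up; have [_ g2] := dg p Up.
  exact: esym (pd2_comb a b f2 g2).2.
Qed.

Lemma harmonic_on_ext U f g : open U -> (forall p, U p -> f p = g p) ->
  harmonic_on U f -> harmonic_on U g.
Proof.
move=> oU fg [cf hf]; split; first exact: Ck_on_ext oU fg cf.
move=> p Up.
have E1 := pd1_eq_on oU (pd1_eq_on oU fg) Up.
have E2 := pd2_eq_on oU (pd2_eq_on oU fg) Up.
exact: etrans (congr2 +%R (esym E1) (esym E2)) (hf p Up).
Qed.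

Lemma harmonic_on_sub U V f : U `<=` V -> harmonic_on V f -> harmonic_on U f.
Proof.
by move=> UV [cf hf]; split; [exact: Ck_on_sub UV cf|move=> p /UV; exact: hf].
Qed.

Lemma harmonic_on_comb U f g (a b : R) : open U -> harmonic_on U f ->
  harmonic_on U g -> harmonic_on U (fun q => a * f q + b * g q).
Proof.
move=> oU [cf hf] [cg hg]; split; first exact: Ck_on_comb.
move=> p Up; case: cf => df [df1 _ _] [df2 _ _]; case: cg => dg [dg1 _ _] [dg2 _ _].
have E1 q (Uq : U q) := (pd1_comb a b (df q Uq).1 (dg q Uq).1).2.
have E2 q (Uq : U q) := (pd2_comb a b (df q Uq).2 (dg q Uq).2).2.
have F1 := (pd1_comb a b (df1 p Up).1 (dg1 p Up).1).2.
have F2 := (pd2_comb a b (df2 p Up).2 (dg2 p Up).2).2.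
apply: etrans (congr2 +%R (etrans (pd1_eq_on oU E1 Up) F1) (etrans (pd2_eq_on oU E2 Up) F2)) _.
have sum0 (x1 x2 y1 y2 : R) : x1 + x2 = 0 -> y1 + y2 = 0 ->
    a * x1 + b * y1 + (a * x2 + b * y2) = 0.
  by move=> e1 e2; rewrite addrACA -!mulrDr e1 e2 !mulr0 addr0.
exact: sum0 (hf p Up) (hg p Up).
Qed.

Lemma Ck1_has_grad U f p : open U -> Ck_on 1 U f -> U p ->
  has_grad f (pd1 f p) (pd2 f p) p.
Proof.
move=> oU [df c1 c2] Up; apply: C1_has_grad; [|exact: c1|exact: c2].
have := open_nbhs_nbhs (conj oU Up).
by apply: filterS => q /df.
Qed.

(** For positive [k] the definition speaks of the partials of [f] and not of its continuity. The
    partials are continuous by induction, so the C^1 criterion gives differentiability, hence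
    continuity. *)
Lemma Ck_on_continuous k U f p : open U -> Ck_on k U f -> U p -> {for p, continuous f}.
Proof.
move=> oU; elim: k f => [|k IH] f; first by apply.
move=> [df c1 c2] Up; apply: has_grad_continuous (C1_has_grad _ _ _).
- by have := open_nbhs_nbhs (conj oU Up); apply: filterS => q /df.
- exact: (IH _ c1 Up).
- exact: (IH _ c2 Up).
Qed.

Lemma Ck_onW k U f : open U -> Ck_on k.+1 U f -> Ck_on k U f.
Proof.
move=> oU; elim: k f => [|k IH] f; first by move=> cf p; exact: (Ck_on_continuous oU cf).
by case=> df c1 c2; split; [exact: df|exact: (IH _ c1)|exact: (IH _ c2)].
Qed.

Lemma harmonic_on_continuous U f p : open U -> harmonic_on U f -> U p ->
  {for p, continuous f}.
Proof. by move=> oU [cf _]; exact: (Ck_on_continuous oU cf). Qed.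

End HarmonicOn.

(** * Holomorphic functions *)

Section ComplexPlane.
Context {R : realType}.
Implicit Types (z w c : R * R) (f g : R * R -> R * R) (U V : set (R * R)).

Definition cmul z w : R * R := (z.1 * w.1 - z.2 * w.2, z.1 * w.2 + z.2 * w.1).
Definition sqmod z : R := z.1 ^+ 2 + z.2 ^+ 2.
Definition cconj z : R * R := (z.1, - z.2).
(** The value at 0 is 0, which lets [sqmod_inv] and [cinvM] hold without side conditions. *)
Definition cinv z : R * R := (z.1 / sqmod z, - z.2 / sqmod z).
Definition cexp z : R * R := (expR z.1 * cos z.2, expR z.1 * sin z.2).

(* The Cauchy-Riemann equations are built in. *)
Definition has_cderiv f c p :=
  has_grad (fun z => (f z).1) c.1 (- c.2) p /\ has_grad (fun z => (f z).2) c.2 c.1 p.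

(** The successive complex derivatives are carried as witnesses. Regularity of holomorphic functions
    is thus built up by the closure lemmas, and Cauchy's integral formula is avoided. *)
Fixpoint hol (k : nat) U f : Prop :=
  match k with
  | 0 => forall p, U p -> {for p, continuous (fun z => (f z).1)} /\
                          {for p, continuous (fun z => (f z).2)}
  | k'.+1 => exists2 f', (forall p, U p -> has_cderiv f (f' p) p) & hol k' U f'
  end.

Lemma sqmod_ge0 z : 0 <= sqmod z.
Proof. by rewrite addr_ge0 ?sqr_ge0. Qed.

Lemma sqmod_eq0 z : (sqmod z == 0) = (z == 0).
Proof.
rewrite paddr_eq0 ?sqr_ge0 // !sqrf_eq0.
by case: z.
Qed.

Lemma sqmod_gt0 z : (0 < sqmod z) = (z != 0).
Proof. by rewrite lt_neqAle sqmod_ge0 andbT eq_sym sqmod_eq0. Qed.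

Lemma sqmodM z w : sqmod (cmul z w) = sqmod z * sqmod w.
Proof. rewrite /sqmod /=; ring. Qed.

Lemma sqmod_inv z : sqmod (cinv z) = (sqmod z)^-1.
Proof.
have [->|z0] := eqVneq z 0.
  by rewrite /sqmod /cinv /= oppr0 !mul0r expr0n /= addr0 invr0.
have : sqmod z != 0 by rewrite sqmod_eq0.
by rewrite {2 3}/sqmod /cinv /sqmod /= => h; field.
Qed.

Lemma sqmod_conj z : sqmod (cconj z) = sqmod z.
Proof. by rewrite /sqmod /= sqrrN. Qed.

Lemma sqmod_exp z : sqmod (cexp z) = expR (2 * z.1).
Proof.
rewrite /sqmod /= !exprMn -mulrDr cos2Dsin2 mulr1 -expRM_natl.
by congr expR; rewrite mulr_natl.
Qed.

Lemma cmulC z w : cmul z w = cmul w z.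
Proof. by rewrite /cmul; congr pair; ring. Qed.

Lemma cmulA z w c : cmul z (cmul w c) = cmul (cmul z w) c.
Proof. by rewrite /cmul /=; congr pair; ring. Qed.

Lemma cmul1 z : cmul (1, 0) z = z.
Proof. by rewrite /cmul /= [RHS]surjective_pairing; congr pair; ring. Qed.

Lemma cmulV z : z != 0 -> cmul z (cinv z) = (1, 0).
Proof.
rewrite -sqmod_eq0 => z0; rewrite /cmul /cinv /=.
by congr pair; move: z0; rewrite /sqmod => z0; field.
Qed.

Lemma cexp_neq0 z : cexp z != 0.
Proof. by rewrite -sqmod_gt0 sqmod_exp expR_gt0. Qed.

Lemma has_cderiv_eq f g c d p : has_cderiv f c p -> f =1 g -> c = d -> has_cderiv g d p.
Proof. by move=> hf /funext <- <-. Qed.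

Lemma has_cderiv_cst c p : has_cderiv (cst c) 0 p.
Proof. by split; apply: has_grad_eq (has_grad_cst _ p) _ _ _ => //=; rewrite oppr0. Qed.

Lemma has_cderiv_id p : has_cderiv id (1, 0) p.
Proof.
split; first by apply: has_grad_eq (has_grad_fst p) _ _ _ => //=; rewrite oppr0.
exact: has_grad_snd.
Qed.

Lemma has_cderivD f g c d p : has_cderiv f c p -> has_cderiv g d p ->
  has_cderiv (fun z => f z + g z) (c + d) p.
Proof.
move=> [f1 f2] [g1 g2]; split.
  by apply: has_grad_eq (has_gradD f1 g1) _ _ _ => //=; ring.
by apply: has_grad_eq (has_gradD f2 g2) _ _ _ => //=; ring.
Qed.

Lemma has_cderivB f g c d p : has_cderiv f c p -> has_cderiv g d p ->
  has_cderiv (fun z => f z - g z) (c - d) p.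
Proof.
move=> [f1 f2] [g1 g2]; split.
  by apply: has_grad_eq (has_gradB f1 g1) _ _ _ => //=; ring.
by apply: has_grad_eq (has_gradB f2 g2) _ _ _ => //=; ring.
Qed.

Lemma has_cderivM f g c d p : has_cderiv f c p -> has_cderiv g d p ->
  has_cderiv (fun z => cmul (f z) (g z)) (cmul c (g p) + cmul (f p) d) p.
Proof.
move=> [f1 f2] [g1 g2]; split.
  by apply: has_grad_eq (has_gradB (has_gradM f1 g1) (has_gradM f2 g2)) _ _ _ => //=; ring.
by apply: has_grad_eq (has_gradD (has_gradM f1 g2) (has_gradM f2 g1)) _ _ _ => //=; ring.
Qed.

Lemma has_cderiv_comp f g c d p : has_cderiv f c (g p) -> has_cderiv g d p ->
  has_cderiv (fun z => f (g z)) (cmul c d) p.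
Proof.
move=> [f1 f2] [g1 g2].
have E : g p = ((g p).1, (g p).2) by rewrite -surjective_pairing.
have h1 := @has_grad_comp2 _ _ _ _ (fun z => (g z).1) (fun z => (g z).2) _ _ _ _ p
  (eq_ind _ (fun z => has_grad _ _ _ z) f1 _ E) g1 g2.
have h2 := @has_grad_comp2 _ _ _ _ (fun z => (g z).1) (fun z => (g z).2) _ _ _ _ p
  (eq_ind _ (fun z => has_grad _ _ _ z) f2 _ E) g1 g2.
split.
  apply: has_grad_eq h1 _ _ _ => /=; try ring.
  by move=> z; rewrite -surjective_pairing.
apply: has_grad_eq h2 _ _ _ => /=; try ring.
by move=> z; rewrite -surjective_pairing.
Qed.

Lemma has_cderiv_exp p : has_cderiv cexp (cexp p) p.
Proof.
have e1 := has_grad_comp1 (is_derive_expR _) (has_grad_fst p).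
have c2 := has_grad_comp1 (is_derive_cos _) (has_grad_snd p).
have s2 := has_grad_comp1 (is_derive_sin _) (has_grad_snd p).
split.
  by apply: has_grad_eq (has_gradM e1 c2) _ _ _ => //=; ring.
by apply: has_grad_eq (has_gradM e1 s2) _ _ _ => //=; ring.
Qed.

Lemma has_grad_sqmod p : has_grad sqmod (2 * p.1) (2 * p.2) p.
Proof.
have h1 := has_gradM (has_grad_fst p) (has_grad_fst p).
have h2 := has_gradM (has_grad_snd p) (has_grad_snd p).
by apply: has_grad_eq (has_gradD h1 h2) _ _ _ => /=; try ring; move=> z; rewrite /sqmod; ring.
Qed.

Lemma is_derive_inv (x : R) : x != 0 -> is_derive x 1 (fun y : R => y^-1) (- x ^- 2).
Proof.
move=> x0; have dx : derivable (id : R -> R) x 1 by exact: derivable_id.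
by apply: DeriveDef; [exact: (derivableV (f := id))|rewrite (deriveV (f := id)) // derive_id scaler1].
Qed.

Lemma has_cderiv_inv p : p != 0 -> has_cderiv cinv (cmul (-1, 0) (cmul (cinv p) (cinv p))) p.
Proof.
rewrite -sqmod_eq0 => p0.
have i := has_grad_comp1 (is_derive_inv p0) (has_grad_sqmod p).
have n2 := has_gradB (has_grad_cst 0 p) (has_grad_snd p).
split.
  apply: has_grad_eq (has_gradM (has_grad_fst p) i) _ _ _ => //=;
    by move: p0; rewrite /sqmod => p0; field.
apply: has_grad_eq (has_gradM n2 i) _ _ _ => //=; first by move=> z; rewrite sub0r.
  by move: p0; rewrite /sqmod => p0; field.
by move: p0; rewrite /sqmod => p0; field.
Qed.

Lemma hol_sub k U V f : U `<=` V -> hol k V f -> hol k U f.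
Proof.
move=> UV; elim: k f => [|k IH] f /=; first by move=> cf p /UV; exact: cf.
by case=> f' df hf; exists f'; [move=> p /UV; exact: df|exact: IH hf].
Qed.

Lemma holW k U f : hol k.+1 U f -> hol k U f.
Proof.
elim: k f => [|k IH] f.
  case=> f' df _ p Up; have [h1 h2] := df p Up.
  by split; [exact: has_grad_continuous h1|exact: has_grad_continuous h2].
by case=> f' df hf; exists f'; [exact: df|exact: (IH _ hf)].
Qed.

Lemma hol_cst k U c : hol k U (cst c).
Proof.
elim: k c => [|k IH] c /=; first by move=> p _; split; exact: cvg_cst.
by exists (cst 0); [move=> p _; exact: has_cderiv_cst|exact: IH].
Qed.

Lemma hol_id k U : hol k U id.
Proof.
case: k => [|k] /=.
  by move=> p _; split; [exact: continuous_fst|exact: continuous_snd].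
by exists (cst (1, 0)); [move=> p _; exact: has_cderiv_id|exact: hol_cst].
Qed.

Lemma holD k U f g : hol k U f -> hol k U g -> hol k U (fun z => f z + g z).
Proof.
elim: k f g => [|k IH] f g.
  move=> cf cg p Up; have [f1 f2] := cf p Up; have [g1 g2] := cg p Up.
  by split; [exact: (cvgD f1 g1)|exact: (cvgD f2 g2)].
case=> f' df hf [g' dg hg]; exists (fun z => f' z + g' z); last exact: IH hf hg.
by move=> p Up; exact: has_cderivD (df p Up) (dg p Up).
Qed.

Lemma holB k U f g : hol k U f -> hol k U g -> hol k U (fun z => f z - g z).
Proof.
elim: k f g => [|k IH] f g.
  move=> cf cg p Up; have [f1 f2] := cf p Up; have [g1 g2] := cg p Up.
  by split; [exact: (cvgB f1 g1)|exact: (cvgB f2 g2)].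
case=> f' df hf [g' dg hg]; exists (fun z => f' z - g' z); last exact: IH hf hg.
by move=> p Up; exact: has_cderivB (df p Up) (dg p Up).
Qed.

Lemma holM k U f g : hol k U f -> hol k U g -> hol k U (fun z => cmul (f z) (g z)).
Proof.
elim: k f g => [|k IH] f g.
  move=> cf cg p Up; have [f1 f2] := cf p Up; have [g1 g2] := cg p Up.
  split; first exact: (cvgB (cvgM f1 g1) (cvgM f2 g2)).
  exact: (cvgD (cvgM f1 g2) (cvgM f2 g1)).
move=> hf hg; have hf0 := holW hf; have hg0 := holW hg.
case: hf hg => f' df hf [g' dg hg].
exists (fun z => cmul (f' z) (g z) + cmul (f z) (g' z)).
  by move=> p Up; exact: has_cderivM (df p Up) (dg p Up).
by apply: holD; apply: IH.
Qed.

Lemma hol_comp k U V f g : (forall z, U z -> V (g z)) -> hol k V f -> hol k U g ->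
  hol k U (fun z => f (g z)).
Proof.
move=> UV; elim: k f => [|k IH] f.
  move=> cf cg p Up; have [f1 f2] := cf _ (UV p Up); have [g1 g2] := cg p Up.
  have gp : {for p, continuous g}.
    have h : g = (fun z => ((g z).1, (g z).2)).
      by apply/funext => z; rewrite -surjective_pairing.
    suff : g z @[z --> p] --> g p by [].
    by rewrite h; exact: cvg_pair g1 g2.
  by split; [exact: (continuous_comp gp f1)|exact: (continuous_comp gp f2)].
move=> hf hg; have hg0 := holW hg.
case: hf hg => f' df hf [g' dg hg].
exists (fun z => cmul (f' (g z)) (g' z)).
  by move=> p Up; exact: has_cderiv_comp (df _ (UV p Up)) (dg p Up).
by apply: holM hg; exact: IH.
Qed.

Lemma hol_exp k U : hol k U cexp.
Proof.
elim: k => [|k IH]; last by exists cexp => // p _; exact: has_cderiv_exp.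
move=> p _; have [h1 h2] := has_cderiv_exp p.
by split; [exact: has_grad_continuous h1|exact: has_grad_continuous h2].
Qed.

Lemma hol_inv k : hol k [set z | z != 0] cinv.
Proof.
elim: k => [|k IH].
  move=> p p0; have [h1 h2] := has_cderiv_inv p0.
  by split; [exact: has_grad_continuous h1|exact: has_grad_continuous h2].
exists (fun z => cmul (-1, 0) (cmul (cinv z) (cinv z))).
  by move=> p p0; exact: has_cderiv_inv.
by apply: holM; [exact: hol_cst|exact: holM].
Qed.

Lemma holV k U f : (forall z, U z -> f z != 0) -> hol k U f -> hol k U (fun z => cinv (f z)).
Proof. by move=> U0; apply: hol_comp U0 (hol_inv k). Qed.

(** The Cauchy-Riemann equations of the complex gradient g = u_x - i u_y contain the Laplace
    equation of [u]. This form also covers ln |z|, whose conjugate is multivalued while its complex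
    gradient 1/z is not. *)
Lemma harmonic_on_cgrad U (u : R * R -> R) g : open U ->
  (forall p, U p -> has_grad u (g p).1 (- (g p).2) p) -> hol 1 U g -> harmonic_on U u.
Proof.
move=> oU hu [g' dg hg].
have E1 p : U p -> (g p).1 = pd1 u p by move=> /hu/has_grad_pd1[_ ->].
have E2 p : U p -> - (g p).2 = pd2 u p by move=> /hu/has_grad_pd2[_ ->].
have dg1 p : U p -> has_grad (pd1 u) (g' p).1 (- (g' p).2) p.
  by move=> Up; apply: has_grad_near (eq_on_near oU E1 Up) (dg p Up).1.
have dg2 p : U p -> has_grad (pd2 u) (- (g' p).2) (- (g' p).1) p.
  move=> Up; apply: has_grad_near (eq_on_near oU E2 Up) _.
  apply: has_grad_eq (has_gradB (has_grad_cst 0 p) (dg p Up).2) _ _ _ => [z||] /=;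
    by rewrite sub0r.
have cN (k : R * R -> R) (p : R * R) : {for p, continuous k} -> {for p, continuous (fun z => - k z)}.
  by move=> ck; exact: cvgN ck.
split; last first.
  move=> p Up; have [_ ->] := has_grad_pd1 (dg1 p Up).
  by have [_ ->] := has_grad_pd2 (dg2 p Up); rewrite subrr.
split.
- by move=> p Up; split; [have [] := has_grad_pd1 (hu p Up)|have [] := has_grad_pd2 (hu p Up)].
- split.
  + by move=> p Up; split; [have [] := has_grad_pd1 (dg1 p Up)|have [] := has_grad_pd2 (dg1 p Up)].
  + refine (@Ck_on_ext _ 0 U (fun z => (g' z).1) _ oU (fun p Up => _) (fun p Up => _)).
      by have [_ ->] := has_grad_pd1 (dg1 p Up).
    by have [] := hg p Up.
  + refine (@Ck_on_ext _ 0 U (fun z => - (g' z).2) _ oU (fun p Up => _) (fun p Up => _)).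
      by have [_ ->] := has_grad_pd2 (dg1 p Up).
    by apply: cN; have [] := hg p Up.
- split.
  + by move=> p Up; split; [have [] := has_grad_pd1 (dg2 p Up)|have [] := has_grad_pd2 (dg2 p Up)].
  + refine (@Ck_on_ext _ 0 U (fun z => - (g' z).2) _ oU (fun p Up => _) (fun p Up => _)).
      by have [_ ->] := has_grad_pd1 (dg2 p Up).
    by apply: cN; have [] := hg p Up.
  + refine (@Ck_on_ext _ 0 U (fun z => - (g' z).1) _ oU (fun p Up => _) (fun p Up => _)).
      by have [_ ->] := has_grad_pd2 (dg2 p Up).
    by apply: cN; have [] := hg p Up.
Qed.

Lemma hol_harmonic1 U f : open U -> hol 2 U f -> harmonic_on U (fun z => (f z).1).
Proof. by move=> oU [f' df hf]; apply: harmonic_on_cgrad oU _ hf => p /df[]. Qed.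

Lemma hol_harmonic2 U f : open U -> hol 2 U f -> harmonic_on U (fun z => (f z).2).
Proof.
move=> oU hf; have [f' df hf'] := holM (hol_cst 2 U (0, -1)) hf.
apply: harmonic_on_cgrad oU _ hf' => p /df[h _].
by apply: has_grad_eq h _ _ _ => //= z; ring.
Qed.

End ComplexPlane.

(** * The maximum principle *)

Section MaximumPrinciple.
Context {R : realType}.
Implicit Types (u v w : R * R -> R) (p q z : R * R) (U : set (R * R)).

(** The maximum forces [g x = 0]. A positive [g'] would then make [g] positive just to the right of
    [x], and by the mean value theorem [f] would exceed [f x] there. *)
Lemma local_max_second_derive (f g : R -> R) (x d g' : R) : 0 < d ->
  (forall t, `|t - x| < d -> is_derive t 1 f (g t)) -> is_derive x 1 g g' ->
  (forall t, `|t - x| < d -> f t <= f x) -> g' <= 0.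
Proof.
move=> d0 fg gg fmax; rewrite leNgt; apply/negP => g'0.
have inI t : (t \in `](x - d), (x + d)[) -> `|t - x| < d.
  by rewrite in_itv /= ltr_norml => /andP[? ?]; apply/andP; split; lra.
have gx0 : g x = 0.
  have xI : x \in `](x - d), (x + d)[ by rewrite in_itv /=; apply/andP; split; lra.
  have [_ <-] : is_derive x 1 f 0.
    apply: (@derive1_at_max _ f (x - d) (x + d)) => //; first by lra.
      by move=> t /inI/fg[].
    by move=> t /inI/fmax.
  have xx : `|x - x| < d by rewrite subrr normr0.
  by have [_ ->] := fg x xx.
have [dg dgE] := gg.
have [e /= e0 He] := (iffLR (nbhs_ballP _ _)) ((iffLR (cvgrPdist_lt _ _)) dg _ g'0).
rewrite -/('D_1 g x) dgE in He.
pose h := Num.min e d / 2.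
have m0 : 0 < Num.min e d by rewrite lt_min e0 d0.
have h0 : 0 < h by rewrite divr_gt0.
have he : h < e by rewrite (@lt_le_trans _ _ (Num.min e d)) ?ge_min ?lexx // /h; lra.
have hd : h < d by rewrite (@lt_le_trans _ _ (Num.min e d)) ?ge_min ?lexx ?orbT // /h; lra.
have [|t|t|t /[!in_itv] /= /andP[t1 t2]] := @MVT _ f g x (x + h).
- by rewrite ltrDl.
- rewrite in_itv /= => /andP[t1 t2]; apply: fg; rewrite ger0_norm; lra.
- apply: derivable_within_continuous => s; rewrite in_itv /= => /andP[s1 s2].
  by have [] : is_derive s 1 f (g s) by apply: fg; rewrite ger0_norm; lra.
- have := fmax (x + h); rewrite addrC addKr gtr0_norm // => /(_ hd) fh E.
  have /(He (t - x)) : ball (0 : R) e (t - x).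
    by rewrite /ball /= sub0r normrN ger0_norm; lra.
  have tx : t - x != 0 by rewrite subr_eq0 gt_eqF.
  have E1 : g ((t - x) *: (1 : R) + x) = g t.
    by rewrite /= /GRing.scale /= mulr1 subrK.
  move=> /(_ tx) H; rewrite E1 gx0 subr0 in H.
  have gt0 : 0 < g t.
    have tx0 : 0 < t - x by lra.
    have : 0 < (t - x)^-1 * g t by move: H; rewrite ltr_norml /GRing.scale /= => /andP[]; lra.
    by rewrite pmulr_rgt0 // invr_gt0.
  have : 0 < g t * h by rewrite mulr_gt0.
  by rewrite -E; lra.
Qed.

(** The bound is taken at least 1 so that it can be divided by. *)
Lemma bounded_set_sqmod U : bounded_set U -> exists2 M : R, 1 <= M &
  forall z, U z -> `|z.1| <= M /\ `|z.2| <= M.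
Proof.
move=> [M [Mr HM]]; exists (Num.max 1 (M + 1)); first by rewrite le_max lexx.
move=> z Uz.
have : `|z| <= Num.max 1 (M + 1).
  by apply: HM => //; rewrite lt_max; apply/orP; right; lra.
by rewrite prod_normE ge_max => /andP[].
Qed.

(** If [m = w p] were positive, then w + e |z - p|^2 would have an interior maximum although its
    Laplacian is 4 e > 0. The boundary condition is an upper limit, since the functions to which it
    is applied are controlled only from inside [U]. *)
Theorem maximum_principle U w : open U -> bounded_set U -> harmonic_on U w ->
  (forall q, closure U q -> ~ U q -> forall e, 0 < e ->
     \forall z \near q, U z -> w z <= e) ->
  forall p, U p -> w p <= 0.
Proof.
move=> oU bU hw wb p Up; rewrite leNgt; apply/negP; set m := w p => m0.
have [M M1 HM] := bounded_set_sqmod bU.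
have cw z : U z -> {for z, continuous w} by exact: harmonic_on_continuous hw.
(* [A] is closed in the plane: near a boundary point [w] is at most m/8, so [A] keeps away from the
   boundary. *)
pose A := [set z | U z /\ m / 4 <= w z].
have clA : closed A.
  move=> q clq.
  have clU : closure U q by move=> B /clq[z [[Uz _] Bz]]; exists z.
  have [Uq|nUq] := pselect (U q).
    split=> //; rewrite leNgt; apply/negP => wq.
    have e0 : 0 < m / 4 - w q by lra.
    have [z [[_ wz]]] := clq _ (continuous_near_dist (cw q Uq) e0).
    by rewrite ltr_norml => /andP[_]; lra.
  have e0 : 0 < m / 8 by rewrite divr_gt0.
  have [z [[Uz wz]]] := clq _ (wb q clU nUq _ e0).
  by move=> /(_ Uz); lra.
have cA : compact A.
  apply: (@subclosed_compact _ _ (`[- M, M] `*` `[- M, M])) => //.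
    by apply: compact_setX; exact: segment_compact.
  by move=> z [/HM[z1 z2] _]; split; rewrite /= in_itv /= -ler_norml.
(* Since [N] is at most 8 M^2 on [U], the perturbation is at most m/2. Comparison with [p], where it
   vanishes, gives [w >= m / 2] at the maximiser [z0], well above the threshold m/4 of [A]; hence
   [z0] is a local maximum in [U]. *)
pose e := m / (16 * M ^+ 2).
have M20 : 0 < M ^+ 2 by rewrite exprn_gt0 //; lra.
have e0 : 0 < e by rewrite divr_gt0 // mulr_gt0.
pose N z := (z.1 - p.1) ^+ 2 + (z.2 - p.2) ^+ 2.
have gN z : has_grad N (2 * (z.1 - p.1)) (2 * (z.2 - p.2)) z.
  have h1 := has_gradB (has_grad_fst z) (has_grad_cst p.1 z).
  have h2 := has_gradB (has_grad_snd z) (has_grad_cst p.2 z).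
  apply: has_grad_eq (has_gradD (has_gradM h1 h1) (has_gradM h2 h2)) _ _ _ => /= [y||].
  - by rewrite /N; ring.
  - by ring.
  - by ring.
have N_le z : U z -> N z <= 8 * M ^+ 2.
  move=> Uz; have [z1 z2] := HM z Uz; have [p1 p2] := HM p Up.
  have sq (a b : R) : `|a| <= M -> `|b| <= M -> (a - b) ^+ 2 <= 4 * M ^+ 2.
    move=> ha hb; have : `|a - b| <= 2 * M by rewrite (le_trans (ler_normB _ _)); lra.
    move=> h; have -> : 4 * M ^+ 2 = (2 * M) ^+ 2 by ring.
    by rewrite -[(a - b) ^+ 2]real_normK ?num_real // lerXn2r ?nnegrE //; lra.
  have := sq _ _ z1 p1; have := sq _ _ z2 p2; rewrite /N; lra.
pose v z := w z + e * N z.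
have Ap : A p by split=> //; rewrite -/m; lra.
have cv : {within A, continuous v}.
  apply: continuous_in_subspaceT => z /set_mem[Uz _].
  have cN := has_grad_continuous (gN z).
  exact: (cvgD (cw z Uz) (cvgM (cvg_cst e) cN)).
have [z0 /set_mem Az0 Hmax] := compact_EVT_max (ex_intro _ p Ap) cA cv.
have Uz0 : U z0 := Az0.1.
have wz0 : m / 2 <= w z0.
  have := Hmax p (mem_set Ap); rewrite /v /N !subrr expr0n /= addr0 mulr0 addr0 -/m -/(N z0).
  have : e * N z0 <= m / 2.
    have := N_le _ Uz0; rewrite -(ler_pM2l e0) => h; apply: (le_trans h).
    rewrite /e le_eqVlt; apply/orP; left; apply/eqP; field.
    by rewrite gt_eqF //; lra.
  lra.
have [d /= d0 Hd] : exists2 d : R, 0 < d & forall z, ball z0 d z -> U z /\ v z <= v z0.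
  have n1 := open_nbhs_nbhs (conj oU Uz0).
  have m40 : 0 < m / 4 by rewrite divr_gt0.
  have n2 := continuous_near_dist (cw z0 Uz0) m40.
  have [d /= d0 Hd] := (iffLR (nbhs_ballP _ _)) (filterI n1 n2).
  exists d => // z /Hd[Uz]; rewrite ltr_norml => /andP[wz _]; split=> //.
  by apply: Hmax; apply: mem_set; split=> //; lra.
case: hw => [[dw [d1w _ _] [d2w _ _]] lap].
have near1 t : `|t - z0.1| < d -> ball z0 d (t, z0.2).
  by move=> td; split; rewrite /ball /= 1?distrC // subrr normr0.
have near2 t : `|t - z0.2| < d -> ball z0 d (z0.1, t).
  by move=> td; split; rewrite /ball /= 1?distrC // subrr normr0.
have z0E : z0 = (z0.1, z0.2) by case: (z0).
have s1 : pd1 (pd1 w) z0 + 2 * e <= 0.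
  apply: (@local_max_second_derive (fun t => v (t, z0.2))
    (fun t => pd1 w (t, z0.2) + e * (2 * (t - p.1))) z0.1 d) => //.
  - move=> t /near1/Hd[Ut _].
    have [Dw _] := dw _ Ut.
    have [DN NE] := has_grad_pd1 (gN (t, z0.2)).
    have := is_deriveD (slice1_derive Dw) (is_deriveZ e (slice1_derive DN)).
    by rewrite NE.
  - have [Dw _] := d1w _ Uz0; rewrite [X in derivable _ X]z0E in Dw.
    have h := is_deriveB (is_derive_id z0.1 1) (is_derive_cst p.1 z0.1 1).
    have h2 := is_deriveD (slice1_derive Dw) (is_deriveZ e (is_deriveZ 2 h)).
    refine (is_derive_eq h2 (congr2 +%R (congr1 (pd1 (pd1 w)) (esym z0E)) _)).
    by rewrite /GRing.scale /=; ring.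
  - by move=> t /near1/Hd[_]; rewrite -z0E.
have s2 : pd2 (pd2 w) z0 + 2 * e <= 0.
  apply: (@local_max_second_derive (fun t => v (z0.1, t))
    (fun t => pd2 w (z0.1, t) + e * (2 * (t - p.2))) z0.2 d) => //.
  - move=> t /near2/Hd[Ut _].
    have [_ Dw] := dw _ Ut.
    have [DN NE] := has_grad_pd2 (gN (z0.1, t)).
    have := is_deriveD (slice2_derive Dw) (is_deriveZ e (slice2_derive DN)).
    by rewrite NE.
  - have [_ Dw] := d2w _ Uz0; rewrite [X in derivable _ X]z0E in Dw.
    have h := is_deriveB (is_derive_id z0.2 1) (is_derive_cst p.2 z0.2 1).
    have h2 := is_deriveD (slice2_derive Dw) (is_deriveZ e (is_deriveZ 2 h)).
    refine (is_derive_eq h2 (congr2 +%R (congr1 (pd2 (pd2 w)) (esym z0E)) _)).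
    by rewrite /GRing.scale /=; ring.
  - by move=> t /near2/Hd[_]; rewrite -z0E.
have := lap z0 Uz0; move: s1 s2; move: (pd1 _ _) (pd2 _ _) => a b; lra.
Qed.

End MaximumPrinciple.

(** * Primitives and monodromy *)

Section LocalPrimitive.
Context {R : realType}.
Implicit Types (A B V u : R * R -> R) (p q : R * R) (Omega : set (R * R)).
Local Notation mu := (@lebesgue_measure R).

Lemma slice1_continuous u x y : {for (x, y), continuous u} ->
  {for x, continuous (fun s => u (s, y))}.
Proof.
move=> cu; apply: (@continuous_comp _ _ _ (fun s => (s, y)) u x _ cu).
exact: cvg_pair cvg_id (cvg_cst y).
Qed.

Lemma slice2_continuous u x y : {for (x, y), continuous u} ->
  {for y, continuous (fun t => u (x, t))}.
Proof.
move=> cu; apply: (@continuous_comp _ _ _ (fun t => (x, t)) u y _ cu).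
exact: cvg_pair (cvg_cst x) cvg_id.
Qed.

Lemma continuous_integrable (f : R -> R) (a b : R) :
  (forall t, t \in `[a, b] -> {for t, continuous f}) ->
  mu.-integrable `[a, b] (EFin \o f).
Proof.
move=> cf; apply: continuous_compact_integrable; first exact: segment_compact.
by apply: continuous_in_subspaceT => t /set_mem; exact: cf.
Qed.

Lemma primitive_derive (f : R -> R) (a b x : R) :
  (forall t, t \in `[a, b] -> {for t, continuous f}) -> x \in `]a, b[ ->
  is_derive x 1 (fun y => \int[mu]_(t in `[a, y]) f t)%R (f x).
Proof.
move=> cf; rewrite in_itv /= => /andP[ax xb].
have [|dF F'] := continuous_FTC1_closed xb (continuous_integrable cf) ax.
  by apply: cf; rewrite in_itv /= !ltW.
by apply: DeriveDef; [exact: dF|rewrite -derive1E; exact: F'].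
Qed.

Lemma integral_derive (F f : R -> R) (a b : R) : a < b ->
  (forall t, t \in `[a, b] -> is_derive t 1 F (f t)) ->
  (forall t, t \in `[a, b] -> {for t, continuous f}) ->
  (\int[mu]_(t in `[a, b]) f t)%R = F b - F a.
Proof.
move=> ab dF cf.
have cF t : t \in `[a, b] -> {for t, continuous F}.
  move=> /dF h; apply: differentiable_continuous; apply/derivable1_diffP.
  exact: ex_derive.
rewrite /Rintegral (@continuous_FTC2 _ f F) //.
- by apply: continuous_in_subspaceT => t /set_mem; exact: cf.
- split.
  + by move=> t tab; have [] := dF t (subset_itv_oo_cc tab).
  + by apply: cvg_at_right_filter; apply: cF; rewrite in_itv /= lexx ltW.
  + by apply: cvg_at_left_filter; apply: cF; rewrite in_itv /= lexx ltW.
- by move=> t tab; rewrite derive1E; have [_ ->] := dF t (subset_itv_oo_cc tab).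
Qed.

Lemma compact_norm_bound u (K : set (R * R)) : compact K ->
  (forall p, K p -> {for p, continuous u}) -> exists2 M, 0 <= M & forall p, K p -> `|u p| <= M.
Proof.
move=> cK cu; have [[p Kp]|K0] := pselect (K !=set0); last first.
  by exists 0 => // p Kp; exfalso; apply: K0; exists p.
have cn : {within K, continuous (fun z => `|u z|)}.
  apply: continuous_in_subspaceT => z /set_mem/cu cz.
  exact: (cvg_norm cz).
have [q _ Hq] := compact_EVT_max (ex_intro _ p Kp) cK cn.
by exists `|u q| => // z /mem_set/Hq.
Qed.

Lemma segment_prod_compact (a b c d : R) : compact (`[a, b] `*` `[c, d]).
Proof. by apply: compact_setX; exact: segment_compact. Qed.

(** [V] integrates [A] along the bottom edge of a square and then [B] upwards. Its y-derivative is
    [B] at once; for the x-derivative, differentiation under the integral turns A_y = B_x into a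
    telescoping integral of A_y. *)
Lemma local_primitive Omega A B p : open Omega -> Ck_on 1 Omega A -> Ck_on 1 Omega B ->
  (forall q, Omega q -> pd2 A q = pd1 B q) -> Omega p ->
  exists V r, [/\ 0 < r, ball p r `<=` Omega &
    forall q, ball p r q -> has_grad V (A q) (B q) q].
Proof.
move=> oO cA cB AB Op.
have [r0 /= r00 Hr0] := (iffLR (nbhs_ballP _ _)) (open_nbhs_nbhs (conj oO Op)).
(* Balls are squares of the sup norm; halving the radius puts the closed square, with its edges of
   integration, inside [Omega]. *)
pose r := r0 / 2.
have r_gt0 : 0 < r by rewrite divr_gt0.
pose x0 := p.1 - r; pose x1 := p.1 + r; pose y0 := p.2 - r; pose y1 := p.2 + r.
have KO x y : x \in `[x0, x1] -> y \in `[y0, y1] -> Omega (x, y).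
  rewrite !in_itv /x0 /x1 /y0 /y1 /= => /andP[? ?] /andP[? ?]; apply: Hr0.
  have hr : r < r0 by rewrite /r; lra.
  by split; rewrite /ball /= distrC (le_lt_trans _ hr) // ler_norml; apply/andP; split; lra.
have x0K : x0 \in `[x0, x1] by rewrite in_itv /= lexx /x0 /x1; lra.
have y0K : y0 \in `[y0, y1] by rewrite in_itv /= lexx /y0 /y1; lra.
have ctA q : Omega q -> {for q, continuous A} by exact: (Ck_on_continuous oO cA).
have ctB q : Omega q -> {for q, continuous B} by exact: (Ck_on_continuous oO cB).
case: cA => dA cA1 cA2; case: cB => dB cB1 cB2.
have [M M0 HM] : exists2 M, 0 <= M & forall q, (`[x0, x1] `*` `[y0, y1]) q -> `|pd1 B q| <= M.
  apply: compact_norm_bound; first exact: segment_prod_compact.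
  by move=> [x y] [/= xK yK]; apply: cB1; exact: KO.
pose V (q : R * R) := (\int[mu]_(t in `[y0, q.2]) B (q.1, t))%R + (\int[mu]_(s in `[x0, q.1]) A (s, y0))%R.
have V2 x y : x \in `]x0, x1[ -> y \in `]y0, y1[ -> is_derive y 1 (fun t => V (x, t)) (B (x, y)).
  move=> xI yI; have xK := subset_itv_oo_cc xI.
  have h := @primitive_derive (fun t => B (x, t)) y0 y1 y _ yI.
  have h1 : is_derive y 1 (fun t => \int[mu]_(s in `[y0, t]) B (x, s))%R (B (x, y)).
    by apply: h => t tK; apply: slice2_continuous; apply: ctB; exact: KO.
  have := is_deriveD h1 (is_derive_cst (\int[mu]_(s in `[x0, x]) A (s, y0))%R y 1).
  by rewrite addr0.
have V1 x y : x \in `]x0, x1[ -> y \in `]y0, y1[ -> is_derive x 1 (fun s => V (s, y)) (A (x, y)).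
  move=> xI yI; have xK := subset_itv_oo_cc xI; have yK := subset_itv_oo_cc yI.
  have sub_y t : t \in `[y0, y] -> t \in `[y0, y1].
    by move: yI; rewrite !in_itv /= => /andP[_ ?] /andP[-> /le_trans->] //; exact: ltW.
  have h1 : is_derive x 1 (fun s => \int[mu]_(t in `[x0, s]) A (t, y0))%R (A (x, y0)).
    apply: (@primitive_derive (fun s => A (s, y0)) x0 x1 x _ xI) => t tK.
    by apply: slice1_continuous; apply: ctA; exact: KO.
  have int_B s : `]x0, x1[%classic s -> mu.-integrable `[y0, y] (EFin \o (fun t => B (s, t))).
    move=> sI; apply: continuous_integrable => t /sub_y tK.
    by apply: slice2_continuous; apply: ctB; apply: KO => //; exact: subset_itv_oo_cc sI.
  have der_B s t : `]x0, x1[%classic s -> `[y0, y]%classic t ->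
      is_derive s 1 (fun s' => B (s', t)) (pd1 B (s, t)).
    move=> sI tI; apply: slice1_derive; apply: (dB (s, t) _).1.
    by apply: KO; [exact: subset_itv_oo_cc sI|exact: sub_y].
  have dB' s t : `]x0, x1[%classic s -> `[y0, y]%classic t -> derivable (fun s' => B (s', t)) s 1.
    by move=> sI tI; have [] := der_B s t sI tI.
  have ubB s t : `]x0, x1[%classic s -> `[y0, y]%classic t ->
      `|partial1of2 (fun s' t' => B (s', t')) s t| <= cst M t.
    move=> sI tI; rewrite partial1of2E; have [_ ->] := der_B s t sI tI.
    by apply: HM; split; [exact: subset_itv_oo_cc sI|exact: sub_y].
  have intM : mu.-integrable `[y0, y] (EFin \o cst M).
    by apply: continuous_integrable => t _; exact: cvg_cst.
  have mI : measurable (`[y0, y]%classic : set R) by exact: measurable_itv.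
  have D := @derivable_under_integral R _ _ mu (fun s t => B (s, t)) `[y0, y] mI x x0 x1 xI int_B dB'
    (cst M) (fun _ => M0) intM ubB.
  have E := @differentiation_under_integral R _ _ mu (fun s t => B (s, t)) `[y0, y] mI x x0 x1 xI int_B dB'
    (cst M) (fun _ => M0) intM ubB.
  have E2 : (\int[mu]_(t in `[y0, y]) (partial1of2 (fun s t => B (s, t)) ^~ t) x)%R = A (x, y) - A (x, y0).
    have y0y : y0 < y by move: yI; rewrite in_itv /= => /andP[].
    have dA' t : t \in `[y0, y] -> is_derive t 1 (fun s => A (x, s)) (pd2 A (x, t)).
      by move=> /sub_y tK; apply: slice2_derive; apply: (dA (x, t) _).2; exact: KO.
    have cA' t : t \in `[y0, y] -> {for t, continuous (fun s => pd2 A (x, s))}.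
      by move=> /sub_y tK; apply: slice2_continuous; apply: cA2; exact: KO.
    have h := integral_derive y0y dA' cA'.
    refine (etrans _ h).
    apply: eq_Rintegral => t /set_mem tI; rewrite partial1of2E.
    have [_ ->] := der_B x t xI tI; apply: esym; apply: AB.
    by apply: KO => //; exact: sub_y.
  have h2 : is_derive x 1 (fun s => \int[mu]_(t in `[y0, y]) B (s, t))%R (A (x, y) - A (x, y0)).
    by apply: DeriveDef; [exact: D|rewrite -derive1E E E2].
  by have := is_deriveD h2 h1; rewrite subrK.
move: V V1 V2 => V V1 V2.
have inI q : ball p r q -> (q.1 \in `]x0, x1[) /\ (q.2 \in `]y0, y1[).
  case: q => a b [/= h1 h2]; move: h1 h2; rewrite /ball /= !ltr_norml !in_itv /=.
  by move=> /andP[? ?] /andP[? ?]; split; apply/andP; split; rewrite /x0 /x1 /y0 /y1; lra.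
have dV q : ball p r q -> [/\ derivable V q (1, 0), (pd1 V q = A q), derivable V q (0, 1) & (pd2 V q = B q)].
  case: q => x y /inI[/= q1 q2].
  have [D1 E1] := iffLR (slice1P V (x, y) _) (V1 x y q1 q2).
  have [D2 E2] := iffLR (slice2P V (x, y) _) (V2 x y q1 q2).
  by split; [exact: D1|exact: E1|exact: D2|exact: E2].
have oB : open (ball p r) by exact: ball_open.
have bO q : ball p r q -> Omega q.
  by move=> /inI[q1 q2]; rewrite (surjective_pairing q); apply: KO; exact: subset_itv_oo_cc.
exists V, r; split; [exact: r_gt0|exact: bO|move=> q bq].
have [_ E1 _ E2] := dV q bq; rewrite -E1 -E2.
apply: C1_has_grad.
- have := open_nbhs_nbhs (conj oB bq); apply: filterS => z /dV[d1 _ d2 _].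
  exact: (conj d1 d2).
- have E z (bz : ball p r z) : A z = pd1 V z by have [_ ->] := dV z bz.
  exact: continuous_eq_on oB E bq (ctA q (bO q bq)).
- have E z (bz : ball p r z) : B z = pd2 V z by have [_ _ _ ->] := dV z bz.
  exact: continuous_eq_on oB E bq (ctB q (bO q bq)).
Qed.

End LocalPrimitive.

(** * Analytic continuation of primitives along a map *)

Section Lifts.
Context {R : realType}.
Variables (A B : R * R -> R).
Implicit Types (V : R * R -> R) (p q : R * R).

Definition primitive_on V (p : R * R) (r : R) :=
  0 < r /\ forall q, ball p r q -> has_grad V (A q) (B q) q.

Lemma ball_segment p r q q' (t : R) : ball p r q -> ball p r q' -> 0 <= t <= 1 ->
  ball p r (q.1 + t * (q'.1 - q.1), q.2 + t * (q'.2 - q.2)).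
Proof.
have conv (x y y' : R) : `|x - y| < r -> `|x - y'| < r -> 0 <= t <= 1 ->
    `|x - (y + t * (y' - y))| < r.
  move=> h1 h2 /andP[t0 t1].
  have -> : x - (y + t * (y' - y)) = (1 - t) * (x - y) + t * (x - y') by ring.
  apply: (le_lt_trans (ler_normD _ _)); rewrite !normrM (ger0_norm t0) ger0_norm; last by lra.
  have r0 : 0 < r := le_lt_trans (normr_ge0 _) h1.
  have [->|tn] := eqVneq t 0; first by rewrite subr0 mul1r mul0r addr0.
  have tp : 0 < t by rewrite lt_neqAle eq_sym tn.
  have l2 : t * `|x - y'| < t * r by rewrite ltr_pM2l.
  have l1 : (1 - t) * `|x - y| <= (1 - t) * r by rewrite ler_wpM2l ?(ltW h1) //; lra.
  by lra.
by move=> [/= a1 a2] [/= b1 b2] t01; split; exact: conv.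
Qed.

(** The difference of the primitives has zero gradient, and balls contain the segment from [q] to
    [q']. *)
Lemma primitive_on_unique V V' p r q q' : primitive_on V p r -> primitive_on V' p r ->
  ball p r q -> ball p r q' -> V q - V' q = V q' - V' q'.
Proof.
move=> [r0 hV] [_ hV'] bq bq'.
pose c1 t := q.1 + t * (q'.1 - q.1); pose c2 t := q.2 + t * (q'.2 - q.2).
have dlin (a b t : R) : is_derive t 1 (fun s : R => a + s * b) b.
  have h := is_deriveD (is_derive_cst a t 1) (is_deriveM (is_derive_id t 1) (is_derive_cst b t 1)).
  by apply: (is_derive_eq h); rewrite scaler0 !add0r /GRing.scale /= mulr1.
pose f (t : R) := V (c1 t, c2 t) - V' (c1 t, c2 t).
have df (t : R) : t \in `[0, 1] -> is_derive t 1 f 0.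
  rewrite in_itv /= => t01; have bt := ball_segment bq bq' t01.
  have h1 := @has_grad_curve _ V _ _ c1 c2 _ _ t (hV _ bt) (dlin _ _ t) (dlin _ _ t).
  have h2 := @has_grad_curve _ V' _ _ c1 c2 _ _ t (hV' _ bt) (dlin _ _ t) (dlin _ _ t).
  have h := is_deriveB h1 h2.
  by apply: (is_derive_eq h); rewrite subrr.
have cf : {within `[0, 1], continuous f}.
  by apply: derivable_within_continuous => t t01; have [] := df t t01.
have [t _] := @MVT _ f (fun=> 0) 0 1 ltr01 (fun t t01 => df t (subset_itv_oo_cc t01)) cf.
rewrite mul0r /f /c1 /c2 !mul1r !mul0r !addr0 ![_ + (_ - _)]addrC !subrK -!surjective_pairing.
by move/eqP; rewrite subr_eq0 => /eqP.
Qed.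

Lemma primitive_on_sub V p r q r' : primitive_on V p r -> 0 < r' ->
  ball q r' `<=` ball p r -> primitive_on V q r'.
Proof. by move=> [_ h] r'0 sub; split => // z /sub/h. Qed.

Lemma primitive_on_shift V p r c : primitive_on V p r -> primitive_on (fun q => V q + c) p r.
Proof.
move=> [r0 h]; split => // q bq.
by apply: has_grad_eq (has_gradD (h q bq) (has_grad_cst c q)) _ _ _ => //=; rewrite addr0.
Qed.

(* Analytic continuation of a primitive of A dx + B dy along the map K. *)
Definition lift_on {T : topologicalType} (D : set T) (K : T -> R * R) (w : T -> R) :=
  forall t, D t -> exists V r, primitive_on V (K t) r /\
    \forall s \near t, D s -> w s = V (K s).

Lemma lift_sub {T : topologicalType} (D D' : set T) K w :
  D' `<=` D -> lift_on D K w -> lift_on D' K w.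
Proof.
move=> DD h t /DD/h[V [r [pV n]]]; exists V, r; split => //.
by apply: filterS n => s hs /DD.
Qed.

Lemma lift_ext {T : topologicalType} (D : set T) K K' w :
  (forall t, D t -> K t = K' t) -> lift_on D K w -> lift_on D K' w.
Proof.
move=> KK h t Dt; have [V [r [pV n]]] := h t Dt; rewrite -(KK t Dt).
exists V, r; split => //.
by apply: filterS n => s hs Ds; rewrite -(KK s Ds); exact: hs.
Qed.

Lemma lift_comp {T T' : topologicalType} (D : set T) (D' : set T') K w (phi : T' -> T) :
  continuous phi -> (forall t, D' t -> D (phi t)) ->
  lift_on D K w -> lift_on D' (K \o phi) (w \o phi).
Proof.
move=> cphi DD h t /DD/h[V [r [pV n]]]; exists V, r; split => //.
have n' : \forall s \near t, D (phi s) -> w (phi s) = V (K (phi s)) := cphi t _ n.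
apply: filterS n' => s hs /DD; exact: hs.
Qed.

Lemma lift_in_ball {T : topologicalType} (D : set T) K V p r :
  continuous K -> primitive_on V p r -> (forall t, D t -> ball p r (K t)) ->
  lift_on D K (V \o K).
Proof.
move=> cK pV DK t Dt.
have [r' /= r'0 sub] := (iffLR (nbhs_ballP _ _)) (open_nbhs_nbhs (conj (ball_open _ _) (DK t Dt))).
exists V, r'; split; first exact: primitive_on_sub pV r'0 sub.
by apply: filterE.
Qed.

Lemma near_ball {T : topologicalType} (K : T -> R * R) t m : continuous K -> 0 < m ->
  \forall s \near t, ball (K t) m (K s).
Proof.
move=> cK m0; have nb : nbhs (K t) (ball (K t) m) by exact: nbhsx_ballx.
exact: (cK t _ nb).
Qed.

(** On a common small ball two primitives differ by a constant, so [w - w'] is locally constant on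
    [D]; the set where it takes its value at [t0] is open and closed in [D]. *)
Lemma lift_unique {T : topologicalType} (D : set T) K w w' : continuous K -> connected D ->
  lift_on D K w -> lift_on D K w' ->
  forall s t, D s -> D t -> w s - w' s = w t - w' t.
Proof.
move=> cK cD hw hw' s0 t0 Ds0 Dt0.
have loc t : D t -> \forall s \near t, D s -> w s - w' s = w t - w' t.
  move=> Dt; have [V [r [pV n]]] := hw t Dt; have [V' [r' [pV' n']]] := hw' t Dt.
  pose m := Num.min r r'.
  have m0 : 0 < m by rewrite lt_min pV.1 pV'.1.
  have sub1 : ball (K t) m `<=` ball (K t) r by apply: le_ball; rewrite ge_min lexx.
  have sub2 : ball (K t) m `<=` ball (K t) r' by apply: le_ball; rewrite ge_min lexx orbT.
  have wt := nbhs_singleton n Dt; have wt' := nbhs_singleton n' Dt.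
  have bt : ball (K t) m (K t) by exact: ballxx.
  have bm := near_ball t cK m0.
  apply: filterS3 n n' bm => s hs hs' bs Ds.
  rewrite wt wt' (hs Ds) (hs' Ds).
  exact: primitive_on_unique (primitive_on_sub pV m0 sub1) (primitive_on_sub pV' m0 sub2) bs bt.
pose c := w t0 - w' t0.
pose E := [set s | D s /\ w s - w' s = c].
suff ED : E = D by have [] : E s0 by rewrite ED.
apply: cD; first by exists t0; split.
- exists [set s | D s -> w s - w' s = c]°; first exact: open_interior.
  apply/seteqP; split => s.
    by move=> [Ds ws]; split => //; apply: filterS (loc s Ds) => z hz /hz ->.
  by move=> [Ds /nbhs_singleton/(_ Ds)].
- exists (~` [set s | D s -> w s - w' s <> c]°); first exact/open_closedC/open_interior.
  apply/seteqP; split => s.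
    by move=> [Ds ws]; split => // /nbhs_singleton/(_ Ds).
  move=> [Ds nws]; split => //; apply: contrapT => ws; apply: nws.
  by apply: filterS (loc s Ds) => z hz /hz ->.
Qed.

Lemma lift_shift {T : topologicalType} (D : set T) K w c : lift_on D K w ->
  lift_on D K (fun t => w t + c).
Proof.
move=> h t Dt; have [V [r [pV n]]] := h t Dt.
exists (fun q => V q + c), r; split; first exact: primitive_on_shift.
by apply: filterS n => s hs /hs ->.
Qed.

(** A shift of [w2] makes the lifts agree at one point of the connected overlap, hence on all of it.
    At an overlap point the two local primitives then coincide on a common ball, so one of them
    serves both pieces; elsewhere closedness keeps the other piece away. *)
Lemma lift_glue {T : topologicalType} (D1 D2 : set T) K w1 w2 : continuous K ->
  closed D1 -> closed D2 -> D1 `&` D2 !=set0 -> connected (D1 `&` D2) ->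
  lift_on D1 K w1 -> lift_on D2 K w2 -> exists w, lift_on (D1 `|` D2) K w.
Proof.
move=> cK cD1 cD2 [t0 [t01 t02]] cD h1 h2'.
pose c := w1 t0 - w2 t0.
have h2 := lift_shift c h2'.
have agree t : D1 t -> D2 t -> w2 t + c = w1 t.
  move=> t1 t2; have u := lift_unique cK cD (lift_sub (@subIsetl _ _ _) h1) (lift_sub (@subIsetr _ _ _) h2').
  by have := u t t0 (conj t1 t2) (conj t01 t02); rewrite -/c => <-; ring.
pose w t := if pselect (D1 t) then w1 t else w2 t + c.
have wE1 t : D1 t -> w t = w1 t by rewrite /w; case: pselect.
have wE2 t : D2 t -> w t = w2 t + c.
  by move=> t2; rewrite /w; case: pselect => // t1; rewrite agree.
exists w => t.
have [t1|nt1] := pselect (D1 t); have [t2|nt2] := pselect (D2 t) => tU.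
- have [V [r [pV n]]] := h1 t t1; have [V' [r' [pV' n']]] := h2 t t2.
  pose m := Num.min r r'.
  have m0 : 0 < m by rewrite lt_min pV.1 pV'.1.
  have sub1 : ball (K t) m `<=` ball (K t) r by apply: le_ball; rewrite ge_min lexx.
  have sub2 : ball (K t) m `<=` ball (K t) r' by apply: le_ball; rewrite ge_min lexx orbT.
  have pm := primitive_on_sub pV m0 sub1; have pm' := primitive_on_sub pV' m0 sub2.
  have bt : ball (K t) m (K t) by exact: ballxx.
  have VV : V (K t) = V' (K t).
    rewrite -(nbhs_singleton n t1) -(nbhs_singleton n' t2).
    by rewrite agree.
  have Vm q : ball (K t) m q -> V q = V' q.
    by move=> bq; have := primitive_on_unique pm pm' bq bt; rewrite VV subrr => /eqP; rewrite subr_eq0 => /eqP.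
  exists V, r; split => //.
  apply: filterS3 n n' (near_ball t cK m0) => s hs hs' bs [s1|s2].
    by rewrite wE1 //; exact: hs.
  by rewrite wE2 // (hs' s2) Vm.
- have [V [r [pV n]]] := h1 t t1; exists V, r; split => //.
  have n' : nbhs t (~` D2) by apply: open_nbhs_nbhs; split => //; exact: closed_openC.
  apply: filterS2 n n' => s hs s2 [s1|//].
  by rewrite wE1 //; exact: hs.
- have [V [r [pV n]]] := h2 t t2; exists V, r; split => //.
  have n' : nbhs t (~` D1) by apply: open_nbhs_nbhs; split => //; exact: closed_openC.
  apply: filterS2 n n' => s hs s2 [//|s1].
  by rewrite wE2 //; exact: hs.
- by case: tU.
Qed.

End Lifts.

(** * Monodromy and global primitives *)

Section Monodromy.
Context {R : realType}.
Implicit Types (A B V : R * R -> R) (p q : R * R) (Omega : set (R * R)).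

Local Notation rect a b c d := (`[(a : R), (b : R)]%classic `*` `[(c : R), (d : R)]%classic : set (R * R)).

Lemma continuous_pair {T : topologicalType} (f g : T -> R) :
  continuous f -> continuous g -> continuous (fun t => (f t, g t)).
Proof. by move=> cf cg t; exact: cvg_pair (cf t) (cg t). Qed.

(** [S] is a union of segments that share the centre [c]. *)
Lemma star_connected (S : set (R * R)) (c : R * R) : S c ->
  (forall p (t : R), S p -> 0 <= t <= 1 -> S (c.1 + t * (p.1 - c.1), c.2 + t * (p.2 - c.2))) ->
  connected S.
Proof.
move=> Sc star.
pose seg (p : R * R) (t : R) : R * R := (c.1 + t * (p.1 - c.1), c.2 + t * (p.2 - c.2)).
have segc p : continuous (seg p).
  have lin (a b : R) : continuous (fun t : R => a + t * b).
    by move=> t; apply: cvgD; [exact: cvg_cst|apply: cvgM; [exact: cvg_id|exact: cvg_cst]].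
  exact: continuous_pair (lin _ _) (lin _ _).
have -> : S = \bigcup_(p in S) (seg p @` `[0, 1]).
  apply/seteqP; split=> [p Sp|_ [p Sp [t t01 <-]]].
    exists p => //; exists 1; first by rewrite /= ?in_itv /= ler01 lexx.
    by rewrite /seg !mul1r ![_ + (_ - _)]addrC !subrK -surjective_pairing.
  by apply: star => //; move: t01; rewrite /= ?in_itv.
apply: bigcup_connected.
  exists c => p Sp; exists 0; first by rewrite /= ?in_itv /= ler01 lexx.
  by rewrite /seg !mul0r !addr0 -surjective_pairing.
move=> p _; apply: connected_continuous_connected; first exact: segment_connected.
exact: continuous_subspaceT.
Qed.

Lemma rect_connected (a b c d : R) : a <= b -> c <= d -> connected (rect (a) (b) (c) (d)).
Proof.
move=> ab cd; apply: (@star_connected _ (a, c)).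
  by split; rewrite /= ?in_itv /= lexx ?ab ?cd.
move=> p t [s1 s2]; move: s1 s2; rewrite /= ?in_itv /= => /andP[p1 p1'] /andP[p2 p2'] /andP[t0 t1].
have m (x y z : R) : x <= y -> y <= z -> x <= x + t * (y - x) <= z.
  move=> xy yz; have : 0 <= t * (y - x) by rewrite mulr_ge0 // subr_ge0.
  have : t * (y - x) <= 1 * (y - x) by rewrite ler_wpM2r // subr_ge0.
  by move=> h1 h2; apply/andP; split; lra.
by split; exact: m.
Qed.

Lemma rect_closed (a b c d : R) : closed (rect (a) (b) (c) (d)).
Proof. apply: compact_closed; [exact: norm_hausdorff|exact: segment_prod_compact]. Qed.

Definition local_primitives Omega A B := forall p, Omega p ->
  exists V r, ball p r `<=` Omega /\ primitive_on A B V p r.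

(** Compactness makes the radius uniform: any cell of a mesh finer than [d] is mapped into the
    domain of a single local primitive. *)
Lemma lebesgue_number Omega A B (K : R * R -> R * R) (S : set (R * R)) :
  compact S -> continuous K -> K @` S `<=` Omega -> local_primitives Omega A B ->
  exists2 d : R, 0 < d & forall t, S t -> exists V p r,
    primitive_on A B V p r /\ forall s, ball t d s -> ball p r (K s).
Proof.
move=> cS cK KS loc.
pose P (d : R) (t : R * R) := exists V p r,
    primitive_on A B V p r /\ forall s, ball t d s -> ball p r (K s).
have H : forall t, S t -> \forall t' \near t & d \near (0 : R)^'+, P d t'.
  move=> t St; have [|V [r [_ pV]]] := loc (K t); first by apply: KS; exists t.
  have [e /= e0 He] := (iffLR (nbhs_ballP _ _)) (near_ball t cK pV.1).
  exists (ball t (e / 2), [set d | d < e / 2]) => /=.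
    split; first by apply: nbhsx_ballx; rewrite divr_gt0.
    by apply: nbhs_right_lt; rewrite divr_gt0.
  move=> [t' d] [/= tt' de]; exists V, (K t), r; split => // s st'.
  apply: He; rewrite (splitr e); apply: ball_triangle tt' _.
  by apply: le_ball st'; exact: ltW.
have := (iffLR (compact_near_coveringP S)) cS R (0 : R)^'+ P _ H.
move=> /(_ _)[d /= d0 Hd].
exists (d / 2); first by rewrite divr_gt0.
move=> t St; apply: (Hd (d / 2)) => //=.
  by rewrite /ball /= sub0r normrN gtr0_norm ?divr_gt0 //; lra.
by rewrite divr_gt0.
Qed.

(** A lift exists on each cell of a fine grid. Cells are glued into rows and rows into the square;
    each overlap is a segment, hence connected, as gluing requires. *)
Lemma square_lift Omega A B (K : R * R -> R * R) :
  continuous K -> K @` (rect (0) (1) (0) (1)) `<=` Omega -> local_primitives Omega A B ->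
  exists w, lift_on A B (rect (0) (1) (0) (1)) K w.
Proof.
move=> cK KS loc.
have [d d0 Hd] := lebesgue_number (@segment_prod_compact R 0 1 0 1) cK KS loc.
(* The mesh 1/N is below [d], so each closed cell lies in the [d]-ball around its lower left
   corner. *)
pose N := (Num.trunc d^-1).+1.
have N0 : 0 < N%:R :> R by rewrite ltr0n.
have Nd : N%:R^-1 < d.
  by rewrite invf_plt ?posrE // truncnS_gt.
pose x (i : nat) : R := i%:R / N%:R.
have x_ge0 i : 0 <= x i by rewrite divr_ge0 ?ler0n.
have x0 : x 0%N = 0 by rewrite /x mul0r.
have xS i : x i.+1 = x i + N%:R^-1 by rewrite /x -natr1 mulrDl mul1r.
have x_le i : x i <= x i.+1 by rewrite xS lerDl invr_ge0 ltW.
have x_le1 i : (i <= N)%N -> x i <= 1 by move=> iN; rewrite /x ler_pdivrMr // mul1r ler_nat.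
have xN : x N = 1 by rewrite /x divff // gt_eqF.
have cell i j : (i < N)%N -> (j < N)%N ->
    exists w, lift_on A B (rect (x i) (x i.+1) (x j) (x j.+1)) K w.
  move=> iN jN; have [|V [p [r [pV bK]]]] := Hd (x i, x j).
    by split; rewrite /= ?in_itv /= x_ge0 x_le1 // ltnW.
  exists (V \o K); apply: lift_in_ball cK pV _ => t [/=].
  rewrite /= ?in_itv /= !xS => /andP[? ?] /andP[? ?]; apply: bK; split;
    by rewrite /ball /= distrC ger0_norm; lra.
have row j : (j < N)%N -> forall i, (i < N)%N ->
    exists w, lift_on A B (rect (0) (x i.+1) (x j) (x j.+1)) K w.
  move=> jN; elim=> [|i IH] iN; first by rewrite -{1}x0; exact: cell.
  have [w1 h1] := IH (ltnW iN); have [w2 h2] := cell i.+1 j iN jN.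
  have EI : (rect (0) (x i.+1) (x j) (x j.+1)) `&` (rect (x i.+1) (x i.+2) (x j) (x j.+1)) =
      rect (x i.+1) (x i.+1) (x j) (x j.+1).
    apply/seteqP; split => [[s t] [[/= + tj] [/= + _]]|[s t] [/= + tj]].
      by rewrite /= ?in_itv /= => /andP[_ ->] /andP[-> _].
    rewrite /= ?in_itv /= => /andP[s1 s2].
    by split; split => //=; rewrite /= ?in_itv /= ?s1 ?s2 ?(le_trans (x_ge0 i.+1) s1) ?(le_trans s2 (x_le i.+1)).
  have EU : (rect (0) (x i.+1) (x j) (x j.+1)) `|` (rect (x i.+1) (x i.+2) (x j) (x j.+1)) =
      rect (0) (x i.+2) (x j) (x j.+1).
    apply/seteqP; split => [[s t] [[/= + tj]|[/= + tj]]|[s t] [/= + tj]]; rewrite /= ?in_itv /= => /andP[s1 s2].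
    - by split => //=; rewrite /= ?in_itv /= s1 (le_trans s2 (x_le _)).
    - by split => //=; rewrite /= ?in_itv /= s2 (le_trans _ s1).
    - have [le|le] := leP s (x i.+1); [left|right]; split => //=; rewrite /= ?in_itv /=.
        by rewrite s1 ?le.
      by rewrite s2 ?(ltW le).
  rewrite -EU; apply: (lift_glue cK) h1 h2; rewrite ?EI;
    [exact: rect_closed|exact: rect_closed| |exact: rect_connected].
  by exists (x i.+1, x j); split; rewrite /= ?in_itv /= lexx ?x_le.
have N1 : N.-1.+1 = N by [].
suff H j : (j < N)%N -> exists w, lift_on A B (rect (0) (1) (0) (x j.+1)) K w.
  by rewrite -[in X in _ `*` X]xN; exact: (H N.-1).
elim: j => [|j IH] jN.
  by have := row 0%N jN N.-1 (ltnSn _); rewrite N1 xN x0.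
have [w1 h1] := IH (ltnW jN).
have [w2 h2] : exists w, lift_on A B (rect (0) (1) (x j.+1) (x j.+2)) K w.
  by rewrite -[in X in X `*` _]xN; exact: (row j.+1 jN N.-1 (ltnSn _)).
have EI : (rect (0) (1) (0) (x j.+1)) `&` (rect (0) (1) (x j.+1) (x j.+2)) =
    rect (0) (1) (x j.+1) (x j.+1).
  apply/seteqP; split => [[s t] [[/= si +] [/= _ +]]|[s t] [/= si +]].
    by rewrite /= ?in_itv /= => /andP[_ t1] /andP[t2 _]; split => //=; rewrite /= ?in_itv /= t1 t2.
  rewrite /= ?in_itv /= => /andP[s1 s2].
  by split; split => //=; rewrite /= ?in_itv /= ?s1 ?s2 ?(le_trans (x_ge0 j.+1) s1) ?(le_trans s2 (x_le j.+1)).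
have EU : (rect (0) (1) (0) (x j.+1)) `|` (rect (0) (1) (x j.+1) (x j.+2)) =
    rect (0) (1) (0) (x j.+2).
  apply/seteqP; split => [[s t] [[/= si +]|[/= si +]]|[s t] [/= si +]]; rewrite /= ?in_itv /= => /andP[s1 s2].
  - by split => //=; rewrite /= ?in_itv /= s1 (le_trans s2 (x_le _)).
  - by split => //=; rewrite /= ?in_itv /= s2 (le_trans _ s1).
  - have [le|le] := leP t (x j.+1); [left|right]; split => //=; rewrite /= ?in_itv /=.
      by rewrite s1 ?le.
    by rewrite s2 ?(ltW le).
rewrite -EU; apply: (lift_glue cK) h1 h2; rewrite ?EI;
    [exact: rect_closed|exact: rect_closed| |exact: rect_connected].
by exists (0, x j.+1); split; rewrite /= ?in_itv /= lexx ?ler01.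
Qed.

(** The path is viewed as a map of the square that is constant in the first variable, and the lift
    is restricted to the side [s = 0]. *)
Lemma path_lift Omega A B (g : R -> R * R) :
  continuous g -> g @` (@unit_itv R) `<=` Omega -> local_primitives Omega A B ->
  exists w, lift_on A B (@unit_itv R) g w.
Proof.
move=> cg gO loc.
have cK : continuous (g \o (snd : R * R -> R)).
  by move=> z; apply: continuous_comp; [exact: continuous_snd|exact: cg].
have [|w hw] := square_lift cK _ loc.
  by move=> _ [[s t] [_ /= t01] <-]; apply: gO; exists t.
exists (w \o (fun t => (0, t))).
have cp : continuous (fun t : R => (0 : R, t)) by move=> t; exact: cvg_pair (cvg_cst _) cvg_id.
apply: (lift_comp cp _ hw) => t t01; split => //=.
by rewrite in_itv /= lexx ler01.
Qed.

(** Composing with this retraction onto the unit interval turns a map continuous only within the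
    interval into one continuous on the whole line, the form that lifts require. *)
Definition clamp (t : R) : R := Num.max 0 (Num.min 1 t).

Lemma clamp_unit t : unit_itv (clamp t).
Proof. by rewrite /unit_itv /clamp /= in_itv /= le_max lexx /= ge_max ler01 ge_min lexx. Qed.

Lemma clamp_id t : unit_itv t -> clamp t = t.
Proof.
rewrite /unit_itv /clamp /= in_itv /= => /andP[t0 t1].
by rewrite min_r // max_r.
Qed.

Lemma clamp_le0 t : t <= 0 -> clamp t = 0.
Proof. by move=> t0; rewrite /clamp max_l // ge_min t0 orbT. Qed.

Lemma clamp_ge1 t : 1 <= t -> clamp t = 1.
Proof. by move=> t1; rewrite /clamp min_l // max_r. Qed.

Lemma continuous_clamp : continuous clamp.
Proof.
move=> t.
have c0 : {for t, continuous (cst 0 : R -> R^o)} by exact: cvg_cst.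
have c1 : {for t, continuous (cst 1 : R -> R^o)} by exact: cvg_cst.
have ci : {for t, continuous (id : R -> R^o)} by exact: cvg_id.
exact: continuous_max c0 (continuous_min c1 ci).
Qed.

Lemma within_comp_continuous {T U V : topologicalType} (S : set U) (f : U -> V) (phi : T -> U) :
  {within S, continuous f} -> continuous phi -> (forall t, S (phi t)) ->
  continuous (f \o phi).
Proof.
move=> cf cphi Sphi t W /= nW.
have H : within S (nbhs (phi t)) (f @^-1` W).
  by rewrite (nbhs_subspace_in (Sphi t)); exact: cf.
have H' : \forall s \near t, S (phi s) -> W (f (phi s)) := cphi t _ H.
by apply: filterS H' => s; apply; exact: Sphi.
Qed.

Lemma simply_connected_path_lift Omega A B a p : simply_connected Omega ->
  local_primitives Omega A B -> Omega a -> Omega p ->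
  exists (g : R -> R * R) (w : R -> R), [/\ continuous g, g @` (@unit_itv R) `<=` Omega,
    g 0 = a, g 1 = p & lift_on A B (@unit_itv R) g w].
Proof.
move=> [pc _] loc Oa Op; have [g0 [[cg gO] ga gp]] := pc a p Oa Op.
pose g := g0 \o clamp.
have cg' : continuous g := within_comp_continuous cg continuous_clamp clamp_unit.
have u0 : (@unit_itv R) 0 by rewrite /unit_itv /= in_itv /= lexx ler01.
have u1 : (@unit_itv R) 1 by rewrite /unit_itv /= in_itv /= lexx ler01.
have gO' : g @` (@unit_itv R) `<=` Omega.
  by move=> _ [t _ <-]; apply: gO; exists (clamp t) => //; exact: clamp_unit.
have [w hw] := path_lift cg' gO' loc.
by exists g, w; split => //; rewrite /g /= clamp_id.
Qed.

Lemma unit_itv_connected : connected (@unit_itv R).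
Proof. exact: segment_connected. Qed.

(** The whole homotopy is lifted. Its sides [t = 0], [s = 1] and [t = 1] go to the base point, where
    a lift is constant; following them shows that the lift agrees at the two ends of the side
    [s = 0], which carries the loop. *)
Lemma contractible_lift Omega A B (L : R -> R * R) u : local_primitives Omega A B ->
  continuous L -> L 0 = L 1 -> contractible_loop Omega L ->
  lift_on A B (@unit_itv R) L u -> u 1 = u 0.
Proof.
move=> loc cL L01 [K0 [cK0 KO K0L K1 Kbase]] hu.
pose K := K0 \o (fun z : R * R => (clamp z.1, clamp z.2)).
have cc : continuous (fun z : R * R => (clamp z.1, clamp z.2)).
  apply: continuous_pair => z.
    exact: (continuous_comp (@continuous_fst R z) (@continuous_clamp _)).
  exact: (continuous_comp (@continuous_snd R z) (@continuous_clamp _)).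
have cK : continuous K.
  by apply: within_comp_continuous cK0 cc _ => z; split; exact: clamp_unit.
have KE s t : unit_itv s -> unit_itv t -> K (s, t) = K0 (s, t).
  by move=> us ut; rewrite /K /= !clamp_id.
have [|w hw] := square_lift cK _ loc.
  by move=> _ [[s t] [us ut] <-]; rewrite KE //; apply: KO; exists (s, t).
have u0 : (@unit_itv R) 0 by rewrite /unit_itv /= in_itv /= lexx ler01.
have u1 : (@unit_itv R) 1 by rewrite /unit_itv /= in_itv /= lexx ler01.
have OL0 : Omega (L 0) by rewrite -(K0L 0 u0); apply: KO; exists (0, 0).
have edge (phi : R -> R * R) : continuous phi ->
    (forall t, unit_itv t -> [/\ unit_itv (phi t).1, unit_itv (phi t).2 & K (phi t) = L 0]) ->
    w (phi 0) = w (phi 1).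
  move=> cphi hphi.
  have h1 : lift_on A B (@unit_itv R) (cst (L 0)) (w \o phi).
    apply: (@lift_ext _ _ _ _ _ (K \o phi)); first by move=> t /hphi[].
    by apply: (lift_comp cphi _ hw) => t /hphi[].
  have [V [r [_ pV]]] := loc (L 0) OL0.
  have r0 := pV.1.
  have h2 : lift_on A B (@unit_itv R) (cst (L 0)) (V \o cst (L 0)).
    apply: lift_in_ball pV _; first by move=> t; exact: cvg_cst.
    by move=> t _; exact: ballxx.
  have cc0 : continuous (cst (L 0) : R -> R * R) by move=> t; exact: cvg_cst.
  have := lift_unique cc0 unit_itv_connected h1 h2 u0 u1.
  by move=> /= /addIr.
have cpair1 (c : R) : continuous (fun t : R => (t, c)) by move=> t; exact: cvg_pair cvg_id (cvg_cst _).
have cpair2 (c : R) : continuous (fun t : R => (c, t)) by move=> t; exact: cvg_pair (cvg_cst _) cvg_id.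
have e1 := edge _ (cpair1 0) (fun t ut => And3 ut u0 (etrans (KE _ _ ut u0) (Kbase t ut).1)).
have e2 := edge _ (cpair1 1) (fun t ut => And3 ut u1 (etrans (KE _ _ ut u1) (Kbase t ut).2)).
have e3 := edge _ (cpair2 1) (fun t ut => And3 u1 ut (etrans (KE _ _ u1 ut) (K1 t ut))).
have hL : lift_on A B (@unit_itv R) L (w \o (fun t => (0, t))).
  apply: (@lift_ext _ _ _ _ _ (K \o (fun t => (0, t)))).
    by move=> t ut; rewrite /= KE // K0L.
  by apply: (lift_comp (cpair2 0) _ hw) => t ut; split.
have := lift_unique cL unit_itv_connected hu hL u0 u1.
rewrite /= e1 e3 -e2 => /eqP; rewrite -subr_eq0 => /eqP; lra.
Qed.

(** [V p] is the increment of a lift along some chosen path from [a] to [p]. For [q] near [p], the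
    loop made of the path to [p], the segment to [q] and the reversed path from [q] is contractible,
    so the three increments cancel and [V] differs from the local primitive [U] by a constant. *)
Lemma global_primitive Omega A B : open Omega -> simply_connected Omega ->
  local_primitives Omega A B ->
  exists V, forall p, Omega p -> has_grad V (A p) (B p) p.
Proof.
move=> oO sc loc.
have [[a Oa]|Oe] := pselect (Omega !=set0); last first.
  by exists (cst 0) => p Op; exfalso; apply: Oe; exists p.
have /choice[G HG] : forall p, exists gw : (R -> R * R) * (R -> R), Omega p ->
    [/\ continuous gw.1, gw.1 @` (@unit_itv R) `<=` Omega,
      gw.1 0 = a, gw.1 1 = p & lift_on A B (@unit_itv R) gw.1 gw.2].
  move=> p.
  have [Op|nOp] := pselect (Omega p); last by exists (cst 0, cst 0).
  have [g [w h]] := simply_connected_path_lift sc loc Oa Op.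
  by exists (g, w).
pose V p := (G p).2 1 - (G p).2 0.
exists V => p Op.
have [U [r [bO pU]]] := loc p Op.
suff E q : ball p r q -> V q = U q + (V p - U p).
  apply: (@has_grad_near _ (fun q => U q + (V p - U p))).
    have := nbhsx_ballx p _ pU.1; apply: filterS => q /E; exact: esym.
  apply: has_grad_eq (has_gradD (pU.2 p (ballxx _ pU.1)) (has_grad_cst (V p - U p) p)) _ _ _ => //;
    by rewrite addr0.
move=> bq; have Oq := bO q bq.
rewrite /V; have [cgp gpO gp0 gp1 hp] := HG p Op; have [cgq gqO gq0 gq1 hq] := HG q Oq.
move: (G p).1 (G p).2 (G q).1 (G q).2 cgp gpO gp0 gp1 hp cgq gqO gq0 gq1 hq.
move=> gp wp gq wq cgp gpO gp0 gp1 hp cgq gqO gq0 gq1 hq.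
have caff (b c : R) : continuous (fun t : R => clamp (b * t + c)).
  have ca : continuous (fun t : R => b * t + c).
    by move=> t; apply: cvgD; [apply: cvgM; [exact: cvg_cst|exact: cvg_id]|exact: cvg_cst].
  by move=> t; exact: (continuous_comp (ca t) (@continuous_clamp _)).
(* Three clocks, one for each third of the unit interval; [f3] runs backwards. On each third only
   one term of [L] moves, so a single formula describes the concatenated loop and its continuity
   needs no case analysis. *)
pose f1 (t : R) := clamp (3 * t + 0).
pose f2 (t : R) := clamp (3 * t + -1).
pose f3 (t : R) := clamp (-3 * t + 3).
pose L t : R * R := gp (f1 t) + (f2 t * (q.1 - p.1), f2 t * (q.2 - p.2)) + (gq (f3 t) - q).
have cL : continuous L.
  move=> t; apply: cvgD.
    apply: cvgD; first exact: (continuous_comp (caff 3 0 t) (cgp _)).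
    have hc (c : R) : continuous (fun t => f2 t * c).
      by move=> s; apply: cvgM; [exact: caff|exact: cvg_cst].
    have hcc := continuous_pair (hc (q.1 - p.1)) (hc (q.2 - p.2)).
    exact: hcc.
  by apply: cvgB; [exact: (continuous_comp (caff (-3) 3 t) (cgq _))|exact: cvg_cst].
have L1 t : t <= 3^-1 -> L t = gp (f1 t).
  move=> t3; rewrite /L /f2 /f3 clamp_le0; last by lra.
  rewrite clamp_ge1; last by lra.
  by rewrite gq1 subrr !mul0r !addr0.
have L2 t : 3^-1 <= t <= 2 / 3 ->
    L t = (p.1 + (3 * t - 1) * (q.1 - p.1), p.2 + (3 * t - 1) * (q.2 - p.2)).
  move=> /andP[t1 t2]; rewrite /L /f1 /f2 /f3 [clamp (3 * t + 0)]clamp_ge1; last by lra.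
  rewrite [clamp (-3 * t + 3)]clamp_ge1; last by lra.
  rewrite gq1 subrr addr0 gp1 clamp_id //.
  by rewrite /unit_itv /= in_itv /=; apply/andP; split; lra.
have L3 t : 2 / 3 <= t -> L t = gq (f3 t).
  move=> t3; rewrite /L /f1 /f2 [clamp (3 * t + 0)]clamp_ge1; last by lra.
  rewrite [clamp (3 * t + -1)]clamp_ge1; last by lra.
  rewrite gp1 !mul1r [gq _ - q]addrC addrA.
  have -> : p + (q.1 - p.1, q.2 - p.2) = q.
    by apply/pair_eqP; rewrite /= ![_ + (_ - _)]addrC !subrK !eqxx.
  by rewrite subrr add0r.
have uI (t : R) : unit_itv t = (0 <= t <= 1) by rewrite /unit_itv /= in_itv.
have u0 : (@unit_itv R) 0 by rewrite uI lexx ler01.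
have u1 : (@unit_itv R) 1 by rewrite uI lexx ler01.
have L2ball t : 3^-1 <= t <= 2 / 3 -> ball p r (L t).
  move=> t23; rewrite L2 //; apply: ball_segment => //; first exact: ballxx pU.1.
  by move: t23 => /andP[t1 t2]; apply/andP; split; lra.
have LO : L @` (@unit_itv R) `<=` Omega.
  move=> _ [t ut <-].
  have [t1|t1] := leP t 3^-1.
    by rewrite L1 //; apply: gpO; exists (f1 t) => //; exact: clamp_unit.
  have [t2|t2] := leP t (2 / 3); last first.
    by rewrite L3 ?ltW //; apply: gqO; exists (f3 t) => //; exact: clamp_unit.
  by apply: bO; apply: L2ball; rewrite t2 ltW.
have [u hu] := path_lift cL LO loc.
have f10 : f1 0 = 0 by rewrite /f1 clamp_le0 //; lra.
have f31 : f3 1 = 0 by rewrite /f3 clamp_le0 //; lra.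
have L0a : L 0 = a by rewrite L1 ?f10 ?gp0 // invr_ge0.
have L1a : L 1 = a by rewrite L3 ?f31 ?gq0 //; lra.
have uu : u 1 = u 0.
  apply: (contractible_lift loc cL) hu; first by rewrite L0a L1a.
  apply: (proj2 sc); last by rewrite L0a L1a.
  by split => //; exact: continuous_subspaceT.
have sub_unit (c d : R) : 0 <= c -> d <= 1 -> `[c, d] `<=` (@unit_itv R).
  by move=> c0 d1 t; rewrite uI /= in_itv /= => /andP[? ?]; apply/andP; split; lra.
(* By uniqueness of lifts, the increment of [u] on a third can be computed from any other lift
   there. *)
have step (c d : R) w : 0 <= c -> c <= d -> d <= 1 -> lift_on A B `[c, d]%classic L w ->
    u d - u c = w d - w c.
  move=> c0 cd d1 hw.
  have hu' := lift_sub (sub_unit c d c0 d1) hu.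
  have cc : (`[c, d]%classic : set R) c by rewrite /= in_itv /= lexx cd.
  have dd : (`[c, d]%classic : set R) d by rewrite /= in_itv /= lexx cd.
  have := lift_unique cL (@segment_connected R c d) hu' hw cc dd; lra.
have s1 : u 3^-1 - u 0 = wp 1 - wp 0.
  have -> : wp 1 - wp 0 = (wp \o f1) 3^-1 - (wp \o f1) 0.
    by rewrite /= f10 /f1 clamp_ge1 //; lra.
  refine (step 0 3^-1 (wp \o f1) _ _ _ _); [lra|lra|lra|].
  apply: (@lift_ext _ _ _ _ _ (gp \o f1)).
    by move=> t; rewrite /= in_itv /= => /andP[_ t1]; rewrite L1.
  by apply: lift_comp hp; [exact: caff|move=> t _; exact: clamp_unit].
have s2 : u (2 / 3) - u 3^-1 = U q - U p.
  have -> : U q - U p = (U \o L) (2 / 3) - (U \o L) 3^-1.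
    rewrite /= !L2; try by apply/andP; split; lra.
    have -> : (3 : R) * (2 / 3) - 1 = 1 by lra.
    have -> : (3 : R) * 3^-1 - 1 = 0 by lra.
    by rewrite !mul1r !mul0r !addr0 ![_ + (_ - _)]addrC !subrK -!surjective_pairing.
  refine (step 3^-1 (2 / 3) (U \o L) _ _ _ _); [lra|lra|lra|].
  apply: lift_in_ball pU _ => // t; rewrite /= in_itv /=; exact: L2ball.
have s3 : u 1 - u (2 / 3) = wq 0 - wq 1.
  have -> : wq 0 - wq 1 = (wq \o f3) 1 - (wq \o f3) (2 / 3).
    by rewrite /= f31 /f3 clamp_ge1 //; lra.
  refine (step (2 / 3) 1 (wq \o f3) _ _ _ _); [lra|lra|lra|].
  apply: (@lift_ext _ _ _ _ _ (gq \o f3)).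
    by move=> t; rewrite /= in_itv /= => /andP[t1 _]; rewrite L3.
  by apply: lift_comp hq; [exact: caff|move=> t _; exact: clamp_unit].
lra.
Qed.

End Monodromy.

(** * Simply connected domains *)

Section SimplyConnected.
Context {R : realType}.
Implicit Types (u v w : R * R -> R) (p q z : R * R) (Omega U : set (R * R)).

Lemma Ck_on_opp k U u : open U -> Ck_on k U u -> Ck_on k U (fun z => - u z).
Proof.
move=> oU cu; apply: (Ck_on_ext oU _ (Ck_on_comb (-1) 0 oU cu cu)) => p _.
by rewrite mul0r addr0 mulN1r.
Qed.

(** The conjugate is a primitive of - u_y dx + u_x dy, a closed form because [u] is harmonic. The
    complex derivatives are u_x - i u_y and u_xx - i u_xy; the second one uses the symmetry of mixed
    partials. *)
Lemma harmonic_conjugate Omega u : open Omega -> simply_connected Omega ->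
  harmonic_on Omega u -> exists V, hol 2 Omega (fun z => (u z, V z)).
Proof.
move=> oO sc [cu lap]; have cu1 := Ck_onW oO cu; case: (cu) => du c1 c2.
have C1 : Ck_on 1 Omega (pd1 u) := c1.
have C2 : Ck_on 1 Omega (pd2 u) := c2.
have gu p (Op : Omega p) := Ck1_has_grad oO cu1 Op.
have g1 p (Op : Omega p) := Ck1_has_grad oO C1 Op.
have g2 p (Op : Omega p) := Ck1_has_grad oO C2 Op.
have gN2 p (Op : Omega p) : has_grad (fun z => - pd2 u z) (- pd1 (pd2 u) p) (- pd2 (pd2 u) p) p.
  by apply: has_grad_eq (has_gradB (has_grad_cst 0 p) (g2 p Op)) _ _ _ => [z||] /=; rewrite sub0r.
have [V hV] : exists V, forall p, Omega p -> has_grad V (- pd2 u p) (pd1 u p) p.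
  apply: (@global_primitive R Omega (fun p => - pd2 u p) (pd1 u) oO sc) => p Op.
  have AB q : Omega q -> pd2 (fun p => - pd2 u p) q = pd1 (pd1 u) q.
    move=> Oq; have [_ ->] := has_grad_pd2 (gN2 q Oq).
    by have := lap q Oq; move: (pd1 _ _) (pd2 _ _) => x y /eqP; rewrite addr_eq0 => /eqP ->.
  have [W [r [r0 rO rW]]] := local_primitive oO (Ck_on_opp oO C2) C1 AB Op.
  by exists W, r; split.
have mix p (Op : Omega p) : pd2 (pd1 u) p = pd1 (pd2 u) p.
  case: c1 => d1 _ c12; case: c2 => d2 c21 _.
  apply: mixed_partials; [|exact: c12 p Op|exact: c21 p Op].
  have := open_nbhs_nbhs (conj oO Op); apply: filterS => q Oq.
  by split; [exact: (du q Oq).1|exact: (du q Oq).2|exact: (d1 q Oq).2|exact: (d2 q Oq).1].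
exists V; exists (fun z => (pd1 u z, - pd2 u z)).
  move=> p Op; split; last exact: hV p Op.
  by rewrite /= opprK; exact: gu p Op.
exists (fun z => (pd1 (pd1 u) z, - pd1 (pd2 u) z)).
  move=> p Op; split => /=.
    by rewrite opprK -(mix p Op); exact: g1 p Op.
  refine (has_grad_eq (gN2 p Op) (fun z => erefl) (erefl _) _).
  by have := lap p Op; move: (pd1 _ _) (pd2 _ _) => x y /eqP; rewrite addr_eq0 => /eqP ->.
case: c1 => _ c11 _; case: c2 => _ c21 _.
move=> p Op; split; first exact: c11 p Op.
exact: cvgN (c21 p Op).
Qed.

Lemma punctured_limit u v p : {for p, continuous u} -> {for p, continuous v} ->
  (\forall z \near p, z <> p -> u z = v z) -> u p = v p.
Proof.
move=> cu cv uv; apply/eqP/negPn/negP => neq.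
have e0 : 0 < `|u p - v p| / 2 by rewrite divr_gt0 // normr_gt0 subr_eq0.
have [d /= d0 Hd] := (iffLR (nbhs_ballP _ _)) (filterI uv
  (filterI (continuous_near_dist cu e0) (continuous_near_dist cv e0))).
pose z : R * R := (p.1 + d / 2, p.2).
have bz : ball p d z.
  split; rewrite /ball /=; last by rewrite subrr normr0.
  by rewrite opprD addNKr normrN gtr0_norm ?divr_gt0 //; lra.
have zp : z <> p.
  move/(congr1 fst) => /= /eqP; rewrite -subr_eq0 addrAC subrr add0r => /eqP.
  have : 0 < d / 2 by rewrite divr_gt0.
  lra.
have [E [E1 E2]] := Hd z bz.
exact: (close_both_ways E1 E2 (E zp)).
Qed.

Lemma has_grad_lipschitz u a b p : has_grad u a b p -> exists2 K, 0 <= K &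
  \forall z \near p, `|u z - u p| <= K * `|z - p|.
Proof.
move=> /has_gradP /(_ 1 ltr01) H.
exists (`|a| + `|b| + 1); first by rewrite !addr_ge0.
rewrite (near_shift 0); apply: filterS H => h /= H.
rewrite subr0 addrK -[u (h + p) - u p](subrK (a * h.1 + b * h.2)).
apply: (le_trans (ler_normD _ _)); rewrite [leRHS]mulrDl [leRHS]addrC.
apply: lerD => //; apply: (le_trans (ler_normD _ _)); rewrite !normrM mulrDl.
by apply: lerD; rewrite ler_wpM2l // ?norm_fst_le ?norm_snd_le.
Qed.

Lemma sqmod_norm_le z : sqmod z <= 2 * `|z| ^+ 2.
Proof.
have sq (x : R) : `|x| <= `|z| -> x ^+ 2 <= `|z| ^+ 2.
  by move=> h; rewrite -[x ^+ 2]real_normK ?num_real // lerXn2r ?nnegrE.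
by have := sq _ (norm_fst_le z); have := sq _ (norm_snd_le z); rewrite /sqmod; lra.
Qed.

Lemma norm_sqmod_le z : `|z| ^+ 2 <= sqmod z.
Proof.
rewrite prod_normE /Num.max; case: ifP => _.
  by rewrite real_normK ?num_real // lerDr sqr_ge0.
by rewrite real_normK ?num_real // lerDl sqr_ge0.
Qed.

Lemma norm_le_sqmod (x : R) z (M : R) : 0 <= M -> `|x| <= `|z| -> sqmod z <= M ^+ 2 -> `|x| <= M.
Proof.
move=> M0 xz zM; apply: (le_trans xz); rewrite -(@ler_pXn2r _ 2) ?nnegrE //.
exact: le_trans (norm_sqmod_le z) zM.
Qed.

Lemma eucl_distE p q : eucl_dist p q = Num.sqrt (sqmod (q - p)).
Proof. by rewrite /eucl_dist /sqmod /= -[p.1 - q.1]opprB -[p.2 - q.2]opprB !sqrrN. Qed.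

Lemma eucl_dist_gt0 p q : q <> p -> 0 < eucl_dist p q.
Proof. by move=> /eqP qp; rewrite eucl_distE sqrtr_gt0 sqmod_gt0 subr_eq0. Qed.

Lemma eucl_dist_sqr p q : eucl_dist p q ^+ 2 = sqmod (q - p).
Proof. by rewrite eucl_distE sqr_sqrtr // sqmod_ge0. Qed.

Lemma expR_ln_dist p q : q <> p -> expR (2 * ln (eucl_dist p q)) = sqmod (q - p).
Proof.
move=> qp; rewrite expRM_natl lnK ?eucl_dist_sqr //.
by rewrite posrE; exact: eucl_dist_gt0.
Qed.

Lemma within_near_dist (S : set (R * R)) u p e : {within S, continuous u} -> S p -> 0 < e ->
  \forall z \near p, S z -> `|u z - u p| < e.
Proof.
move=> cu Sp e0.
have W : nbhs (u p) (ball (u p) e) by exact: nbhsx_ballx.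
have H : within S (nbhs p) (u @^-1` ball (u p) e).
  by rewrite (nbhs_subspace_in Sp); exact: cu.
have H' : \forall z \near p, S z -> ball (u p) e (u z) := H.
by apply: filterS H' => z h /h; rewrite /ball /= distrC.
Qed.

End SimplyConnected.

(** * Uniqueness for the Dirichlet problem with a puncture *)

Section PuncturedDirichlet.
Context {R : realType}.
Implicit Types (u v w : R * R -> R) (p q z : R * R) (Omega U : set (R * R)).

Lemma open_setD1 U (a : R * R) : open U -> open (U `\ a).
Proof.
move=> oU; apply: openI => //; apply: closed_openC.
by apply: accessible_closed_set1; apply: hausdorff_accessible; exact: norm_hausdorff.
Qed.

Lemma boundary_open Omega q : open Omega -> boundary Omega q <-> closure Omega q /\ ~ Omega q.
Proof.
move=> oO; rewrite /boundary; have -> : Omega° = Omega by apply/interior_id.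
by [].
Qed.

Lemma ln_dist_to_infty (a : R * R) (K : R) : \forall z \near a, z <> a -> K <= - ln (eucl_dist a z).
Proof.
(* In the sup-norm ball of this radius the Euclidean distance is at most sqrt 2 * e^-K / 2, hence
   below e^-K. *)
have e0 : 0 < expR (- K) / 2 by rewrite divr_gt0 ?expR_gt0.
have n : nbhs a (ball a (expR (- K) / 2)) by exact: nbhsx_ballx.
apply: filterS n => z [/= b1 b2] za.
rewrite lerNr -(expRK (- K)) ler_ln ?posrE ?expR_gt0 ?eucl_dist_gt0 //.
rewrite -(@ler_pXn2r _ 2) ?nnegrE ?expR_ge0 ?(ltW (eucl_dist_gt0 za)) // eucl_dist_sqr.
move: b1 b2; rewrite /ball /= distrC => b1; rewrite distrC => b2.
apply: (le_trans (sqmod_norm_le _)).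
have n0 : `|z - a| <= expR (- K) / 2 by rewrite prod_normE ge_max /= !ltW.
have n1 : `|z - a| ^+ 2 <= (expR (- K) / 2) ^+ 2 by rewrite lerXn2r ?nnegrE // ltW.
have : 0 <= expR (- K) ^+ 2 by rewrite sqr_ge0.
by move: n1; rewrite expr_div_n; lra.
Qed.

(* Removable singularity: the Green's function dominates any function bounded near the pole. *)
Lemma punctured_dirichlet_zero Omega (G : R * R -> R) w (a : R * R) (M : R) :
  open Omega -> bounded_set Omega -> Omega a ->
  harmonic_on (Omega `\ a) G ->
  (forall q, closure Omega q -> ~ Omega q -> forall e, 0 < e ->
     \forall z \near q, Omega z -> `|G z| < e) ->
  (forall K, \forall z \near a, z <> a -> K <= G z) ->
  harmonic_on (Omega `\ a) w ->
  (forall q, closure Omega q -> ~ Omega q -> forall e, 0 < e ->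
     \forall z \near q, Omega z -> `|w z| < e) ->
  (\forall z \near a, z <> a -> `|w z| <= M) ->
  forall z, Omega z -> z <> a -> w z = 0.
Proof.
move=> oO bO Oa hG Gb Ga hw wb wa.
have oD : open (Omega `\ a) by exact: open_setD1.
have bD : bounded_set (Omega `\ a).
  case: bO => N [Nr HN]; exists N; split => // N' NN' z [Oz _]; exact: HN N' NN' z Oz.
(* The maximum principle on the punctured domain, with the puncture as a boundary point: both terms
   vanish at the outer boundary, and near [a] the term [e * G] exceeds the bound [M]. *)
have half (s : R) : `|s| = 1 -> forall e z, 0 < e -> Omega z -> z <> a -> s * w z + - e * G z <= 0.
  move=> s1 e z e0 Oz za.
  have hc := harmonic_on_comb s (- e) oD hw hG.
  apply: (maximum_principle oD bD hc) (conj Oz za) => q clq nq d d0.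
  have clO : closure Omega q by apply: closureS clq => y [].
  have [Oq|nOq] := pselect (Omega q); last first.
    have d2 : 0 < d / 2 by rewrite divr_gt0.
    have de : 0 < d / 2 / e by rewrite divr_gt0.
    apply: filterS2 (wb q clO nOq _ d2) (Gb q clO nOq _ de) => y h1 h2 [Oy _].
    have {}h1 := h1 Oy; have {}h2 := h2 Oy.
    have : s * w y <= d / 2 by rewrite (le_trans (ler_norm _)) // normrM s1 mul1r ltW.
    have : - e * G y <= d / 2.
      rewrite (le_trans (ler_norm _)) // normrM normrN (gtr0_norm e0) mulrC.
      by rewrite -ler_pdivlMr // ltW.
    lra.
  have -> : q = a by apply: contrapT => qa; apply: nq.
  apply: filterS2 wa (Ga (M / e)) => y h1 h2 [Oy ya].
  have {}h1 := h1 ya; have {}h2 := h2 ya.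
  have : s * w y <= M by rewrite (le_trans (ler_norm _)) // normrM s1 mul1r.
  have : M <= e * G y by rewrite mulrC -ler_pdivrMr.
  by lra.
move=> z Oz za.
have le0 s : `|s| = 1 -> s * w z <= 0.
  move=> s1; rewrite leNgt; apply/negP => m0.
  (* At the fixed point [z] this [e] makes [e * G z] at most half of [s * w z], which contradicts
     [half]. *)
  pose e := s * w z / (2 * (`|G z| + 1)).
  have G1 : 0 < `|G z| + 1 by rewrite ltr_wpDl.
  have e0 : 0 < e by rewrite divr_gt0 // mulr_gt0.
  have := half s s1 e z e0 Oz za.
  have : e * G z <= e * (`|G z| + 1).
    by rewrite ler_pM2l // (le_trans (ler_norm _)) // lerDl.
  have -> : e * (`|G z| + 1) = s * w z / 2 by rewrite /e; field; rewrite gt_eqF.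
  by lra.
have := le0 1 (normr1 _); have := le0 (- 1) (normrN1 _); lra.
Qed.

End PuncturedDirichlet.

(** * The identity on simply connected domains *)

Section RobinIdentity.
Context {R : realType}.
Implicit Types (u v : R * R -> R) (p q z w : R * R) (Omega U : set (R * R)).

(** The zero of [f] at [p] cancels the pole: differentiability gives |f z| = O(|z - p|). *)
Lemma cinv_near_bound (f : R * R -> R * R) c p : has_cderiv f c p -> f p = 0 ->
  exists M : R, \forall z \near p, z <> p ->
    `|(cmul (cinv (z - p)) (f z)).1| <= M /\ `|(cmul (cinv (z - p)) (f z)).2| <= M.
Proof.
move=> [h1 h2] fp0.
have [K1 K10 H1] := has_grad_lipschitz h1; have [K2 K20 H2] := has_grad_lipschitz h2.
exists (K1 + K2); apply: filterS2 H1 H2 => z; rewrite fp0 /= !subr0 => l1 l2 zp.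
have zp0 : 0 < sqmod (z - p) by rewrite sqmod_gt0 subr_eq0; apply/eqP.
have K0 : 0 <= K1 + K2 by rewrite addr_ge0.
have B : sqmod (cmul (cinv (z - p)) (f z)) <= (K1 + K2) ^+ 2.
  rewrite sqmodM sqmod_inv mulrC ler_pdivrMr //.
  apply: (@le_trans _ _ ((K1 + K2) ^+ 2 * `|z - p| ^+ 2)); last first.
    by rewrite ler_wpM2l ?sqr_ge0 // norm_sqmod_le.
  have sq (x K : R) : 0 <= K -> `|x| <= K * `|z - p| -> x ^+ 2 <= K ^+ 2 * `|z - p| ^+ 2.
    move=> Kn h; rewrite -exprMn -[x ^+ 2]real_normK ?num_real //.
    by rewrite lerXn2r ?nnegrE // mulr_ge0.
  have := sq _ _ K10 l1; have := sq _ _ K20 l2; rewrite /sqmod => a1 a2.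
  have : 0 <= K1 * K2 * `|z - p| ^+ 2 by rewrite !mulr_ge0 // sqr_ge0.
  have -> : (K1 + K2) ^+ 2 = K1 ^+ 2 + K2 ^+ 2 + 2 * (K1 * K2) by ring.
  lra.
by split; [exact: (norm_le_sqmod K0 (norm_fst_le _) B)|exact: (norm_le_sqmod K0 (norm_snd_le _) B)].
Qed.

Lemma sqmod_opp z : sqmod (- z) = sqmod z.
Proof. by rewrite /sqmod /= !sqrrN. Qed.

Lemma near_neq q p : q <> p -> \forall z \near q, z <> p.
Proof.
move=> qp; have oa : open (~` [set p]) by rewrite -setTD; apply: open_setD1; exact: openT.
exact: open_nbhs_nbhs (conj oa qp).
Qed.

Lemma cinvM z w : cinv (cmul z w) = cmul (cinv z) (cinv w).
Proof.
rewrite /cinv sqmodM /cmul /=.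
have [->|z0] := eqVneq (sqmod z) 0; first by rewrite !(mul0r, invr0, mulr0, oppr0, subr0, addr0).
have [->|w0] := eqVneq (sqmod w) 0; first by rewrite !(mul0r, invr0, mulr0, oppr0, subr0, addr0).
by apply/pair_eqP; apply/andP; split => /=; apply/eqP; field; rewrite z0 w0.
Qed.

(* On the boundary |f| = 1, so that 1/f and the conjugate of f agree. *)
Lemma cinv_conj_dist w (g : R) : sqmod w = expR (- 2 * g) ->
  `|(cinv w).1 - w.1| <= `|expR g - expR (- g)| /\
  `|(cinv w).2 + w.2| <= `|expR g - expR (- g)|.
Proof.
move=> Nw.
have comp (x : R) : x ^+ 2 <= sqmod w -> `|x * ((sqmod w)^-1 - 1)| <= `|expR g - expR (- g)|.
  move=> xw; have x1 : `|x| <= expR (- g).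
    rewrite -(@ler_pXn2r _ 2) ?nnegrE ?expR_ge0 // real_normK ?num_real //.
    by rewrite -expRM_natl (_ : expR _ = sqmod w) // Nw; congr expR; ring.
  have -> : expR g - expR (- g) = expR (- g) * ((sqmod w)^-1 - 1).
    by rewrite Nw -expRN mulrBr mulr1 -expRD; congr (expR _ - _); ring.
  by rewrite !normrM (ger0_norm (expR_ge0 _)) ler_wpM2r.
split.
  have -> : (cinv w).1 - w.1 = w.1 * ((sqmod w)^-1 - 1) by rewrite /cinv /= mulrBr mulr1.
  by apply: comp; rewrite /sqmod lerDl sqr_ge0.
have -> : (cinv w).2 + w.2 = - (w.2 * ((sqmod w)^-1 - 1)).
  by rewrite /cinv /= mulrBr mulr1 opprB mulNr addrC.
by rewrite normrN; apply: comp; rewrite /sqmod lerDr sqr_ge0.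
Qed.

Lemma expR_sub_near0 (e : R) : 0 < e -> exists2 d : R, 0 < d &
  forall g, `|g| < d -> `|expR g - expR (- g)| < e.
Proof.
move=> e0; have cE : {for (0 : R), continuous (fun g : R => expR g - expR (- g))}.
  apply: cvgB; first exact: continuous_expR.
  apply: (@continuous_comp _ _ _ -%R expR); first exact: opp_continuous.
  exact: continuous_expR.
have [d /= d0 Hd] := (iffLR (nbhs_ballP _ _)) ((iffLR (cvgrPdist_lt _ _)) cE e e0).
exists d => // g gd; have := Hd g; rewrite /ball /= sub0r normrN oppr0 subrr => /(_ gd).
by rewrite sub0r normrN.
Qed.

Theorem Htilde_simply_connected Omega (G H h1 h2 : R * R -> R * R -> R) :
  open Omega -> bounded_set Omega -> simply_connected Omega ->
  green_data Omega G H h1 h2 ->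
  forall a, Omega a -> Htilde h1 h2 a = 2 * expR (2 * robin H a).
Proof.
move=> oO bO sc [gG rH ih1 ih2] a Oa.
have [hG cG G0 _] := gG a Oa; have [hH GH] := rH a Oa.
have [hh1 ch1 bh1] := ih1 a Oa; have [hh2 ch2 bh2] := ih2 a Oa.
have clO z : Omega z -> closure Omega z by exact: subset_closure.
have oD : open (Omega `\ a) by exact: open_setD1.
have DO : Omega `\ a `<=` Omega by move=> z [].
have Gb q : closure Omega q -> ~ Omega q -> forall e, 0 < e ->
    \forall z \near q, Omega z -> `|G a z| < e.
  move=> clq nOq e e0.
  have qa : q <> a by move=> qa; apply: nOq; rewrite qa.
  have bq : boundary Omega q by apply/boundary_open.
  have Sq : (closure Omega `\ a) q by split.
  apply: filterS2 (near_neq qa) (within_near_dist cG Sq e0) => z za h Oz.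
  by have := h (conj (clO z Oz) za); rewrite (G0 q bq) subr0.
have cHa : {for a, continuous (H a)} by exact: harmonic_on_continuous oO hH Oa.
have Oan := open_nbhs_nbhs (conj oO Oa).
have Ga K : \forall z \near a, z <> a -> K <= G a z.
  apply: filterS3 Oan (continuous_near_dist cHa ltr01) (ln_dist_to_infty a (K + H a a + 1)).
  move=> z Oz hz Kz za; rewrite GH //; last exact: clO.
  by have := Kz za; move: hz; rewrite ltr_norml => /andP[_]; lra.
have [V0 hF0] := harmonic_conjugate oO sc hH.
pose F z : R * R := (H a z, V0 z) - (0, V0 a).
have hF : hol 2 Omega F by apply: holB hF0 _; exact: hol_cst.
have F1 z : (F z).1 = H a z by rewrite /F /= subr0.
have Fa : F a = (H a a, 0) by rewrite /F; apply/pair_eqP; rewrite /= subr0 subrr !eqxx.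
pose c := expR (H a a).
have c0 : 0 < c by exact: expR_gt0.
have hid : hol 2 Omega (fun z => z - a) by apply: holB; [exact: hol_id|exact: hol_cst].
have hE : hol 2 Omega (fun z => cexp (F z)) by apply: (hol_comp (V := setT)) hF; [|exact: hol_exp].
pose f z := cmul (z - a) (cexp (F z)).
have hf : hol 2 Omega f by exact: holM.
have f_sq z : Omega z -> z <> a -> sqmod (f z) = expR (- 2 * G a z).
  move=> Oz za; rewrite sqmodM sqmod_exp F1 -(expR_ln_dist za) -expRD GH //; last exact: clO.
  by congr expR; ring.
have f_neq0 z : (Omega `\ a) z -> f z != 0.
  by move=> [Oz za]; rewrite -sqmod_gt0 f_sq // expR_gt0.
have id_neq0 z : (Omega `\ a) z -> z - a != 0.
  by move=> [Oz za]; rewrite subr_eq0; apply/eqP.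
have hfD := hol_sub DO hf.
pose k z := cinv (z - a) - cmul (c, 0) (cinv (f z)).
have hk : hol 2 (Omega `\ a) k.
  apply: holB; first by apply: holV id_neq0 _; exact: hol_sub hid.
  by apply: holM; [exact: hol_cst|exact: holV].
(* [W1] and [W2] are the real part and minus the imaginary part of h1 - i h2 - (k + c conj f); they
   are to be shown to vanish. *)
pose W1 z := h1 a z - ((k z).1 + c * (f z).1).
pose W2 z := h2 a z - (- (k z).2 + c * (f z).2).
have hW1 : harmonic_on (Omega `\ a) W1.
  have e := harmonic_on_comb 1 c oD (hol_harmonic1 oD hk) (hol_harmonic1 oD hfD).
  apply: harmonic_on_ext oD _ (harmonic_on_comb 1 (-1) oD (harmonic_on_sub DO hh1) e) => z _.
  by rewrite /W1; ring.
have hW2 : harmonic_on (Omega `\ a) W2.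
  have e := harmonic_on_comb (-1) c oD (hol_harmonic2 oD hk) (hol_harmonic2 oD hfD).
  apply: harmonic_on_ext oD _ (harmonic_on_comb 1 (-1) oD (harmonic_on_sub DO hh2) e) => z _.
  by rewrite /W2; ring.
have near_bd q : closure Omega q -> ~ Omega q -> forall e, 0 < e ->
    \forall z \near q, Omega z -> `|W1 z| < e /\ `|W2 z| < e.
  move=> clq nOq e e0.
  have qa : q <> a by move=> qa; apply: nOq; rewrite qa.
  have bq : boundary Omega q by apply/boundary_open.
  have qa0 : q - a != 0 by rewrite subr_eq0; apply/eqP.
  have e4 : 0 < e / 4 by rewrite divr_gt0.
  have ec : 0 < e / (2 * c) by rewrite divr_gt0 // mulr_gt0.
  have [d d0 Hd] := expR_sub_near0 ec.
  have hI : hol 2 [set z | z - a != 0] (fun z => cinv (z - a)).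
    by apply: holV => //; apply: holB; [exact: hol_id|exact: hol_cst].
  have [cI1 cI2] := holW (holW hI) q qa0.
  have n1 := within_near_dist ch1 clq e4; have n1' := continuous_near_dist cI1 e4.
  have n2 := within_near_dist ch2 clq e4; have n2' := continuous_near_dist cI2 e4.
  have v1 : h1 a q = (cinv (q - a)).1.
    by rewrite (bh1 q bq) eucl_dist_sqr -[a - q]opprB sqmod_opp.
  have v2 : h2 a q = - (cinv (q - a)).2.
    by rewrite (bh2 q bq) eucl_dist_sqr -[a - q]opprB sqmod_opp /cinv /= mulNr opprK.
  have m1 : \forall z \near q, closure Omega z -> `|h1 a z - h1 a q| < e / 4 /\
      `|(cinv (z - a)).1 - (cinv (q - a)).1| < e / 4.
    by apply: filterS2 n1 n1' => z l l' /l.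
  have m2 : \forall z \near q, closure Omega z -> `|h2 a z - h2 a q| < e / 4 /\
      `|(cinv (z - a)).2 - (cinv (q - a)).2| < e / 4.
    by apply: filterS2 n2 n2' => z l l' /l.
  have m3 : \forall z \near q, Omega z -> z <> a /\ `|G a z| < d.
    by apply: filterS2 (near_neq qa) (Gb q clq nOq d d0) => z za l /l.
  apply: filterS3 m1 m2 m3 => z l m Gz Oz; have [za hG'] := Gz Oz.
  have [l1 l2] := l (clO z Oz); have [k1 k2] := m (clO z Oz).
  have [b1 b2] := cinv_conj_dist (f_sq z Oz za).
  have Hg := Hd _ hG'.
  have cb (x : R) : `|x| <= `|expR (G a z) - expR (- G a z)| -> `|c * x| < e / 2.
    move=> xg; rewrite normrM (gtr0_norm c0).
    have : c * `|x| < c * (e / (2 * c)) by rewrite ltr_pM2l // (le_lt_trans xg).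
    by have -> : c * (e / (2 * c)) = e / 2 by field; rewrite gt_eqF.
  split.
    (* By the boundary value of [h1] at [q], the first two differences tend to 0. The rest is c
       times the real part of 1/f - conj f, which tends to 0 because |f| tends to 1. *)
    have -> : W1 z = (h1 a z - h1 a q) - ((cinv (z - a)).1 - (cinv (q - a)).1)
        + c * ((cinv (f z)).1 - (f z).1) by rewrite /W1 v1 /k /=; ring.
    apply: (le_lt_trans (ler_normD _ _)); have := cb _ b1.
    by have := ler_normB (h1 a z - h1 a q) ((cinv (z - a)).1 - (cinv (q - a)).1); lra.
  have -> : W2 z = (h2 a z - h2 a q) + ((cinv (z - a)).2 - (cinv (q - a)).2)
      - c * ((cinv (f z)).2 + (f z).2) by rewrite /W2 v2 /k /=; ring.
  apply: (le_lt_trans (ler_normB _ _)); have := cb _ b2.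
  by have := ler_normD (h2 a z - h2 a q) ((cinv (z - a)).2 - (cinv (q - a)).2); lra.
have near_a : exists M, \forall z \near a, z <> a -> `|W1 z| <= M /\ `|W2 z| <= M.
  (* [k] equals n / (z - a), and [n] vanishes at [a] because the normalisation of [F] gives
     [cexp (F a) = (c, 0)]. *)
  pose n z := (1, 0) - cmul (c, 0) (cinv (cexp (F z))).
  have hn : hol 1 Omega n.
    apply: holB; first exact: hol_cst.
    apply: holM; first exact: hol_cst.
    by apply: holV; [move=> z _; exact: cexp_neq0|exact: holW].
  have n0 : n a = 0.
    rewrite /n Fa /cexp /= cos0 sin0 mulr1 mulr0 -/c /cinv /cmul /sqmod /= oppr0 !mul0r expr0n /= addr0 !mulr0.
    apply/pair_eqP; apply/andP; split; apply/eqP; rewrite /=; last by rewrite addr0 subrr.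
    by field; rewrite gt_eqF.
  case: hn => n' dn _.
  have [M HM] := cinv_near_bound (dn a Oa) n0.
  have [cf1 cf2] := holW (holW hf) a Oa.
  have ca1 := harmonic_on_continuous oO hh1 Oa.
  have ca2 := harmonic_on_continuous oO hh2 Oa.
  have m1 : \forall z \near a, `|(f z).1 - (f a).1| < 1 /\ `|(f z).2 - (f a).2| < 1.
    by apply: filterS2 (continuous_near_dist cf1 ltr01) (continuous_near_dist cf2 ltr01).
  have m2 : \forall z \near a, `|h1 a z - h1 a a| < 1 /\ `|h2 a z - h2 a a| < 1.
    by apply: filterS2 (continuous_near_dist ca1 ltr01) (continuous_near_dist ca2 ltr01).
  exists (`|h1 a a| + `|h2 a a| + 1 + M + c * (`|(f a).1| + `|(f a).2| + 1)).
  apply: filterS3 HM m1 m2 => z hM [l1 l2] [j1 j2] za.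
  have kE : k z = cmul (cinv (z - a)) (n z).
    rewrite /k /n /f cinvM /cmul /=; apply/pair_eqP; apply/andP; split; apply/eqP; rewrite /=; ring.
  rewrite /W1 /W2 kE; have [{}hM1 hM2] := hM za.
  have tri (x y : R) : `|x - y| < 1 -> `|x| <= `|y| + 1.
    by move=> xy; rewrite -[x](subrK y) addrC (le_trans (ler_normD _ _)) // lerD2l ltW.
  have cc (x y y' : R) : `|x - y| < 1 -> `|c * x| <= c * (`|y| + `|y'| + 1).
    move=> /tri xy; rewrite normrM (gtr0_norm c0) ler_pM2l //.
    by have := normr_ge0 y'; lra.
  have := tri _ _ j1; have := tri _ _ j2; have := normr_ge0 (h1 a a); have := normr_ge0 (h2 a a).
  move=> p1 p2 t2 t1; split.
    apply: (le_trans (ler_normB _ _)).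
    have := ler_normD (cmul (cinv (z - a)) (n z)).1 (c * (f z).1).
    by have := cc _ _ (f a).2 l1; lra.
  apply: (le_trans (ler_normB _ _)).
  have := ler_normD (- (cmul (cinv (z - a)) (n z)).2) (c * (f z).2); rewrite normrN.
  have := cc _ _ (f a).1 l2; rewrite [`|(f a).2| + _]addrC; lra.
have [M HM] := near_a.
have W1_0 z : Omega z -> z <> a -> W1 z = 0.
  apply: (punctured_dirichlet_zero (M := M) oO bO Oa hG Gb Ga hW1).
    move=> q clq nq e e0; apply: filterS (near_bd q clq nq e e0) => y h Oy; exact: (h Oy).1.
  by apply: filterS HM => y h ya; exact: (h ya).1.
have W2_0 z : Omega z -> z <> a -> W2 z = 0.
  apply: (punctured_dirichlet_zero (M := M) oO bO Oa hG Gb Ga hW2).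
    move=> q clq nq e e0; apply: filterS (near_bd q clq nq e e0) => y h Oy; exact: (h Oy).2.
  by apply: filterS HM => y h ya; exact: (h ya).2.
have [f' df hf'] := hf; have [k' dk _] := hk.
have E z : Omega z -> z <> a -> pd1 (h1 a) z + pd2 (h2 a) z = 2 * c * (f' z).1.
  move=> Oz za; have Dz : (Omega `\ a) z by split.
  have [k1 k2] := dk z Dz; have [f1 f2] := df z Oz.
  have g1 := has_gradD k1 (has_gradM (has_grad_cst c z) f1).
  have g2 := has_gradD (has_gradB (has_grad_cst 0 z) k2) (has_gradM (has_grad_cst c z) f2).
  have E1 y : (Omega `\ a) y -> h1 a y = (k y).1 + c * (f y).1.
    by move=> [Oy ya]; apply/eqP; rewrite -subr_eq0; apply/eqP; exact: W1_0 Oy ya.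
  have E2 y : (Omega `\ a) y -> h2 a y = 0 - (k y).2 + c * (f y).2.
    by move=> [Oy ya]; apply/eqP; rewrite sub0r -subr_eq0; apply/eqP; exact: W2_0 Oy ya.
  have p1 := (has_grad_pd1 g1).2; have p2 := (has_grad_pd2 g2).2.
  have -> := etrans (pd1_eq_on oD E1 Dz) p1.
  have -> := etrans (pd2_eq_on oD E2 Dz) p2.
  by rewrite /=; ring.
(* The formula [E] holds only off [a], where [k] is defined; it reaches [a] by continuity of both
   sides. *)
have [c11 c22] : {for a, continuous (pd1 (h1 a))} /\ {for a, continuous (pd2 (h2 a))}.
  case: hh1 => [[_ C1 _] _]; case: hh2 => [[_ _ C2] _].
  by split; [exact: (Ck_on_continuous (k := 1) oO C1 Oa)|exact: (Ck_on_continuous (k := 1) oO C2 Oa)].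
have cf' := (holW (hf' : hol 1 Omega f') a Oa).1.
have lim : pd1 (h1 a) a + pd2 (h2 a) a = 2 * c * (f' a).1.
  apply: (@punctured_limit _ (fun z => pd1 (h1 a) z + pd2 (h2 a) z) (fun z => 2 * c * (f' z).1)).
  - exact: cvgD c11 c22.
  - exact: cvgM (cvg_cst _) cf'.
  - by apply: filterS Oan => z; exact: E.
rewrite /Htilde lim.
(* In the product (z - a) exp F only the derivative of the first factor survives at [a]. *)
have f'a : (f' a).1 = c.
  have [F' dF _] := hF.
  have d1 : has_cderiv (fun z => z - a) ((1, 0) - 0) a.
    by apply: has_cderivB; [exact: has_cderiv_id|exact: has_cderiv_cst].
  have d2 := has_cderivM d1 (has_cderiv_comp (has_cderiv_exp (F a)) (dF a Oa)).
  rewrite subrr [F a]Fa in d2.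
  apply: etrans (esym (has_grad_pd1 (df a Oa).1).2) (etrans (has_grad_pd1 d2.1).2 _).
  by rewrite /= cos0 sin0 -/c; ring.
by rewrite f'a -mulrA; congr (_ * _); rewrite /c -expRD /robin; congr expR; ring.
Qed.

End RobinIdentity.

(** * Power series *)

Section Sums.
Context {R : realType}.
Implicit Types (u v a : nat -> R) (l m A : R).

Definition sums u l := series u n @[n --> \oo] --> l.

Lemma sums_unique u l m : sums u l -> sums u m -> l = m.
Proof. by move=> hl hm; exact: (cvg_unique (@norm_hausdorff _ _) hl hm). Qed.

Lemma sums_eq u v l : u =1 v -> sums u l -> sums v l.
Proof. by move=> /funext ->. Qed.

Lemma sums_eq2 u v l m : sums u l -> u =1 v -> l = m -> sums v m.
Proof. by move=> hu /funext <- <-. Qed.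

Lemma sumsD u v l m : sums u l -> sums v m -> sums (fun n => u n + v n) (l + m).
Proof.
move=> hu hv; rewrite /sums (_ : (fun n => u n + v n) = u + v); last by apply/funext.
by rewrite seriesD; exact: cvgD hu hv.
Qed.

Lemma sumsZ k u l : sums u l -> sums (fun n => k * u n) (k * l).
Proof.
move=> hu; rewrite /sums (_ : series _ = fun n => k * series u n).
  exact: cvgM (cvg_cst k) hu.
by apply/funext => n; rewrite /series /= mulr_sumr.
Qed.

Lemma sumsB u v l m : sums u l -> sums v m -> sums (fun n => u n - v n) (l - m).
Proof.
move=> hu /(sumsZ (k := -1)) hv; rewrite (_ : l - m = l + -1 * m); last by ring.
by apply: sums_eq (sumsD hu hv) => n; ring.
Qed.

Lemma sums_shift u l : sums u l -> sums (fun n => u n.+1) (l - u 0%N).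
Proof.
move=> hu; rewrite /sums (_ : series _ = fun n => series u n.+1 - u 0%N).
  apply: cvgB; last exact: cvg_cst.
  by rewrite (cvg_shiftS (series u)).
by apply/funext => n; rewrite /series /= big_nat_recl //= addrC addKr.
Qed.

Lemma sums_unshift u l : sums (fun n => u n.+1) l -> sums u (u 0%N + l).
Proof.
move=> hu; rewrite /sums -(cvg_shiftS (series u)).
rewrite (_ : [sequence _]_n = fun n => u 0%N + series (fun n => u n.+1) n).
  exact: cvgD (cvg_cst _) hu.
by apply/funext => n; rewrite /series /= big_nat_recl.
Qed.

Lemma sums_geometric x : `|x| < 1 -> sums (fun n => x ^+ n) (1 - x)^-1.
Proof.
move=> x1; have h : sums (geometric 1 x) (1 / (1 - x)) := cvg_geometric_series x1.
by rewrite div1r in h; apply: sums_eq h => n; rewrite /geometric /= mul1r.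
Qed.

Lemma sums_le u v l m : (forall n, u n <= v n) -> sums u l -> sums v m -> l <= m.
Proof.
move=> uv hu hv; rewrite -(cvg_lim (@norm_hausdorff _ _) hu) -(cvg_lim (@norm_hausdorff _ _) hv).
by apply: lim_series_le => //; [exact: cvgP hu|exact: cvgP hv].
Qed.

Lemma sums_ge0 u l : (forall n, 0 <= u n) -> sums u l -> 0 <= l.
Proof.
move=> u0 hu; apply: (@sums_le (fun=> 0) u) hu => //.
by rewrite /sums (_ : series _ = cst 0); [exact: cvg_cst|apply/funext => n; rewrite /series /= big1].
Qed.

Lemma sums_dominated u a A : (forall n, `|u n| <= a n) -> sums a A ->
  exists2 l, sums u l & `|l| <= A.
Proof.
move=> ua hA.
have cu : cvgn [normed series u].
  by apply: (series_le_cvg _ _ ua) => // [n|]; [exact: le_trans (ua n)|exact: cvgP hA].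
exists (limn (series u)); first exact: (normed_cvg cu).
apply: (le_trans (lim_series_norm cu)).
rewrite -(cvg_lim (@norm_hausdorff _ _) hA).
by apply: lim_series_le => //; exact: cvgP hA.
Qed.

End Sums.

Section PowerSeries.
Context {R : realType}.
Implicit Types (c d : nat -> R) (z w h : R * R) (s r : R).

Definition cpow z n : R * R := iter n (cmul z) (1, 0).
Definition cmod z : R := Num.sqrt (sqmod z).

Lemma cmod_ge0 z : 0 <= cmod z. Proof. exact: sqrtr_ge0. Qed.

Lemma cmod_sqr z : cmod z ^+ 2 = sqmod z.
Proof. by rewrite sqr_sqrtr // sqmod_ge0. Qed.

Lemma cmodM z w : cmod (cmul z w) = cmod z * cmod w.
Proof. by rewrite /cmod sqmodM sqrtrM ?sqmod_ge0. Qed.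

Lemma cmod_pow z n : cmod (cpow z n) = cmod z ^+ n.
Proof.
elim: n => [|n IH]; first by rewrite /cmod /sqmod /= expr1n expr0n addr0 sqrtr1.
by rewrite /= cmodM IH exprS.
Qed.

Lemma cmod_conj z : cmod (cconj z) = cmod z.
Proof. by rewrite /cmod sqmod_conj. Qed.

Lemma cmod_fst z : `|z.1| <= cmod z.
Proof.
rewrite -(@ler_pXn2r _ 2) ?nnegrE ?cmod_ge0 // cmod_sqr real_normK ?num_real //.
by rewrite lerDl sqr_ge0.
Qed.

Lemma cmod_snd z : `|z.2| <= cmod z.
Proof.
rewrite -(@ler_pXn2r _ 2) ?nnegrE ?cmod_ge0 // cmod_sqr real_normK ?num_real //.
by rewrite lerDr sqr_ge0.
Qed.

Lemma cmodD z w : cmod (z + w) <= cmod z + cmod w.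
Proof.
rewrite -(@ler_pXn2r _ 2) ?nnegrE ?addr_ge0 ?cmod_ge0 // cmod_sqr sqrrD !cmod_sqr.
have : z.1 * w.1 + z.2 * w.2 <= cmod z * cmod w.
  rewrite (le_trans (ler_norm _)) // -(@ler_pXn2r _ 2) ?nnegrE ?mulr_ge0 ?cmod_ge0 //.
  rewrite real_normK ?num_real // exprMn !cmod_sqr /sqmod.
  by have := sqr_ge0 (z.1 * w.2 - z.2 * w.1); rewrite !sqrrD; nra.
by rewrite /sqmod /=; nra.
Qed.

Lemma cmodZ (k : R) z : cmod (k * z.1, k * z.2) = `|k| * cmod z.
Proof.
rewrite /cmod /sqmod /= !exprMn -mulrDr sqrtrM ?sqr_ge0 // sqrtr_sqr.
by [].
Qed.

Lemma cmod_le_norm z : cmod z <= 2 * `|z|.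
Proof.
rewrite -(@ler_pXn2r _ 2) ?nnegrE ?mulr_ge0 ?cmod_ge0 // cmod_sqr exprMn.
have := sqmod_norm_le z; have := sqr_ge0 `|z|; lra.
Qed.

(** Radius of convergence at least [r], expressed by bounded terms on smaller circles; this form is
    easily checked and passes to the differentiated series. *)
Definition has_radius c r := forall s, 0 <= s < r -> exists M, forall n, `|c n| * s ^+ n <= M.

Definition dcoef c n := n.+1%:R * c n.+1.

(** Bernoulli's inequality: x^-n >= 1 + n d with d = 1/x - 1, so n x^n <= 1/d. *)
Lemma linear_geometric_bound (x : R) : 0 <= x < 1 -> exists M, forall n : nat, n%:R * x ^+ n <= M.
Proof.
move=> /andP[]; rewrite le_eqVlt => /orP[/eqP<- _|x0 x1].
  by exists 0 => -[|n]; rewrite ?mul0r // exprS mul0r mulr0.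
pose d := x^-1 - 1; have d0 : 0 < d by rewrite subr_gt0 invf_gt1.
have bern n : n%:R * d <= (x^-1) ^+ n.
  suff : 1 + n%:R * d <= (x^-1) ^+ n by lra.
  elim: n => [|n IH]; first by rewrite mul0r addr0 expr0.
  rewrite exprS; apply: (@le_trans _ _ (x^-1 * (1 + n%:R * d))).
    have -> : x^-1 = 1 + d by rewrite /d; ring.
    have := mulr_ge0 (ler0n R n) (mulr_ge0 (ltW d0) (ltW d0)).
    by rewrite -natr1; lra.
  by rewrite ler_pM2l ?invr_gt0.
exists d^-1 => n; have := bern n; rewrite exprVn => h.
have xn : 0 < x ^+ n by rewrite exprn_gt0.
rewrite -(@ler_pM2r _ d) // mulVf ?gt_eqF // mulrAC.
by rewrite -ler_pdivlMr // div1r.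
Qed.

Lemma has_radius_natmul c r : has_radius c r -> has_radius (fun n => n%:R * c n) r.
Proof.
move=> hc s /andP[s0 sr].
(* On the intermediate radius [t] the terms are bounded, and the factor (s/t)^n absorbs [n]. *)
pose t := (s + r) / 2; have st : s < t by rewrite /t; lra.
have tr : t < r by rewrite /t; lra.
have t0 : 0 < t by lra.
have [|M HM] := hc t; first by rewrite tr ltW.
have [|K HK] := @linear_geometric_bound (s / t).
  by rewrite divr_ge0 ?(ltW t0) //= ltr_pdivrMr // mul1r.
have M0 : 0 <= M by apply: le_trans (HM 0%N); rewrite mulr_ge0.
exists (K * M) => n.
have -> : `|n%:R * c n| * s ^+ n = (n%:R * (s / t) ^+ n) * (`|c n| * t ^+ n).
  rewrite normrM normr_nat expr_div_n; field.
  by rewrite expf_neq0 // gt_eqF.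
have st0 : 0 <= s / t by rewrite divr_ge0 // ltW.
have tn0 : 0 <= t ^+ n by rewrite exprn_ge0 // ltW.
exact: ler_pM (mulr_ge0 (ler0n _ _) (exprn_ge0 _ st0)) (mulr_ge0 (normr_ge0 _) tn0) (HK n) (HM n).
Qed.

Lemma has_radius_dcoef c r : has_radius c r -> has_radius (dcoef c) r.
Proof.
move=> hc s /andP[s0 sr].
pose t := (s + r) / 2; have st : s < t by rewrite /t; lra.
have tr : t < r by rewrite /t; lra.
have t0 : 0 < t by lra.
have t01 : 0 <= t < r by rewrite tr ltW.
have [M HM] := has_radius_natmul hc t01.
exists (M / t) => n; rewrite ler_pdivlMr //; apply: le_trans (HM n.+1).
rewrite [t ^+ n.+1]exprSr [leRHS]mulrA ler_pM2r //; apply: ler_wpM2l => //.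
by apply: lerXn2r; rewrite ?nnegrE // ltW.
Qed.

Lemma radius_sums c r s : has_radius c r -> 0 <= s < r -> exists l, sums (fun n => `|c n| * s ^+ n) l.
Proof.
move=> hc /andP[s0 sr].
pose t := (s + r) / 2; have st : s < t by rewrite /t; lra.
have tr : t < r by rewrite /t; lra.
have t0 : 0 < t by lra.
have [|M HM] := hc t; first by rewrite tr ltW.
have st1 : `|s / t| < 1.
  rewrite ger0_norm; last by rewrite divr_ge0 // ltW.
  by rewrite ltr_pdivrMr // mul1r.
have b n : `| `|c n| * s ^+ n| <= M * (s / t) ^+ n.
  rewrite normrM normr_id (ger0_norm (exprn_ge0 _ s0)).
  have -> : `|c n| * s ^+ n = (`|c n| * t ^+ n) * (s / t) ^+ n.
    by rewrite [(s / t) ^+ n]expr_div_n; field; rewrite expf_neq0 // gt_eqF.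
  by rewrite ler_wpM2r // exprn_ge0 // divr_ge0 // ltW.
have [l hl _] := sums_dominated b (sumsZ (k := M) (sums_geometric st1)).
by exists l.
Qed.

(** A complex series with real coefficients, summed componentwise; real coefficients make it commute
    with conjugation. *)
Definition ps c z : R * R :=
  (limn (series (fun n => c n * (cpow z n).1)), limn (series (fun n => c n * (cpow z n).2))).

Lemma ps_sums c r z : has_radius c r -> cmod z < r ->
  sums (fun n => c n * (cpow z n).1) (ps c z).1 /\ sums (fun n => c n * (cpow z n).2) (ps c z).2.
Proof.
move=> hc zr; have zr0 : 0 <= cmod z < r by rewrite cmod_ge0.
have [l hl] := radius_sums hc zr0.
have b1 n : `|c n * (cpow z n).1| <= `|c n| * cmod z ^+ n.
  by rewrite normrM ler_wpM2l // -cmod_pow cmod_fst.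
have b2 n : `|c n * (cpow z n).2| <= `|c n| * cmod z ^+ n.
  by rewrite normrM ler_wpM2l // -cmod_pow cmod_snd.
have [l1 h1 _] := sums_dominated b1 hl; have [l2 h2 _] := sums_dominated b2 hl.
by split; [exact: cvgP h1|exact: cvgP h2].
Qed.

Lemma ps_eq c z l1 l2 : sums (fun n => c n * (cpow z n).1) l1 ->
  sums (fun n => c n * (cpow z n).2) l2 -> ps c z = (l1, l2).
Proof.
by move=> h1 h2; rewrite /ps (cvg_lim (@norm_hausdorff _ _) h1) (cvg_lim (@norm_hausdorff _ _) h2).
Qed.

End PowerSeries.

Section PowerSeriesDerivative.
Context {R : realType}.
Implicit Types (c d : nat -> R) (z w h : R * R) (s r : R).

Lemma has_grad_quadratic (u : R * R -> R) a b p (K d : R) : 0 <= K -> 0 < d ->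
  (forall h, `|h| < d -> `|u (h + p) - u p - (a * h.1 + b * h.2)| <= K * `|h| ^+ 2) ->
  has_grad u a b p.
Proof.
move=> K0 d0 H; apply/has_gradP => e e0.
have e1 : 0 < Num.min d (e / (K + 1)) by rewrite lt_min d0 divr_gt0 //; lra.
have := @nbhs0_lt _ (R * R)%type _ e1; apply: filterS => h.
rewrite lt_min => /andP[hd he]; apply: (le_trans (H h hd)).
rewrite expr2 mulrA ler_wpM2r //.
move: he; rewrite ltr_pdivlMr; last by lra.
by have := normr_ge0 h; nra.
Qed.

(** The remainder (z + h)^n - z^n - n z^(n-1) h. For [n = 0] the exponent [n.-1] is 0, harmlessly,
    since the factor [n] vanishes. *)
Definition pow_error z h n : R * R := cpow (z + h) n - cpow z n -
  (n%:R * (cmul (cpow z n.-1) h).1, n%:R * (cmul (cpow z n.-1) h).2).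

Lemma pow_errorS z h n : pow_error z h n.+1 =
  cmul (z + h) (pow_error z h n) +
  (n%:R * (cmul (cmul (cpow z n.-1) h) h).1, n%:R * (cmul (cmul (cpow z n.-1) h) h).2).
Proof.
case: n => [|n]; rewrite /pow_error /=.
  by apply/pair_eqP; apply/andP; split; apply/eqP; rewrite /=; ring.
rewrite -/(cpow z n) -/(cpow (z + h) n).
rewrite -[n.+2%:R]natr1; move: (n.+1%:R) => k.
move: (cpow z n) (cpow (z + h) n) => [x1 x2] [y1 y2].
by apply/pair_eqP; apply/andP; split; apply/eqP; rewrite /=; ring.
Qed.

(** Induction through [pow_errorS]; the step amounts to n^2 + n <= (n + 1)^2. The factor s^2 on the
    left avoids the exponent n - 2, which would be truncated for small [n]. *)
Lemma pow_error_bound z h s n : cmod z <= s -> cmod (z + h) <= s ->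
  s ^+ 2 * cmod (pow_error z h n) <= n%:R ^+ 2 * s ^+ n * cmod h ^+ 2.
Proof.
move=> zs zhs; have s0 : 0 <= s := le_trans (cmod_ge0 _) zs.
elim: n => [|n IH].
  rewrite expr0n !mul0r (_ : pow_error z h 0 = (0 * h.1, 0 * h.2)).
    by rewrite cmodZ normr0 mul0r mulr0.
  by rewrite /pow_error /=; apply/pair_eqP; apply/andP; split; apply/eqP; rewrite /=; ring.
rewrite pow_errorS.
apply: (@le_trans _ _ (s ^+ 2 * (s * cmod (pow_error z h n) + n%:R * (s ^+ n.-1 * cmod h ^+ 2)))).
  apply: ler_wpM2l; first by rewrite exprn_ge0.
  apply: (le_trans (cmodD _ _)); apply: lerD.
    by rewrite cmodM ler_wpM2r // cmod_ge0.
  rewrite cmodZ normr_nat ler_wpM2l ?ler0n // !cmodM -mulrA -expr2 cmod_pow.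
  by rewrite ler_wpM2r ?exprn_ge0 ?cmod_ge0 // lerXn2r ?nnegrE ?cmod_ge0.
have -> : s ^+ 2 * (s * cmod (pow_error z h n) + n%:R * (s ^+ n.-1 * cmod h ^+ 2)) =
   s * (s ^+ 2 * cmod (pow_error z h n)) + n%:R * (s ^+ 2 * s ^+ n.-1) * cmod h ^+ 2 by ring.
apply: (@le_trans _ _ (s * (n%:R ^+ 2 * s ^+ n * cmod h ^+ 2) + n%:R * s ^+ n.+1 * cmod h ^+ 2)).
  apply: lerD; first by rewrite ler_wpM2l.
  case: n {IH} => [|n]; first by rewrite !mul0r.
  by rewrite [n.+1.-1]/= -exprD.
have -> : s * (n%:R ^+ 2 * s ^+ n * cmod h ^+ 2) + n%:R * s ^+ n.+1 * cmod h ^+ 2 =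
  (n%:R ^+ 2 + n%:R) * (s ^+ n.+1 * cmod h ^+ 2) by rewrite [s ^+ n.+1]exprS; ring.
rewrite -mulrA ler_wpM2r ?mulr_ge0 ?exprn_ge0 ?cmod_ge0 //.
by rewrite -natr1; have := ler0n R n; nra.
Qed.

(** Termwise differentiation leaves a remainder bounded by |h|^2 times the sum of n^2 |c_n| s^n over
    s^2, for some [s] between |z| and [r]; this majorant converges since the factors [n] do not
    change the radius. *)
Lemma has_cderiv_ps c r z : has_radius c r -> cmod z < r ->
  has_cderiv (ps c) (ps (dcoef c) z) z.
Proof.
move=> hc zr.
pose s := (cmod z + r) / 2; have zs : cmod z < s by rewrite /s; lra.
have sr : s < r by rewrite /s; lra.
have s0 : 0 < s := le_lt_trans (cmod_ge0 z) zs.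
have s01 : 0 <= s < r by rewrite sr ltW.
have [S hS] := radius_sums (has_radius_natmul (has_radius_natmul hc)) s01.
have S0 : 0 <= S.
  by apply: sums_ge0 hS => n; rewrite mulr_ge0 // exprn_ge0 // ltW.
have [D1 D2] := ps_sums (has_radius_dcoef hc) zr.
have [F1 F2] := ps_sums hc zr.
pose d := (s - cmod z) / 2; have d0 : 0 < d by rewrite divr_gt0 // subr_gt0.
(* The factor 4 comes from |h| <= 2 [|h|], the modulus against the sup norm; the same comparison
   halves [d]. *)
pose K := 4 * (S / s ^+ 2).
have K0 : 0 <= K by rewrite mulr_ge0 // divr_ge0 // exprn_ge0 // ltW.
have small h : `|h| < d -> cmod (z + h) < s.
  move=> hd; apply: (le_lt_trans (cmodD _ _)).
  have := cmod_le_norm h; have : 2 * `|h| < s - cmod z by move: hd; rewrite /d; lra.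
  lra.
have bound h (x : nat -> R) (l : R) : `|h| < d ->
    (forall n, `|x n| <= cmod (pow_error z h n)) ->
    sums (fun n => c n * x n) l -> `|l| <= K * `|h| ^+ 2.
  move=> hd hx hl.
  have b n : `|c n * x n| <= (cmod h ^+ 2 / s ^+ 2) * (`|n%:R * (n%:R * c n)| * s ^+ n).
    rewrite normrM; have e := pow_error_bound n (ltW zs) (ltW (small h hd)).
    have s20 : 0 < s ^+ 2 by rewrite exprn_gt0.
    rewrite mulrAC ler_pdivlMr //.
    have -> : cmod h ^+ 2 * (`|n%:R * (n%:R * c n)| * s ^+ n) =
        `|c n| * (n%:R ^+ 2 * s ^+ n * cmod h ^+ 2).
      by rewrite !normrM !normr_nat; ring.
    rewrite -[leLHS]mulrA ler_wpM2l // [leLHS]mulrC; apply: le_trans e.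
    by rewrite ler_wpM2l // ltW.
  have [l' hl' ll] := sums_dominated b (sumsZ (k := cmod h ^+ 2 / s ^+ 2) hS).
  rewrite (sums_unique hl hl') (le_trans ll) // /K.
  have -> : cmod h ^+ 2 / s ^+ 2 * S = S / s ^+ 2 * cmod h ^+ 2 by ring.
  have -> : 4 * (S / s ^+ 2) * `|h| ^+ 2 = S / s ^+ 2 * (4 * `|h| ^+ 2) by ring.
  rewrite ler_wpM2l ?divr_ge0 ?exprn_ge0 ?(ltW s0) //.
  have -> : 4 * `|h| ^+ 2 = (2 * `|h|) ^+ 2 by ring.
  by rewrite lerXn2r ?nnegrE ?cmod_ge0 ?mulr_ge0 // cmod_le_norm.
have expand h : `|h| < d -> sums (fun n => c n * (pow_error z h n).1)
     ((ps c (h + z)).1 - (ps c z).1 - (cmul (ps (dcoef c) z) h).1) /\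
   sums (fun n => c n * (pow_error z h n).2)
     ((ps c (h + z)).2 - (ps c z).2 - (cmul (ps (dcoef c) z) h).2).
  move=> hd; have zhr : cmod (h + z) < r by rewrite addrC (lt_trans (small h hd)).
  have [H1 H2] := ps_sums hc zhr.
  have U1 : sums (fun n => n%:R * c n * (cmul (cpow z n.-1) h).1) (cmul (ps (dcoef c) z) h).1.
    rewrite -[X in sums _ X]add0r -[X in sums _ (X + _)](_ : 0%:R * c 0%N * (cmul (cpow z 0.-1) h).1 = 0).
      apply: (@sums_unshift _ (fun n => n%:R * c n * (cmul (cpow z n.-1) h).1)).
      apply: sums_eq2 (sumsB (sumsZ (k := h.1) D1) (sumsZ (k := h.2) D2)) _ _ => [n|]; rewrite /dcoef /=; ring.
    by rewrite !mul0r.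
  have U2 : sums (fun n => n%:R * c n * (cmul (cpow z n.-1) h).2) (cmul (ps (dcoef c) z) h).2.
    rewrite -[X in sums _ X]add0r -[X in sums _ (X + _)](_ : 0%:R * c 0%N * (cmul (cpow z 0.-1) h).2 = 0).
      apply: (@sums_unshift _ (fun n => n%:R * c n * (cmul (cpow z n.-1) h).2)).
      apply: sums_eq2 (sumsD (sumsZ (k := h.2) D1) (sumsZ (k := h.1) D2)) _ _ => [n|]; rewrite /dcoef /=; ring.
    by rewrite !mul0r.
  split.
    by apply: sums_eq (sumsB (sumsB H1 F1) U1) => n; rewrite /pow_error [z + h]addrC /=; ring.
  by apply: sums_eq (sumsB (sumsB H2 F2) U2) => n; rewrite /pow_error [z + h]addrC /=; ring.
split; apply: (@has_grad_quadratic _ _ _ _ K d K0 d0) => h hd; have [e1 e2] := expand h hd.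
  have := bound h _ _ hd (fun n => cmod_fst _) e1.
  by rewrite /cmul /= mulNr.
have := bound h _ _ hd (fun n => cmod_snd _) e2.
by rewrite /cmul /= [X in _ - X]addrC.
Qed.

Lemma hol_ps k c r : has_radius c r -> hol k [set z | cmod z < r] (ps c).
Proof.
elim: k c => [|k IH] c hc.
  move=> z /= zr; have [h1 h2] := has_cderiv_ps hc zr.
  by split; [exact: has_grad_continuous h1|exact: has_grad_continuous h2].
exists (ps (dcoef c)); first by move=> z /= zr; exact: has_cderiv_ps hc zr.
by apply: IH; exact: has_radius_dcoef.
Qed.

Lemma cpow_conj z n : cpow (cconj z) n = cconj (cpow z n).
Proof.
elim: n => [|n IH]; first by rewrite /cconj /= oppr0.
by rewrite /= IH /cmul /cconj /=; apply/pair_eqP; apply/andP; split; apply/eqP; rewrite /=; ring.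
Qed.

Lemma ps_conj c r z : has_radius c r -> cmod z < r -> ps c (cconj z) = cconj (ps c z).
Proof.
move=> hc zr; have [h1 h2] := ps_sums hc zr.
apply: ps_eq; first by apply: sums_eq h1 => n; rewrite cpow_conj.
rewrite -[X in sums _ X]mulN1r.
by apply: sums_eq (sumsZ (k := -1) h2) => n; rewrite cpow_conj /=; ring.
Qed.

Lemma cpow_real (x : R) n : cpow (x, 0) n = (x ^+ n, 0).
Proof.
elim: n => [|n IH]; first by rewrite expr0.
by rewrite /= IH /cmul /= exprS; apply/pair_eqP; apply/andP; split; apply/eqP; rewrite /=; ring.
Qed.

Lemma cmod_real (x : R) : cmod (x, 0) = `|x|.
Proof. by rewrite /cmod /sqmod /= expr0n addr0 sqrtr_sqr. Qed.

Lemma ps_real_sums c r (x : R) : has_radius c r -> `|x| < r ->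
  sums (fun n => c n * x ^+ n) (ps c (x, 0)).1.
Proof.
move=> hc xr; have [|h _] := @ps_sums _ c r (x, 0) hc; first by rewrite cmod_real.
by apply: sums_eq h => n; rewrite cpow_real.
Qed.

Lemma is_derive_ps_real c r (x : R) : has_radius c r -> `|x| < r ->
  is_derive x 1 (fun y => (ps c (y, 0)).1) (ps (dcoef c) (x, 0)).1.
Proof.
move=> hc xr; have [|h _] := @has_cderiv_ps c r (x, 0) hc; first by rewrite cmod_real.
have [d e] := has_grad_pd1 h.
by rewrite -e; exact: slice1_derive.
Qed.

End PowerSeriesDerivative.

(** * The Green's function of an annulus *)

Section AnnulusSeries.
Context {R : realType}.
Implicit Types (z w h p S : R * R) (x : R).

Lemma cmod_gt0 z : (0 < cmod z) = (z != 0).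
Proof. by rewrite /cmod sqrtr_gt0 sqmod_gt0. Qed.

Lemma cmod_inv z : cmod (cinv z) = (cmod z)^-1.
Proof. by rewrite /cmod sqmod_inv sqrtrV ?sqmod_ge0. Qed.

Lemma cmod_opp z : cmod (- z) = cmod z.
Proof. by rewrite /cmod sqmod_opp. Qed.

Lemma ln_cmod z : z != 0 -> ln (cmod z) = 2^-1 * ln (sqmod z).
Proof.
by move=> z0; rewrite -cmod_sqr lnXn ?cmod_gt0 //; move: (ln _) => l; lra.
Qed.

Lemma has_grad_ln_cmod z : z != 0 ->
  has_grad (fun w => ln (cmod w)) (cinv z).1 (- (cinv z).2) z.
Proof.
move=> z0; have s0 : 0 < sqmod z by rewrite sqmod_gt0.
have g := has_gradM (has_grad_cst 2^-1 z) (has_grad_comp1 (is_derive1_ln s0) (has_grad_sqmod z)).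
have n0 : \forall w \near z, w != 0.
  have o : open (setT `\ (0 : R * R)) by apply: open_setD1; exact: openT.
  have := open_nbhs_nbhs (conj o (conj I (elimN eqP z0) : (setT `\ (0 : R * R)) z)).
  by apply: filterS => w [_ /eqP].
apply: (has_grad_near _ (has_grad_eq g _ _ _)); first by apply: filterS n0 => w /ln_cmod ->; reflexivity.
- by [].
- by rewrite /cinv /=; field; rewrite gt_eqF.
- by rewrite /cinv /=; field; rewrite gt_eqF.
Qed.

Lemma zero_grad_segment (u : R * R -> R) p q :
  (forall t, t \in `[0, 1] -> has_grad u 0 0 (p.1 + t * (q.1 - p.1), p.2 + t * (q.2 - p.2))) ->
  u p = u q.
Proof.
move=> hu.
pose c1 (t : R) := p.1 + t * (q.1 - p.1); pose c2 (t : R) := p.2 + t * (q.2 - p.2).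
have dlin (a b t : R) : is_derive t 1 (fun s : R => a + s * b) b.
  have h := is_deriveD (is_derive_cst a t 1) (is_deriveM (is_derive_id t 1) (is_derive_cst b t 1)).
  by apply: (is_derive_eq h); rewrite scaler0 !add0r /GRing.scale /= mulr1.
have df (t : R) : t \in `[0, 1] -> is_derive t 1 (fun t => u (c1 t, c2 t)) 0.
  move=> t01.
  have h := @has_grad_curve _ u _ _ c1 c2 _ _ t (hu t t01) (dlin _ _ t) (dlin _ _ t).
  by apply: (is_derive_eq h); rewrite !mul0r addr0.
have cf : {within `[0, 1], continuous (fun t => u (c1 t, c2 t))}.
  by apply: derivable_within_continuous => t t01; have [] := df t t01.
have [t _] := @MVT _ _ (fun=> 0) 0 1 ltr01 (fun t t01 => df t (subset_itv_oo_cc t01)) cf.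
rewrite mul0r /c1 /c2 !mul1r !mul0r !addr0 ![_ + (_ - _)]addrC !subrK -!surjective_pairing.
by move/eqP; rewrite subr_eq0 => /eqP.
Qed.

(** Coefficients of - ln (1 - z). Since the inverse of 0 is 0, the constant term is 0 as it should
    be. *)
Definition lcoef (n : nat) : R := n%:R^-1.

Lemma has_radius_bounded (c : nat -> R) (M r : R) : 0 < r -> (forall n, `|c n| * r ^+ n <= M) ->
  has_radius c r.
Proof.
move=> r0 H s /andP[s0 sr]; exists M => n; apply: le_trans (H n).
by rewrite ler_wpM2l // lerXn2r ?nnegrE // ltW.
Qed.

Lemma has_radius_one : has_radius (fun=> 1 : R) 1.
Proof. by apply: (@has_radius_bounded _ 1) => // n; rewrite expr1n mulr1 normr1. Qed.

Lemma has_radius_lcoef : has_radius lcoef 1.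
Proof.
apply: (@has_radius_bounded _ 1) => // n; rewrite expr1n mulr1 /lcoef normfV normr_nat.
by case: n => [|n]; rewrite ?invr0 // invf_le1 ?ltr0n // ler1n.
Qed.

Lemma geometric_fixpoint S w : S.1 - 1 = w.1 * S.1 - w.2 * S.2 ->
  S.2 - 0 = w.1 * S.2 + w.2 * S.1 -> cmul S ((1, 0) - w) = (1, 0).
Proof.
case: S w => s1 s2 [w1 w2] /= e1 e2; rewrite /cmul /=.
by congr pair; [transitivity (s1 - (w1 * s1 - w2 * s2)); [ring|lra]|
  transitivity (s2 - (w1 * s2 + w2 * s1)); [ring|lra]].
Qed.

(** Multiplication by [w] shifts the geometric series, so its sum satisfies S - 1 = w S. *)
Lemma ps_one w : cmod w < 1 -> ps (fun=> 1) w = cinv ((1, 0) - w).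
Proof.
move=> w1; have [h1 h2] := ps_sums has_radius_one w1.
set S := ps _ _ in h1 h2 *.
have e1 := sums_unique (sums_shift h1) (sums_eq _ (sumsB (sumsZ (k := w.1) h1) (sumsZ (k := w.2) h2))).
have e2 := sums_unique (sums_shift h2) (sums_eq _ (sumsD (sumsZ (k := w.1) h2) (sumsZ (k := w.2) h1))).
rewrite /= !mul1r in e1 e2.
have {}e1 : S.1 - 1 = w.1 * S.1 - w.2 * S.2 by apply: e1 => n; rewrite /=; ring.
have {}e2 : S.2 - 0 = w.1 * S.2 + w.2 * S.1 by apply: e2 => n; rewrite /=; ring.
have n0 : (1, 0) - w != 0.
  apply/eqP => E; move: w1; have -> : w = (1, 0) by apply/eqP; rewrite eq_sym -subr_eq0; apply/eqP.
  by rewrite cmod_real normr1 ltxx.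
have p : cmul S ((1, 0) - w) = (1, 0).
  exact: geometric_fixpoint e1 e2.
have := congr1 (fun y => cmul y (cinv ((1, 0) - w))) p.
by rewrite -cmulA cmulV // cmul1 cmulC cmul1.
Qed.

(** The sum of the series and ln |1 - z| has zero gradient, because the derived series is geometric;
    it is therefore constant on the segment from 0 to [w] and vanishes at 0. Only the real part is
    treated, so no complex logarithm is chosen. *)
Lemma ps_log w : cmod w < 1 -> (ps lcoef w).1 = - ln (cmod ((1, 0) - w)).
Proof.
move=> w1.
have dl : dcoef lcoef = fun=> 1.
  by apply/funext => n; rewrite /dcoef /lcoef divff // pnatr_eq0.
have n0 z : cmod z < 1 -> (1, 0) - z != 0.
  move=> z1; apply/eqP => E; move: z1.
  have -> : z = (1, 0) by apply/eqP; rewrite eq_sym -subr_eq0; apply/eqP.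
  by rewrite cmod_real normr1 ltxx.
pose u z := (ps lcoef z).1 + ln (cmod ((1, 0) - z)).
have gu z : cmod z < 1 -> has_grad u 0 0 z.
  move=> z1; have [d1 _] := has_cderiv_ps has_radius_lcoef z1.
  rewrite dl (ps_one z1) in d1.
  have f1 := has_gradB (has_grad_cst 1 z) (has_grad_fst z).
  have f2 := has_gradB (has_grad_cst 0 z) (has_grad_snd z).
  have g := @has_grad_comp2 _ (fun w => ln (cmod w)) _ _ _ _ _ _ _ _ z (has_grad_ln_cmod (n0 z z1)) f1 f2.
  apply: has_grad_eq (has_gradD d1 g) _ _ _ => [y||]; rewrite /=; [by []|ring|ring].
have E : u 0 = u w.
  apply: zero_grad_segment => t; rewrite in_itv /= => /andP[t0 t1].
  apply: gu; rewrite !add0r !subr0 cmodZ (ger0_norm t0).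
  by apply: le_lt_trans w1; rewrite ler_piMl // cmod_ge0.
have u0 : u 0 = 0.
  rewrite /u subr0 cmod_real normr1 ln1 addr0.
  have := ps_real_sums has_radius_lcoef (x := 0); rewrite normr0 => /(_ ltr01) h.
  apply: (sums_unique h); apply: sums_eq (_ : sums (fun=> 0) 0) => [n|].
    by case: n => [|n]; rewrite ?exprS ?mul0r ?mulr0 // /lcoef invr0 mul0r.
  have := @sumsB R (fun n => lcoef n * 0 ^+ n) _ _ _ h h; rewrite subrr.
  by apply: sums_eq => n; rewrite subrr.
by move: E; rewrite u0 /u => /esym/eqP; rewrite addr_eq0 => /eqP.
Qed.

Variable Q : R.
Hypothesis Q1 : 1 < Q.

(* [ps ecoef z] is the sum over k of w / (1 - w) with w = z / Q ^ (2k + 1), and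
   [ps tcoef z] that of - ln (1 - w). *)
Definition ecoef (n : nat) : R := (Q ^+ n - Q ^- n)^-1.
Definition tcoef (n : nat) : R := ecoef n / n%:R.

Lemma Q_gt0 : 0 < Q. Proof. exact: lt_trans ltr01 Q1. Qed.

Lemma ecoef0 : ecoef 0 = 0.
Proof. by rewrite /ecoef expr0 invr1 subrr invr0. Qed.

Lemma ecoef_den n : 0 < Q ^+ n.+1 - Q ^- n.+1.
Proof.
have h : 1 < Q ^+ n.+1 by rewrite exprn_egt1.
have q0 : 0 < Q ^+ n.+1 by rewrite exprn_gt0 // Q_gt0.
by rewrite subr_gt0; apply: lt_trans (h); rewrite invf_lt1.
Qed.

Lemma ecoef_ge0 n : 0 <= ecoef n.
Proof. by case: n => [|n]; rewrite ?ecoef0 // /ecoef invr_ge0 ltW // ecoef_den. Qed.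

(** The left side is 1 / (1 - Q^(-2n)) for positive [n], largest at [n = 1]; for [n = 0] it is 0. *)
Lemma ecoef_bound n : ecoef n * Q ^+ n <= (1 - Q ^- 2)^-1.
Proof.
have q2 : Q ^- 2 < 1 by rewrite invf_lt1 ?exprn_gt0 ?Q_gt0 // exprn_egt1.
case: n => [|n]; first by rewrite ecoef0 mul0r invr_ge0; lra.
have qn : 0 < Q ^+ n.+1 by rewrite exprn_gt0 // Q_gt0.
rewrite /ecoef mulrC ler_pdivrMr ?ecoef_den // mulrC ler_pdivlMr; last by lra.
rewrite mulrBr mulr1 lerB //.
apply: (@le_trans _ _ Q^-1).
  rewrite -exprVn exprS ler_piMr ?invr_ge0 ?(ltW Q_gt0) // exprn_ile1 ?invr_ge0 ?(ltW Q_gt0) //.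
  by rewrite invf_le1 ?Q_gt0 // ltW.
have -> : Q ^+ n.+1 * Q ^- 2 = Q^-1 * Q ^+ n.
  by rewrite exprS; field; rewrite gt_eqF // Q_gt0.
by rewrite ler_peMr ?invr_ge0 ?(ltW Q_gt0) // exprn_ege1 // ltW.
Qed.

Lemma has_radius_ecoef : has_radius ecoef Q.
Proof.
apply: (has_radius_bounded Q_gt0) => n.
by rewrite (ger0_norm (ecoef_ge0 n)); exact: ecoef_bound.
Qed.

Lemma tcoef_ge0 n : 0 <= tcoef n.
Proof. by rewrite /tcoef divr_ge0 ?ecoef_ge0. Qed.

Lemma has_radius_tcoef : has_radius tcoef Q.
Proof.
apply: (has_radius_bounded Q_gt0) => n.
rewrite (ger0_norm (tcoef_ge0 n)); apply: le_trans (ecoef_bound n).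
rewrite ler_wpM2r ?exprn_ge0 ?(ltW Q_gt0) // /tcoef.
case: n => [|n]; first by rewrite ecoef0 mul0r.
by rewrite ler_piMr ?ecoef_ge0 // invf_le1 ?ltr0n // ler1n.
Qed.

Lemma dcoef_tcoef n : dcoef tcoef n = ecoef n.+1.
Proof. by rewrite /dcoef /tcoef mulrC divfK // pnatr_eq0. Qed.

Lemma cpow_scale (k : R) z n : cpow (k * z.1, k * z.2) n = (k ^+ n * (cpow z n).1, k ^+ n * (cpow z n).2).
Proof.
elim: n => [|n IH]; first by rewrite /= expr0 mul1r mulr0.
rewrite /= -/(cpow z n) -/(cpow (k * z.1, k * z.2) n) IH exprS.
by apply/pair_eqP; apply/andP; split; apply/eqP; rewrite /=; ring.
Qed.

Lemma cmod_scale (k : R) z : 0 <= k -> cmod (k * z.1, k * z.2) = k * cmod z.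
Proof. by move=> k0; rewrite cmodZ ger0_norm. Qed.

(** Replacing z by z / Q^2 drops the first image from the sum over images, so the difference is that
    image's contribution alone. The boundary values of all the annulus functions rest on this
    functional equation. *)
Lemma ps_image_identity (c d : nat -> R) z : has_radius c Q -> has_radius d 1 ->
  (forall n, c n - c n * Q ^- 2 ^+ n = d n * Q^-1 ^+ n) -> cmod z < Q ->
  ps c z - ps c (Q ^- 2 * z.1, Q ^- 2 * z.2) = ps d (Q^-1 * z.1, Q^-1 * z.2).
Proof.
move=> hc hd cd zQ.
have q1 : 0 < Q^-1 by rewrite invr_gt0 Q_gt0.
have q2 : 0 < Q ^- 2 by rewrite invr_gt0 exprn_gt0 // Q_gt0.
have q21 : Q ^- 2 <= 1 by rewrite invf_le1 ?exprn_gt0 ?Q_gt0 // exprn_ege1 // ltW.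
have z1 : cmod (Q^-1 * z.1, Q^-1 * z.2) < 1.
  by rewrite cmod_scale ?(ltW q1) // mulrC ltr_pdivrMr ?Q_gt0 // mul1r.
have z2 : cmod (Q ^- 2 * z.1, Q ^- 2 * z.2) < Q.
  by rewrite cmod_scale ?(ltW q2) //; apply: le_lt_trans zQ; rewrite ler_piMl ?cmod_ge0.
have [a1 a2] := ps_sums hc zQ; have [b1 b2] := ps_sums hc z2.
have E n (x : R) : c n * x - c n * (Q ^- 2 ^+ n * x) = d n * (Q^-1 ^+ n * x).
  by rewrite mulrA [RHS]mulrA -cd; ring.
have -> : ps d (Q^-1 * z.1, Q^-1 * z.2) =
   ((ps c z).1 - (ps c (Q ^- 2 * z.1, Q ^- 2 * z.2)).1,
    (ps c z).2 - (ps c (Q ^- 2 * z.1, Q ^- 2 * z.2)).2).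
  apply: ps_eq; [apply: sums_eq (sumsB a1 b1)|apply: sums_eq (sumsB a2 b2)];
    by move=> n; rewrite !cpow_scale /= E.
by [].
Qed.

Lemma ecoef_image n : ecoef n.+1 - ecoef n.+1 * Q ^- 2 ^+ n.+1 = Q^-1 ^+ n.+1.
Proof.
have qn : 0 < Q ^+ n.+1 by rewrite exprn_gt0 // Q_gt0.
have := ecoef_den n; rewrite /ecoef [Q ^- 2 ^+ n.+1]exprVn exprAC [Q^-1 ^+ n.+1]exprVn; move: qn.
move: (Q ^+ n.+1) => q q0 D0; field.
rewrite (gt_eqF q0) /=.
have qn0 : q != 0 by rewrite gt_eqF.
move: D0; rewrite subr_gt0 -(ltr_pM2l q0) divff // => h.
by rewrite gt_eqF // subr_gt0.
Qed.

Definition gcoef (n : nat) : R := (n != 0%N)%:R.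

Lemma has_radius_gcoef : has_radius gcoef 1.
Proof.
apply: (@has_radius_bounded _ 1) => // n; rewrite expr1n mulr1 /gcoef normr_nat.
by case: (n != 0%N).
Qed.

Lemma ps_gcoef w : cmod w < 1 -> ps gcoef w = cmul w (cinv ((1, 0) - w)).
Proof.
move=> w1; have [h1 h2] := ps_sums has_radius_one w1.
rewrite -(ps_one w1); apply: ps_eq.
  rewrite -[X in sums _ X]add0r -[X in sums _ (X + _)](_ : gcoef 0 * (cpow w 0).1 = 0).
    apply: (@sums_unshift _ (fun n => gcoef n * (cpow w n).1)).
    by apply: sums_eq2 (sumsB (sumsZ (k := w.1) h1) (sumsZ (k := w.2) h2)) _ _ => [n|] //; rewrite /gcoef /=; ring.
  by rewrite /gcoef eqxx mul0r.
rewrite -[X in sums _ X]add0r -[X in sums _ (X + _)](_ : gcoef 0 * (cpow w 0).2 = 0).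
  apply: (@sums_unshift _ (fun n => gcoef n * (cpow w n).2)).
  by apply: sums_eq2 (sumsD (sumsZ (k := w.1) h2) (sumsZ (k := w.2) h1)) _ _ => [n|] //; rewrite /gcoef /=; ring.
by rewrite /gcoef eqxx mul0r.
Qed.

Lemma ecoef_identity z : cmod z < Q ->
  ps ecoef z - ps ecoef (Q ^- 2 * z.1, Q ^- 2 * z.2) =
  cmul (Q^-1 * z.1, Q^-1 * z.2) (cinv ((1, 0) - (Q^-1 * z.1, Q^-1 * z.2))).
Proof.
move=> zQ; rewrite -ps_gcoef; last first.
  by rewrite cmod_scale ?invr_ge0 ?(ltW Q_gt0) // mulrC ltr_pdivrMr ?Q_gt0 // mul1r.
apply: ps_image_identity zQ; [exact: has_radius_ecoef|exact: has_radius_gcoef|].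
case=> [|n]; first by rewrite ecoef0 /gcoef eqxx !mul0r subrr.
by rewrite ecoef_image /gcoef mul1r.
Qed.

Lemma tcoef_identity z : cmod z < Q ->
  (ps tcoef z).1 - (ps tcoef (Q ^- 2 * z.1, Q ^- 2 * z.2)).1 =
  - ln (cmod ((1, 0) - (Q^-1 * z.1, Q^-1 * z.2))).
Proof.
move=> zQ; rewrite -ps_log; last first.
  by rewrite cmod_scale ?invr_ge0 ?(ltW Q_gt0) // mulrC ltr_pdivrMr ?Q_gt0 // mul1r.
have <- // : ps tcoef z - ps tcoef (Q ^- 2 * z.1, Q ^- 2 * z.2) = ps lcoef (Q^-1 * z.1, Q^-1 * z.2).
apply: ps_image_identity zQ; [exact: has_radius_tcoef|exact: has_radius_lcoef|].
case=> [|n]; first by rewrite /tcoef /lcoef ecoef0 invr0 !mul0r subrr.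
by rewrite /tcoef /lcoef -ecoef_image; ring.
Qed.

End AnnulusSeries.

(** * Explicit solutions on the annulus and their boundary values *)

Section AnnulusGreen.
Context {R : realType}.
Implicit Types (z w p a xi b : R * R) (x : R).

Definition cscale (k : R) z : R * R := (k * z.1, k * z.2).

Lemma cscaleE k z : cscale k z = cmul (k, 0) z.
Proof. by rewrite /cscale /cmul /=; congr pair; ring. Qed.

Lemma hol_cscale n U (k : R) (f : R * R -> R * R) : hol n U f -> hol n U (fun z => cscale k (f z)).
Proof.
move=> hf; rewrite (_ : (fun z => _) = fun z => cmul (k, 0) (f z)).
  by apply: holM; [exact: hol_cst|].
by apply/funext => z; rewrite cscaleE.
Qed.

Lemma cconjK z : cconj (cconj z) = z.
Proof. by rewrite /cconj /= opprK -surjective_pairing. Qed.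

Lemma cconjM z w : cconj (cmul z w) = cmul (cconj z) (cconj w).
Proof. by rewrite /cconj /cmul /=; congr pair; ring. Qed.

Lemma cconj_scale (k : R) z : cconj (cscale k z) = cscale k (cconj z).
Proof. by rewrite /cconj /cscale /=; congr pair; ring. Qed.

Lemma cconj_inv z : cconj (cinv z) = cinv (cconj z).
Proof. by rewrite /cconj /cinv sqmod_conj /=; congr pair; ring. Qed.

Lemma cinv_circle xi (r : R) : sqmod xi = r -> cinv xi = cscale r^-1 (cconj xi).
Proof. by move=> <-; rewrite /cinv /cscale /cconj /=; congr pair; ring. Qed.

Lemma cmul_scale (k : R) z w : cmul z (cscale k w) = cscale k (cmul z w).
Proof. by rewrite /cmul /cscale /=; congr pair; ring. Qed.

Lemma cscale_scale (k l : R) z : cscale k (cscale l z) = cscale (k * l) z.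
Proof. by rewrite /cscale /=; congr pair; ring. Qed.

Lemma cmulBr z w p : cmul z (w - p) = cmul z w - cmul z p.
Proof. by apply/pair_eqP; apply/andP; split; apply/eqP; rewrite /=; ring. Qed.

Lemma cscale1 z : cscale 1 z = z.
Proof. by rewrite /cscale !mul1r -surjective_pairing. Qed.

Variables rho Q L : R.
Hypothesis rho1 : 1 < rho.
Hypothesis QE : rho ^+ 2 = Q.
Hypothesis LE : ln rho = L.

Lemma rho_gt0 : 0 < rho. Proof. exact: lt_trans ltr01 rho1. Qed.
Lemma sqr_rho_gt1 : 1 < Q. Proof. by rewrite -QE exprn_egt1. Qed.
Lemma sqr_rho_gt0 : 0 < Q. Proof. exact: lt_trans ltr01 sqr_rho_gt1. Qed.
Lemma ln_rho_gt0 : 0 < L. Proof. by rewrite -LE ln_gt0. Qed.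

Let rho0 := rho_gt0.
Let L0 := ln_rho_gt0.
Let Q1 := sqr_rho_gt1.
Let Q0 := sqr_rho_gt0.

(** The factors 1 - w of the image sums vanish at the images of [a]: those of [arg1] at Q^(2k) * Q /
    conj a and those of [arg3] at Q^(-2k) / (Q conj a), k >= 0, which start with the reflections in
    the outer and inner circle; those of [arg2] and [arg4] at Q^(2k) a and Q^(-2k) a, k >= 1, after
    an even number of reflections. *)
Definition arg1 a xi := cmul (cconj a) xi.
Definition arg2 a xi := cscale Q^-1 (cmul (cinv a) xi).
Definition arg3 a xi := cinv (cmul (cconj a) xi).
Definition arg4 a xi := cscale Q^-1 (cmul a (cinv xi)).

(* A neighbourhood of the closed annulus on which the four series converge. *)
Definition collar a := [set xi : R * R | [/\ cmod (arg1 a xi) < Q, cmod (arg2 a xi) < Q,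
  cmod (arg3 a xi) < Q & cmod (arg4 a xi) < Q] /\ xi != 0].

Lemma annulusE z : annulus rho z <-> rho^-1 < cmod z < rho.
Proof.
by rewrite /annulus /= eucl_distE /cmod (_ : (0, 0) - z = - z) ?sqmod_opp //; apply: sub0r.
Qed.

Lemma annulus_neq0 a : annulus rho a -> a != 0.
Proof.
move=> /annulusE/andP[h _]; rewrite -cmod_gt0; apply: lt_trans h.
by rewrite invr_gt0.
Qed.

Lemma collar_closed_annulus a xi : annulus rho a -> rho^-1 <= cmod xi <= rho -> collar a xi.
Proof.
move=> /annulusE/andP[a1 a2] /andP[x1 x2].
have ri : 0 < rho^-1 by rewrite invr_gt0.
have a0 : 0 < cmod a := lt_trans ri a1.
have x0 : 0 < cmod xi := lt_le_trans ri x1.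
have prod (s t : R) : 0 < s < rho -> 0 < t <= rho -> s * t < Q.
  move=> /andP[s0 sr] /andP[t0 tr]; apply: (@lt_le_trans _ _ (rho * t)); first by rewrite ltr_pM2r.
  by rewrite -QE expr2 ler_pM2l.
have ai : (cmod a)^-1 < rho by rewrite -[rho]invrK ltf_pV2.
have xii : (cmod xi)^-1 <= rho by rewrite -[rho]invrK lef_pV2.
have m1 s : s < Q -> Q^-1 * s < Q.
  move=> sQ; rewrite mulrC ltr_pdivrMr //; apply: (lt_trans sQ); rewrite ltr_pMr //.
have ai0 : 0 < (cmod a)^-1 by rewrite invr_gt0.
have xi0 : 0 < (cmod xi)^-1 by rewrite invr_gt0.
split; last by rewrite -cmod_gt0.
split.
- by rewrite /arg1 cmodM cmod_conj prod // ?a0 ?a2 ?x0 ?x2.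
- rewrite /arg2 /cscale cmod_scale ?invr_ge0 ?ltW // cmodM cmod_inv.
  by apply: m1; apply: prod; rewrite ?ai0 ?ai ?x0 ?x2.
- by rewrite /arg3 cmod_inv cmodM cmod_conj invfM prod // ?ai0 ?ai ?xi0 ?xii.
- rewrite /arg4 /cscale cmod_scale ?invr_ge0 ?ltW // cmodM cmod_inv.
  by apply: m1; apply: prod; rewrite ?a0 ?a2 ?xi0 ?xii.
Qed.

Let T := ps (tcoef Q).
Let E := ps (ecoef Q).

(** The four image sums alone exceed - ln |xi - a| by L on the outer circle and by ln |a| on the
    inner one. The other terms are the affine function of ln |xi| with values - L and - ln |a|
    there. *)
Definition annH a xi := - (L + ln (cmod a)) / 2 + (ln (cmod a) - L) / (2 * L) * ln (cmod xi) +
  ((T (arg1 a xi)).1 - (T (arg2 a xi)).1 + (T (arg3 a xi)).1 - (T (arg4 a xi)).1).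

(* This is h1 - i h2. *)
Definition annX a xi := cmul (cinv a) ((- 2^-1 + ln (cmod xi) / (2 * L), 0) +
  (E (arg2 a xi) - E (arg4 a xi)) + cconj (E (arg1 a xi) - E (arg3 a xi))).

Lemma ps_conj1 c z : has_radius c Q -> cmod z < Q -> (ps c (cconj z)).1 = (ps c z).1.
Proof. by move=> hc zQ; rewrite (ps_conj hc zQ). Qed.

(** On a circle 1/xi is a multiple of conj xi, so the four arguments pair up. Here the sums at
    [arg2] and [arg3] cancel up to conjugation, and those at [arg1] and [arg4] form the difference
    in the functional equation; on the inner circle the pairs exchange roles. *)
Lemma outer_args a xi : a != 0 -> cmod xi = rho ->
  arg3 a xi = cconj (arg2 a xi) /\ arg4 a xi = cconj (cscale (Q ^- 2) (arg1 a xi)).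
Proof.
move=> a0 xr; have xQ : sqmod xi = Q by rewrite -cmod_sqr xr QE.
split.
  by rewrite /arg3 /arg2 cinvM (cinv_circle xQ) cmul_scale cconj_scale cconjM cconj_inv.
rewrite /arg4 /arg1 (cinv_circle xQ) cmul_scale cscale_scale cconj_scale cconjM cconjK.
by congr cscale; field; rewrite gt_eqF.
Qed.

Lemma inner_args a xi : a != 0 -> cmod xi = rho^-1 ->
  arg4 a xi = cconj (arg1 a xi) /\ arg2 a xi = cscale (Q ^- 2) (cconj (arg3 a xi)).
Proof.
move=> a0 xr; have xQ : sqmod xi = Q^-1 by rewrite -cmod_sqr xr exprVn QE.
have Qn : Q != 0 by rewrite gt_eqF.
split.
  by rewrite /arg4 /arg1 (cinv_circle xQ) invrK cmul_scale cscale_scale mulVf // cscale1 cconjM cconjK.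
rewrite /arg2 /arg3 cinvM (cinv_circle xQ) invrK cmul_scale cconj_scale cscale_scale cconjM cconj_inv !cconjK.
by congr cscale; field.
Qed.

Lemma annH_boundary a xi : annulus rho a -> cmod xi = rho \/ cmod xi = rho^-1 ->
  annH a xi = - ln (cmod (xi - a)).
Proof.
move=> ha hxi; have a0 := annulus_neq0 ha.
have ri1 : rho^-1 <= rho by rewrite (@le_trans _ _ 1) ?invf_le1 // ltW.
have [] : collar a xi.
  by apply: collar_closed_annulus => //; case: hxi => ->; rewrite lexx ri1.
move=> [c1 c2 c3 c4] xi0.
have hT := has_radius_tcoef Q1.
have Ln : L != 0 by rewrite gt_eqF.
have xa : xi - a != 0.
  rewrite subr_eq0; apply/eqP => xia; move: ha => /annulusE; rewrite -xia.
  by case: hxi => ->; rewrite ltxx ?andbF.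
case: hxi => xr.
  have xQ : sqmod xi = Q by rewrite -cmod_sqr xr QE.
  have [e3 e4] := outer_args a0 xr.
  have q2 : cmod (cscale (Q ^- 2) (arg1 a xi)) < Q.
    by move: c4; rewrite e4 cmod_conj.
  rewrite /annH e3 e4 (ps_conj1 hT c2) (ps_conj1 hT q2) xr LE.
  have := tcoef_identity Q1 c1; rewrite -/(cscale _ _) -/T => id1.
  have -> : (T (arg1 a xi)).1 - (T (arg2 a xi)).1 + (T (arg2 a xi)).1 - (T (cscale (Q ^- 2) (arg1 a xi))).1
     = (T (arg1 a xi)).1 - (T (cscale (Q ^- 2) (arg1 a xi))).1 by ring.
  rewrite id1.
  have m : cmod (xi - a) = rho * cmod ((1, 0) - (Q^-1 * (arg1 a xi).1, Q^-1 * (arg1 a xi).2)).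
    have rn : rho != 0 by rewrite gt_eqF.
    apply: (mulfI rn); rewrite -{1}xr -cmod_conj -cmodM mulrA -expr2 QE.
    rewrite -(cmod_scale _ (ltW Q0)) -[RHS]cmod_conj; congr cmod.
    rewrite /arg1 /cconj /cmul /=; have Qn : Q != 0 by rewrite gt_eqF.
    by congr pair; move: xQ; rewrite /sqmod => xQ; rewrite ?mulrBr ?mulrA ?(mulfV Qn) -?xQ; ring.
  have pos : 0 < cmod ((1, 0) - (Q^-1 * (arg1 a xi).1, Q^-1 * (arg1 a xi).2)).
    by move: xa; rewrite -cmod_gt0 m pmulr_rgt0.
  by rewrite m lnM ?posrE // LE; move: (ln _) (ln _) Ln => l1 l2 Ln; field.
have xQ : sqmod xi = Q^-1 by rewrite -cmod_sqr xr exprVn QE.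
have [e4 e2] := inner_args a0 xr.
have c3' : cmod (cconj (arg3 a xi)) < Q by rewrite cmod_conj.
rewrite /annH e4 e2 (ps_conj1 hT c1) -(ps_conj1 hT c3) xr lnV ?posrE // LE.
have := tcoef_identity Q1 c3'; rewrite -/(cscale _ _) -/T => id1.
have -> : forall y x1 x2 : R, y - x1 + x2 - y = x2 - x1 by move=> y x1 x2; ring.
rewrite id1.
have m : cmod (xi - a) = cmod a * cmod ((1, 0) - (Q^-1 * (cconj (arg3 a xi)).1, Q^-1 * (cconj (arg3 a xi)).2)).
  rewrite -cmodM -[LHS]cmod_opp opprB; congr cmod.
  have -> : (Q^-1 * (cconj (arg3 a xi)).1, Q^-1 * (cconj (arg3 a xi)).2) = cmul (cinv a) xi.
    rewrite -/(cscale _ _) /arg3 cinvM (cinv_circle xQ) invrK cmul_scale cconj_scale cscale_scale mulVf ?gt_eqF //.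
    by rewrite cscale1 cconjM cconj_inv !cconjK.
  by rewrite cmulBr cmulA cmulV // cmul1 cmulC cmul1.
have am : 0 < cmod a by rewrite cmod_gt0.
have pos : 0 < cmod ((1, 0) - (Q^-1 * (cconj (arg3 a xi)).1, Q^-1 * (cconj (arg3 a xi)).2)).
  by move: xa; rewrite -cmod_gt0 m pmulr_rgt0.
by rewrite m lnM ?posrE //; move: (ln _) (ln _) Ln => l1 l2 Ln; field.
Qed.

(** On the outer circle the logarithmic term cancels the constant and the series leave w / (1 - w)
    with w = a / xi. On the inner circle the constant is -1, and -1 - w / (1 - w) = -1 / (1 - w)
    with w = xi / a. Division by [a] gives 1 / (xi - a) in both cases. *)
Lemma annX_boundary a xi : annulus rho a -> cmod xi = rho \/ cmod xi = rho^-1 ->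
  annX a xi = cinv (xi - a).
Proof.
move=> ha hxi; have a0 := annulus_neq0 ha.
have ri1 : rho^-1 <= rho by rewrite (@le_trans _ _ 1) ?invf_le1 // ltW.
have [] : collar a xi.
  by apply: collar_closed_annulus => //; case: hxi => ->; rewrite lexx ri1.
move=> [c1 c2 c3 c4] xi0.
have hE := has_radius_ecoef Q1.
have Ln : L != 0 by rewrite gt_eqF.
have Qn : Q != 0 by rewrite gt_eqF.
have cj1 : cmod (cconj (arg1 a xi)) < Q by rewrite cmod_conj.
have cj3 : cmod (cconj (arg3 a xi)) < Q by rewrite cmod_conj.
have cB z w : cconj (z - w) = cconj z - cconj w.
  by apply/pair_eqP; apply/andP; split; apply/eqP; rewrite /=; ring.
case: hxi => xr.
  have xQ : sqmod xi = Q by rewrite -cmod_sqr xr QE.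
  have [e3 e4] := outer_args a0 xr.
  have := ecoef_identity Q1 cj1; rewrite -/(cscale _ _) -/(cscale _ (cconj (arg1 a xi))) => id1.
  rewrite /annX xr LE.
  have -> : - 2^-1 + L / (2 * L) = 0 by field.
  rewrite cB -[cconj (E (arg1 a xi))](ps_conj hE c1) -[cconj (E (arg3 a xi))](ps_conj hE c3).
  rewrite {1}e3 cconjK e4 cconj_scale.
  rewrite (_ : (0, 0) + _ + _ = E (cconj (arg1 a xi)) - E (cscale (Q ^- 2) (cconj (arg1 a xi)))); last first.
    by apply/pair_eqP; apply/andP; split; apply/eqP; rewrite /=; ring.
  rewrite id1.
  have -> : cscale Q^-1 (cconj (arg1 a xi)) = cmul a (cinv xi).
    by rewrite (cinv_circle xQ) cmul_scale /arg1 cconjM cconjK.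
  have ba : cmul (cinv a) (cmul a (cinv xi)) = cinv xi.
    by rewrite cmulA [cmul (cinv a) a]cmulC cmulV // cmul1.
  rewrite cmulA ba -cinvM cmulBr [cmul a (cinv xi)]cmulC cmulA cmulV // cmul1.
  by rewrite cmulC cmul1.
have xQ : sqmod xi = Q^-1 by rewrite -cmod_sqr xr exprVn QE.
have [e4 e2] := inner_args a0 xr.
have := ecoef_identity Q1 cj3; rewrite -/(cscale _ _) -/(cscale _ (cconj (arg3 a xi))) => id1.
rewrite /annX xr lnV ?posrE // LE.
have -> : - 2^-1 + - L / (2 * L) = -1 by field.
rewrite cB -[cconj (E (arg1 a xi))](ps_conj hE c1) -[cconj (E (arg3 a xi))](ps_conj hE c3).
rewrite e4 e2.
rewrite (_ : (-1, 0) + _ + _ = (-1, 0) - (E (cconj (arg3 a xi)) - E (cscale (Q ^- 2) (cconj (arg3 a xi))))); last first.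
  by apply/pair_eqP; apply/andP; split; apply/eqP; rewrite /=; ring.
rewrite id1.
have -> : cscale Q^-1 (cconj (arg3 a xi)) = cmul (cinv a) xi.
  rewrite /arg3 cinvM (cinv_circle xQ) invrK cmul_scale cconj_scale cscale_scale mulVf //.
  by rewrite cscale1 cconjM cconj_inv !cconjK.
set w := cmul (cinv a) xi.
have aw : cmul a ((1, 0) - w) = a - xi.
  by rewrite cmulBr /w cmulA cmulV // cmul1 cmulC cmul1.
have w1 : (1, 0) - w != 0.
  apply/eqP => w1; move: aw; rewrite w1 => /esym/eqP; rewrite (_ : cmul a 0 = 0); last first.
    by rewrite /cmul /=; congr pair; ring.
  rewrite subr_eq0 => /eqP axi; move: ha => /annulusE; rewrite axi xr ltxx.
  by [].
have -> : (-1, 0) - cmul w (cinv ((1, 0) - w)) = cmul (-1, 0) (cinv ((1, 0) - w)).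
  rewrite -[X in X - _](_ : cmul (-1, 0) (cmul ((1, 0) - w) (cinv ((1, 0) - w))) = _); last first.
    by rewrite cmulV // cmulC cmul1.
  move: (cinv _) => v; apply/pair_eqP; apply/andP; split; apply/eqP; rewrite /=; ring.
rewrite cmulA [cmul (cinv a) _]cmulC -cmulA -cinvM aw -opprB.
move: (a - xi) => v; rewrite /cinv /cmul /sqmod /= !sqrrN.
by congr pair; rewrite !mul0r ?mulN1r ?subr0 ?addr0 ?mulNr ?opprK.
Qed.

End AnnulusGreen.

Section AnnulusGreenData.
Context {R : realType}.
Implicit Types (z w p a xi b q : R * R) (x : R).

Lemma cmod_comp_continuous (f : R * R -> R * R) p :
  {for p, continuous (fun z => (f z).1)} -> {for p, continuous (fun z => (f z).2)} ->
  {for p, continuous (fun z => cmod (f z))}.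
Proof.
move=> c1 c2; apply: (@continuous_comp _ _ _ (fun z => sqmod (f z)) Num.sqrt).
  by apply: cvgD; apply: cvgM.
exact: sqrt_continuous.
Qed.

Lemma continuous_cmod : continuous (@cmod R).
Proof.
move=> p; apply: (@cmod_comp_continuous id); [exact: continuous_fst|exact: continuous_snd].
Qed.

Lemma open_neq0 : open [set z : R * R | z != 0].
Proof.
have o : open (setT `\ (0 : R * R)) by apply: open_setD1; exact: openT.
rewrite (_ : [set z | _] = setT `\ (0 : R * R)) //.
by apply/seteqP; split => z /=; [move/eqP|move=> [_ /eqP]].
Qed.

Lemma harmonic_ln_cmod : harmonic_on [set z : R * R | z != 0] (fun w => ln (cmod w)).
Proof.
by apply: harmonic_on_cgrad open_neq0 _ (hol_inv 1) => p; exact: has_grad_ln_cmod.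
Qed.

Lemma harmonic_ln_dist a : harmonic_on (setT `\ a) (fun w => ln (eucl_dist a w)).
Proof.
have o : open (setT `\ a) by apply: open_setD1; exact: openT.
have n0 p : (setT `\ a) p -> p - a != 0 by move=> [_ pa]; rewrite subr_eq0; apply/eqP.
apply: (@harmonic_on_ext _ _ (fun w => ln (cmod (w - a)))) => //.
  by move=> p _; rewrite eucl_distE.
apply: (@harmonic_on_cgrad _ _ _ (fun w => cinv (w - a))) => //.
  move=> p /n0 pa.
  have f1 := has_gradB (has_grad_fst p) (has_grad_cst a.1 p).
  have f2 := has_gradB (has_grad_snd p) (has_grad_cst a.2 p).
  have g := @has_grad_comp2 _ (fun w => ln (cmod w)) _ _ _ _ _ _ _ _ p (has_grad_ln_cmod pa) f1 f2.
  by apply: has_grad_eq g _ _ _ => [y||]; rewrite /=; [by []|ring|ring].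
by apply: holV n0 _; apply: holB; [exact: hol_id|exact: hol_cst].
Qed.

Variables rho Q L : R.
Hypothesis rho1 : 1 < rho.
Hypothesis QE : rho ^+ 2 = Q.
Hypothesis LE : ln rho = L.
Let rho0 := rho_gt0 rho1.
Let Q1 := sqr_rho_gt1 rho1 QE.
Let Q0 := sqr_rho_gt0 rho1 QE.
Let L0 := ln_rho_gt0 rho1 LE.
Let hE := has_radius_ecoef Q1.
Let hT := has_radius_tcoef Q1.

Lemma hol_args a n : a != 0 ->
  [/\ hol n [set xi | xi != 0] (arg1 a), hol n [set xi | xi != 0] (arg2 Q a),
      hol n [set xi | xi != 0] (arg3 a) & hol n [set xi | xi != 0] (arg4 Q a)].
Proof.
move=> a0.
have h1 : hol n [set xi | xi != 0] (arg1 a) by apply: holM; [exact: hol_cst|exact: hol_id].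
split=> //.
- by apply: hol_cscale; apply: holM; [exact: hol_cst|exact: hol_id].
- apply: holV h1 => xi xi0; rewrite -cmod_gt0 cmodM cmod_conj mulr_gt0 // cmod_gt0 //.
- by apply: hol_cscale; apply: holM; [exact: hol_cst|exact: hol_inv].
Qed.

Lemma open_collar a : a != 0 -> open (collar Q a).
Proof.
move=> a0; rewrite openE => xi [[c1 c2 c3 c4] xi0].
have [h1 h2 h3 h4] := hol_args 0 a0.
have lt_near (f : R * R -> R * R) : hol 0 [set xi | xi != 0] f -> cmod (f xi) < Q ->
    \forall z \near xi, cmod (f z) < Q.
  move=> hf fQ; have [f1 f2] := hf xi xi0.
  have e0 : 0 < Q - cmod (f xi) by rewrite subr_gt0.
  apply: filterS (continuous_near_dist (cmod_comp_continuous f1 f2) e0) => z.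
  by rewrite ltr_norml => /andP[_]; rewrite ltrD2r.
have n0 := open_nbhs_nbhs (conj open_neq0 xi0).
have n12 : \forall z \near xi, cmod (arg1 a z) < Q /\ cmod (arg2 Q a z) < Q.
  by apply: filterS2 (lt_near _ h1 c1) (lt_near _ h2 c2).
have n34 : \forall z \near xi, cmod (arg3 a z) < Q /\ cmod (arg4 Q a z) < Q.
  by apply: filterS2 (lt_near _ h3 c3) (lt_near _ h4 c4).
by apply: filterS3 n0 n12 n34 => z z0 [? ?] [? ?].
Qed.

Lemma hol_ps_args a n (c : nat -> R) : a != 0 -> has_radius c Q ->
  [/\ hol n (collar Q a) (fun xi => ps c (arg1 a xi)), hol n (collar Q a) (fun xi => ps c (arg2 Q a xi)),
      hol n (collar Q a) (fun xi => ps c (arg3 a xi)) & hol n (collar Q a) (fun xi => ps c (arg4 Q a xi))].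
Proof.
move=> a0 hc; have [h1 h2 h3 h4] := hol_args n a0.
have sub : collar Q a `<=` [set xi | xi != 0] by move=> xi [].
have hp := hol_ps n hc.
split.
- by apply: hol_comp hp (hol_sub sub h1) => xi [[]].
- by apply: hol_comp hp (hol_sub sub h2) => xi [[]].
- by apply: hol_comp hp (hol_sub sub h3) => xi [[]].
- by apply: hol_comp hp (hol_sub sub h4) => xi [[]].
Qed.

Lemma harmonic_annH a : a != 0 -> harmonic_on (collar Q a) (annH Q L a).
Proof.
move=> a0; have oC := open_collar a0; have [h1 h2 h3 h4] := hol_ps_args 2 a0 hT.
have sub : collar Q a `<=` [set xi | xi != 0] by move=> xi [].
have hl := harmonic_on_sub sub harmonic_ln_cmod.
have hP := hol_harmonic1 oC (holB (holD (holB h1 h2) h3) h4).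
have hc := hol_harmonic1 oC (hol_cst 2 (collar Q a) (- (L + ln (cmod a)) / 2, 0)).
have h := harmonic_on_comb 1 1 oC (harmonic_on_comb 1 ((ln (cmod a) - L) / (2 * L)) oC hc hl) hP.
apply: harmonic_on_ext oC _ h => xi _; rewrite /annH /=; ring.
Qed.

(** Conjugating the antiholomorphic part, which keeps real parts and negates imaginary ones, writes
    each component as a component of a holomorphic function plus an affine function of ln |xi|;
    harmonicity and gradients can be read off from this. *)
Lemma annX_split a xi :
  (annX Q L a xi).1 = (cinv a).1 * (- 2^-1 + ln (cmod xi) / (2 * L)) +
    (cmul (cinv a) (ps (ecoef Q) (arg2 Q a xi) - ps (ecoef Q) (arg4 Q a xi)) +
     cmul (cconj (cinv a)) (ps (ecoef Q) (arg1 a xi) - ps (ecoef Q) (arg3 a xi))).1 /\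
  - (annX Q L a xi).2 = - (cinv a).2 * (- 2^-1 + ln (cmod xi) / (2 * L)) +
    (cmul (cconj (cinv a)) (ps (ecoef Q) (arg1 a xi) - ps (ecoef Q) (arg3 a xi)) -
     cmul (cinv a) (ps (ecoef Q) (arg2 Q a xi) - ps (ecoef Q) (arg4 Q a xi))).2.
Proof.
rewrite /annX; move: (cinv a) (ps _ (arg1 a xi)) (ps _ (arg2 Q a xi)) (ps _ (arg3 a xi)) (ps _ (arg4 Q a xi)).
move=> b e1 e2 e3 e4; move: (_ + ln _ / _) => l.
by split; rewrite /=; ring.
Qed.

Lemma harmonic_annX a : a != 0 -> harmonic_on (collar Q a) (fun xi => (annX Q L a xi).1) /\
  harmonic_on (collar Q a) (fun xi => - (annX Q L a xi).2).
Proof.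
move=> a0; have oC := open_collar a0; have [h1 h2 h3 h4] := hol_ps_args 2 a0 hE.
have sub : collar Q a `<=` [set xi | xi != 0] by move=> xi [].
have hl := harmonic_on_sub sub harmonic_ln_cmod.
have hP := holM (hol_cst 2 (collar Q a) (cinv a)) (holB h2 h4).
have hN := holM (hol_cst 2 (collar Q a) (cconj (cinv a))) (holB h1 h3).
have hc := hol_harmonic1 oC (hol_cst 2 (collar Q a) (- 2^-1, 0)).
have hL := harmonic_on_comb 1 (2 * L)^-1 oC hc hl.
have g1 := harmonic_on_comb (cinv a).1 1 oC hL (hol_harmonic1 oC (holD hP hN)).
have g2 := harmonic_on_comb (- (cinv a).2) 1 oC hL (hol_harmonic2 oC (holB hN hP)).
split.
  apply: harmonic_on_ext oC _ g1 => xi _; rewrite (annX_split a xi).1 /cst /=; ring.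
apply: harmonic_on_ext oC _ g2 => xi _; rewrite (annX_split a xi).2 /cst /=; ring.
Qed.

Lemma open_annulus : open (annulus rho).
Proof.
rewrite (_ : annulus rho = cmod @^-1` `]rho^-1, rho[%classic).
  by apply: open_comp => [z _|]; [exact: continuous_cmod|exact: itv_open].
by apply/seteqP; split => z; rewrite annulusE //= in_itv.
Qed.

Lemma closure_annulus z : closure (annulus rho) z -> rho^-1 <= cmod z <= rho.
Proof.
have cl : closed (cmod @^-1` `[rho^-1, rho]%classic : set (R * R)).
  by apply: preimage_closed => [? _|]; [exact: continuous_cmod|exact: itv_closed].
have sub : annulus rho `<=` cmod @^-1` `[rho^-1, rho]%classic.
  by move=> y /annulusE/andP[h1 h2]; rewrite /= in_itv /= !ltW.
by move=> /(closureS sub)/(cl z); rewrite /= in_itv.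
Qed.

Lemma boundary_annulus z : boundary (annulus rho) z -> cmod z = rho \/ cmod z = rho^-1.
Proof.
move=> /(boundary_open _ open_annulus)[/closure_annulus/andP[h1 h2] nz].
have [lt|ge] := ltP (cmod z) rho; last by left; apply/eqP; rewrite eq_le h2 ge.
have [lt'|ge'] := ltP rho^-1 (cmod z); last by right; apply/eqP; rewrite eq_le h1 ge'.
by exfalso; apply: nz; apply/annulusE; rewrite lt' lt.
Qed.

Lemma collar_closure a xi : annulus rho a -> closure (annulus rho) xi -> collar Q a xi.
Proof. by move=> ha /closure_annulus h; exact: (collar_closed_annulus rho1 QE ha h). Qed.

Definition annG a xi := - ln (eucl_dist a xi) - annH Q L a xi.

Lemma annulus_green_data : green_data (annulus rho) annG (annH Q L)
  (fun a xi => (annX Q L a xi).1) (fun a xi => - (annX Q L a xi).2).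
Proof.
have clO a xi : annulus rho a -> annulus rho xi -> collar Q a xi.
  by move=> ha hxi; apply: collar_closure ha _; exact: subset_closure.
have cont (a q : R * R) (u : R * R -> R) : annulus rho a -> harmonic_on (collar Q a) u ->
    collar Q a q -> {for q, continuous u}.
  move=> ha hu cq; have oC := open_collar (annulus_neq0 rho1 ha).
  exact: (harmonic_on_continuous oC hu cq).
split.
- move=> a ha; have a0 := annulus_neq0 rho1 ha.
  have hH := harmonic_annH a0.
  split.
  + have oD : open (annulus rho `\ a) by apply: open_setD1; exact: open_annulus.
    have h1 := harmonic_on_sub (_ : annulus rho `\ a `<=` setT `\ a) (harmonic_ln_dist a).
    have h2 := harmonic_on_sub (_ : annulus rho `\ a `<=` collar Q a) hH.
    apply: harmonic_on_ext oD _ (harmonic_on_comb (-1) (-1) oD (h1 _) (h2 _)).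
    * by move=> xi _; rewrite /annG; ring.
    * by move=> xi [].
    * by move=> xi [hxi _]; exact: clO.
  + apply: continuous_in_subspaceT => q /set_mem[clq qa].
    have oT : open (setT `\ a) by apply: open_setD1; exact: openT.
    have c1 := harmonic_on_continuous oT (harmonic_ln_dist a) (conj I qa : (setT `\ a) q).
    have c2 := cont a q _ ha hH (collar_closure ha clq).
    exact: cvgB (cvgN c1) c2.
  + move=> xi /boundary_annulus hxi; rewrite /annG (annH_boundary rho1 QE LE ha hxi) eucl_distE.
    by rewrite opprK addNr.
  + have cH := cont a a _ ha hH (clO a a ha ha).
    apply/cvgrPdist_le => e e0.
    (* With D = - ln |xi - a| one has 1 - G/D = H/D, at most [e] in modulus once D >= K and |H|
       stays below |H(a,a)| + 1. *)
    pose K := (`|annH Q L a a| + 1) / e.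
    have K0 : 0 < K by rewrite divr_gt0 // ltr_wpDl.
    have H : \forall z \near a, z != a -> `|1 - annG a z / - ln (eucl_dist a z)| <= e.
      apply: filterS2 (ln_dist_to_infty a K) (continuous_near_dist cH ltr01) => z hK hz /eqP za.
      have {}hK := hK za; rewrite /annG.
      move: hK hz; move: (- ln _) (annH _ _ _ z) => D h hK hz.
      have D0 : 0 < D := lt_le_trans K0 hK.
      have -> : 1 - (D - h) / D = h / D by field; rewrite gt_eqF.
      rewrite normrM normfV (gtr0_norm D0) ler_pdivrMr //.
      have : `|annH Q L a a| + 1 <= e * D by rewrite -ler_pdivrMl // mulrC.
      have : `|h| <= `|annH Q L a a| + 1.
        by rewrite -[h](subrK (annH Q L a a)) addrC (le_trans (ler_normD _ _)) // lerD2l ltW.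
      lra.
    exact: H.
- move=> a ha; have a0 := annulus_neq0 rho1 ha; split.
    by apply: harmonic_on_sub (harmonic_annH a0) => xi; exact: clO.
  by [].
- move=> a ha; have a0 := annulus_neq0 rho1 ha; have [hX _] := harmonic_annX a0; split.
  + by apply: harmonic_on_sub hX => xi; exact: clO.
  + apply: continuous_in_subspaceT => q /set_mem clq.
    exact: (cont a q _ ha hX (collar_closure ha clq)).
  + move=> xi /boundary_annulus hxi.
    by rewrite (annX_boundary rho1 QE LE ha hxi) eucl_dist_sqr -[a - xi]opprB sqmod_opp.
- move=> a ha; have a0 := annulus_neq0 rho1 ha; have [_ hX] := harmonic_annX a0; split.
  + by apply: harmonic_on_sub hX => xi; exact: clO.
  + apply: continuous_in_subspaceT => q /set_mem clq.
    exact: (cont a q _ ha hX (collar_closure ha clq)).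
  + move=> xi /boundary_annulus hxi.
    by rewrite (annX_boundary rho1 QE LE ha hxi) eucl_dist_sqr -[a - xi]opprB sqmod_opp /cinv /= mulNr opprK.
Qed.

End AnnulusGreenData.

(** * The Robin function and Htilde as functions of the squared radius *)

Section AnnulusRobin.
Context {R : realType}.
Implicit Types (z w p a xi b q : R * R) (x : R).

Variables rho Q L : R.
Hypothesis rho1 : 1 < rho.
Hypothesis QE : rho ^+ 2 = Q.
Hypothesis LE : ln rho = L.
Let Q1 := sqr_rho_gt1 rho1 QE.
Let L0 := ln_rho_gt0 rho1 LE.
Let hE := has_radius_ecoef Q1.

Definition robin_profile x := - (L + ln x / 2) / 2 + (ln x / 2 - L) / (2 * L) * (ln x / 2) +
  ((ps (tcoef Q) (x, 0)).1 + (ps (tcoef Q) (x^-1, 0)).1 - 2 * (ps (tcoef Q) (Q^-1, 0)).1).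

Definition Htilde_profile x := (2 * L)^-1 / x + 2 * ((ps (dcoef (ecoef Q)) (x, 0)).1 +
  (ps (dcoef (ecoef Q)) (x^-1, 0)).1 / x ^+ 2).

Lemma arg1_diag a : arg1 a a = (sqmod a, 0).
Proof. by rewrite /arg1 /cmul /cconj /sqmod /=; congr pair; ring. Qed.

Lemma arg2_diag a : a != 0 -> arg2 Q a a = (Q^-1, 0).
Proof. by move=> a0; rewrite /arg2 cmulC cmulV // /cscale mulr1 mulr0. Qed.

Lemma arg3_diag a : arg3 a a = ((sqmod a)^-1, 0).
Proof.
rewrite /arg3 -[cmul _ _]/(arg1 a a) arg1_diag; move: (sqmod a) => s; rewrite /cinv /sqmod /=.
rewrite expr0n addr0 oppr0 mul0r; congr pair.
by have [->|s0] := eqVneq s 0; [rewrite invr0 mul0r|field].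
Qed.

Lemma arg4_diag a : a != 0 -> arg4 Q a a = (Q^-1, 0).
Proof. by move=> a0; rewrite /arg4 cmulV // /cscale mulr1 mulr0. Qed.

Lemma robin_annulus a : annulus rho a -> robin (annH Q L) a = robin_profile (sqmod a).
Proof.
move=> /(annulus_neq0 rho1) a0; rewrite /robin /annH /robin_profile arg1_diag arg2_diag // arg3_diag arg4_diag //.
have -> : ln (cmod a) = ln (sqmod a) / 2 by rewrite ln_cmod // mulrC.
ring.
Qed.

Lemma has_cderiv_arg1 a p : has_cderiv (arg1 a) (cconj a) p.
Proof.
apply: has_cderiv_eq (has_cderivM (has_cderiv_cst (cconj a) p) (has_cderiv_id p)) _ _ => //.
by apply/pair_eqP; apply/andP; split; apply/eqP; rewrite /=; ring.
Qed.

Lemma has_cderiv_arg3 a : a != 0 ->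
  has_cderiv (arg3 a) (cmul (cmul (-1, 0) (cmul (arg3 a a) (arg3 a a))) (cconj a)) a.
Proof.
move=> a0; apply: has_cderiv_comp (has_cderiv_arg1 a a); apply: has_cderiv_inv.
by rewrite -sqmod_gt0 sqmodM sqmod_conj mulr_gt0 // sqmod_gt0.
Qed.

Lemma Htilde_annulus a : annulus rho a ->
  Htilde (fun a xi => (annX Q L a xi).1) (fun a xi => - (annX Q L a xi).2) a = Htilde_profile (sqmod a).
Proof.
move=> ha; have a0 := annulus_neq0 rho1 ha.
have s0 : sqmod a != 0 by rewrite sqmod_eq0.
have ca : collar Q a a by apply: (collar_closure rho1 QE ha); exact: subset_closure.
have [c1 c2 c3 c4] := ca.1.
have [_ h2 _ h4] := hol_ps_args 1 a0 hE.
(* The part built on [arg2] and [arg4] is holomorphic, so it cancels in the divergence and its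
   derivative [P'] need not be computed. *)
have [P' dP _] := holM (hol_cst 1 (collar Q a) (cinv a)) (holB h2 h4).
have [p1 p2] := dP a ca.
have e1 := has_cderiv_comp (has_cderiv_ps hE c1) (has_cderiv_arg1 a a).
have e3 := has_cderiv_comp (has_cderiv_ps hE c3) (has_cderiv_arg3 a0).
have [n1 n2] := has_cderivM (has_cderiv_cst (cconj (cinv a)) a) (has_cderivB e1 e3).
have l := has_gradD (has_grad_cst (- 2^-1) a) (has_gradM (has_grad_ln_cmod a0) (has_grad_cst (2 * L)^-1 a)).
have H1 := has_gradD (has_gradM (has_grad_cst (cinv a).1 a) l) (has_gradD p1 n1).
have H2 := has_gradD (has_gradM (has_grad_cst (- (cinv a).2) a) l) (has_gradB n2 p2).
have G1 := has_grad_eq H1 (fun xi => esym (annX_split Q L a xi).1) erefl erefl.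
have G2 := has_grad_eq H2 (fun xi => esym (annX_split Q L a xi).2) erefl erefl.
rewrite /Htilde (has_grad_pd1 G1).2 (has_grad_pd2 G2).2.
move: (ln _) (P' a) => l' P; rewrite arg1_diag arg3_diag /Htilde_profile.
move: (ps (dcoef _) (sqmod a, 0)) (ps (dcoef _) ((sqmod a)^-1, 0)) => E1 E2.
move: (ps _ (sqmod a, 0)) (ps _ ((sqmod a)^-1, 0)) => T1 T2.
rewrite /cmul /cconj /cinv /cst /=.
by move: s0; rewrite /sqmod => s0; field; rewrite s0 gt_eqF.
Qed.

End AnnulusRobin.

(** * The annulus as a smooth domain *)

Section AnnulusDomain.
Context {R : realType}.
Implicit Types (z w p q : R * R) (k : nat).

Lemma Ck_on_grad k U (f g1 g2 : R * R -> R) : open U -> (forall p, U p -> has_grad f (g1 p) (g2 p) p) ->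
  Ck_on k U g1 -> Ck_on k U g2 -> Ck_on k.+1 U f.
Proof.
move=> oU df c1 c2.
have E1 p : U p -> g1 p = pd1 f p by move=> /df/has_grad_pd1[_ ->].
have E2 p : U p -> g2 p = pd2 f p by move=> /df/has_grad_pd2[_ ->].
split; [|exact: (Ck_on_ext oU E1 c1)|exact: (Ck_on_ext oU E2 c2)].
by move=> p Up; split; [exact: (has_grad_pd1 (df p Up)).1|exact: (has_grad_pd2 (df p Up)).1].
Qed.

Lemma Ck_on_cst k U (c : R) : open U -> Ck_on k U (cst c).
Proof.
move=> oU; elim: k c => [|k IH] c; first by move=> p _; exact: cvg_cst.
exact: (Ck_on_grad oU (fun p _ => has_grad_cst c p) (IH 0) (IH 0)).
Qed.

Lemma smooth_on_affine_sqmod U (s c : R) : open U -> smooth_on U (fun z => s * sqmod z + c).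
Proof.
move=> oU [|k].
  move=> p _; apply: cvgD; last exact: cvg_cst.
  by apply: cvgM; [exact: cvg_cst|exact: (has_grad_continuous (has_grad_sqmod p))].
apply: (@Ck_on_grad _ _ _ (fun p => 2 * s * p.1) (fun p => 2 * s * p.2)) => //.
- move=> p _; have := has_gradD (has_gradM (has_grad_cst s p) (has_grad_sqmod p)) (has_grad_cst c p).
  by move/has_grad_eq; apply => //; rewrite /cst; ring.
- case: k => [|k]; first by move=> p _; apply: cvgM; [exact: cvg_cst|exact: continuous_fst].
  apply: (@Ck_on_grad _ _ _ (cst (2 * s)) (cst 0)) (Ck_on_cst _ _ oU) (Ck_on_cst _ _ oU) => // p _.
  have := has_gradM (has_grad_cst (2 * s) p) (has_grad_fst p).
  by move/has_grad_eq; apply => //; rewrite /cst; ring.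
case: k => [|k]; first by move=> p _; apply: cvgM; [exact: cvg_cst|exact: continuous_snd].
apply: (@Ck_on_grad _ _ _ (cst 0) (cst (2 * s))) (Ck_on_cst _ _ oU) (Ck_on_cst _ _ oU) => // p _.
have := has_gradM (has_grad_cst (2 * s) p) (has_grad_snd p).
by move/has_grad_eq; apply => //; rewrite /cst; ring.
Qed.

Lemma norm_le_cmod z : `|z| <= cmod z.
Proof. by rewrite prod_normE ge_max cmod_fst cmod_snd. Qed.

Lemma cmod_exp z : cmod (cexp z) = expR z.1.
Proof. by rewrite /cmod sqmod_exp expRM_natl sqrtr_sqr ger0_norm ?expR_ge0. Qed.

(** The arc cosine of z.1 / |z| gives the angle up to sign, and the sign of [z.2] decides. *)
Lemma polar z : z != 0 -> exists t, cexp (ln (cmod z), t) = z.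
Proof.
move=> z0; have m0 : 0 < cmod z by rewrite cmod_gt0.
have b : -1 <= z.1 / cmod z <= 1.
  by rewrite -ler_norml normrM normfV (gtr0_norm m0) ler_pdivrMr // mul1r cmod_fst.
have c : cos (acos (z.1 / cmod z)) = z.1 / cmod z by rewrite acosK // in_itv.
have s : cmod z * sin (acos (z.1 / cmod z)) = `|z.2|.
  rewrite sin_acos // -{1}[cmod z]gtr0_norm // -sqrtr_sqr -sqrtrM ?sqr_ge0 // -sqrtr_sqr.
  congr Num.sqrt; rewrite mulrBr mulr1 -exprMn mulrC divfK ?gt_eqF // cmod_sqr /sqmod; ring.
have e t : cexp (ln (cmod z), t) = (cmod z * cos t, cmod z * sin t) by rewrite /cexp /= lnK.
have [z2|z2] := leP 0 z.2.
  exists (acos (z.1 / cmod z)); rewrite e c s (ger0_norm z2) mulrC divfK ?gt_eqF //.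
  by case: z {z0 m0 b c s e z2}.
exists (- acos (z.1 / cmod z)); rewrite e cosN sinN c mulrN s (ltr0_norm z2) opprK mulrC divfK ?gt_eqF //.
by case: z {z0 m0 b c s e z2}.
Qed.

Lemma continuous_cexp : continuous (@cexp R).
Proof.
move=> p; have [h1 h2] := has_cderiv_exp p.
exact: cvg_pair (has_grad_continuous h1) (has_grad_continuous h2).
Qed.

Variable rho : R.
Hypothesis rho1 : 1 < rho.
Let rho0 := rho_gt0 rho1.

(** The annulus is the image under the exponential of the convex strip |x| < ln rho. *)
Lemma connected_annulus : connected (annulus rho).
Proof.
have l0 : 0 < ln rho by rewrite ln_gt0.
pose S := [set p : R * R | - ln rho < p.1 < ln rho].
have cS : connected S.
  apply: (@star_connected _ _ (0, 0)); first by rewrite /S /= oppr_lt0 l0.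
  move=> p t; rewrite /S /= => /andP[p1 p2] /andP[t0 t1].
  by rewrite add0r subr0; apply/andP; split; nra.
rewrite (_ : annulus rho = @cexp R @` S).
  by apply: connected_continuous_connected cS _; apply: continuous_subspaceT; exact: continuous_cexp.
apply/seteqP; split => z.
  move=> hz; have z0 := annulus_neq0 rho1 hz; have [t tE] := polar z0.
  exists (ln (cmod z), t) => //; move: hz => /annulusE/andP[h1 h2].
  have m0 : 0 < cmod z by rewrite cmod_gt0.
  by rewrite /S /= -lnV ?posrE // !ltr_ln ?posrE ?invr_gt0 // h1 h2.
move=> [p hp <-]; apply/annulusE; rewrite cmod_exp.
move: hp; rewrite /S /= => /andP[h1 h2].
by rewrite -[X in X^-1 < _]lnK ?posrE // -expRN ltr_expR h1 -[X in _ < X]lnK ?posrE // ltr_expR h2.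
Qed.

(** The defining functions are |z|^2 - rho^2 and rho^-2 - |z|^2, polynomials with nonzero gradient
    off 0. Each neighbourhood [U] already imposes the inequality at the other circle. *)
Lemma smooth_boundary_annulus : smooth_boundary (annulus rho).
Proof.
have ri : 0 < rho^-1 by rewrite invr_gt0.
have ri1 : rho^-1 < rho by rewrite (@lt_trans _ _ 1) ?invf_lt1.
have sq (s t : R) : 0 <= s -> 0 <= t -> (s < t) = (s ^+ 2 < t ^+ 2).
  by move=> s0 t0; rewrite ltr_pXn2r // nnegrE.
have grad (s c : R) p : has_grad (fun z => s * sqmod z + c) (2 * s * p.1) (2 * s * p.2) p.
  have := has_gradD (has_gradM (has_grad_cst s p) (has_grad_sqmod p)) (has_grad_cst c p).
  by move/has_grad_eq; apply => //; rewrite /cst; ring.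
have nz (s c : R) p : s != 0 -> 0 < cmod p ->
    pd1 (fun z => s * sqmod z + c) p <> 0 \/ pd2 (fun z => s * sqmod z + c) p <> 0.
  move=> s0; rewrite cmod_gt0 => p0; rewrite (has_grad_pd1 (grad s c p)).2 (has_grad_pd2 (grad s c p)).2.
  have [p1|p1] := eqVneq p.1 0; [right|left]; apply/eqP; rewrite !mulf_neq0 ?pnatr_eq0 //.
  by apply: contra p0 => /eqP p2; apply/eqP; case: p p1 p2 => x y /= -> ->.
have oU (A : set R) : open A -> open (@cmod R @^-1` A).
  by move=> oA; apply: open_comp oA => z _; exact: continuous_cmod.
move=> p /boundary_annulus; case=> pr.
- exists (@cmod R @^-1` [set x | rho^-1 < x]), (fun z => 1 * sqmod z + - rho ^+ 2); split.
  + by apply: oU; exact: open_gt.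
  + by rewrite /= pr ri1.
  + by apply: smooth_on_affine_sqmod; apply: oU; exact: open_gt.
  + by apply: nz; rewrite ?oner_neq0 // pr.
  + move=> q /= hq; rewrite mul1r subr_lt0 -cmod_sqr -sq ?cmod_ge0 ?(ltW rho0) //.
    by split => [/annulusE/andP[]//|h]; apply/annulusE; rewrite hq h.
- exists (@cmod R @^-1` [set x | x < rho]), (fun z => -1 * sqmod z + rho^-1 ^+ 2); split.
  + by apply: oU; exact: open_lt.
  + by rewrite /= pr ri1.
  + by apply: smooth_on_affine_sqmod; apply: oU; exact: open_lt.
  + by apply: nz; rewrite ?oppr_eq0 ?oner_neq0 // pr.
  + move=> q /= hq; rewrite mulN1r addrC subr_lt0 -cmod_sqr -sq ?cmod_ge0 ?(ltW ri) //.
    by split => [/annulusE/andP[]//|h]; apply/annulusE; rewrite hq h.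
Qed.

Lemma annulus_domain : smooth_bounded_domain (annulus rho).
Proof.
split; [|exact: open_annulus|exact: connected_annulus| |exact: smooth_boundary_annulus].
  by exists (1, 0); apply/annulusE; rewrite cmod_real normr1 rho1 invf_lt1 // rho1.
exists rho; split; first exact: num_real.
move=> M rM z /annulusE/andP[_ zr]; apply: (le_trans (norm_le_cmod z)).
by apply: ltW; exact: lt_trans zr rM.
Qed.

End AnnulusDomain.

(** * The two radial functions *)

Section Profiles.
Context {R : realType}.
Implicit Types (x y : R).

Variables rho Q L : R.
Hypothesis rho1 : 1 < rho.
Hypothesis QE : rho ^+ 2 = Q.
Hypothesis LE : ln rho = L.
Let Q1 := sqr_rho_gt1 rho1 QE.
Let Q0 := sqr_rho_gt0 rho1 QE.
Let L0 := ln_rho_gt0 rho1 LE.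
Let hE := has_radius_ecoef Q1.
Let hT := has_radius_tcoef Q1.

Let rps (c : nat -> R) x := (ps c (x, 0)).1.

Lemma rps_nonneg_le (c : nat -> R) x y : (forall n, 0 <= c n) -> has_radius c Q ->
  0 <= x <= y -> y < Q -> c 0%N <= rps c x <= rps c y.
Proof.
move=> c0 hc /andP[x0 xy] yQ.
have hx : `|x| < Q by rewrite ger0_norm //; exact: le_lt_trans xy yQ.
have y0 : 0 <= y := le_trans x0 xy.
have hy : `|y| < Q by rewrite ger0_norm.
have sx := ps_real_sums hc hx; have sy := ps_real_sums hc hy.
apply/andP; split.
  rewrite -subr_ge0; apply: sums_ge0 (_ : sums (fun n => c n.+1 * x ^+ n.+1) _).
    by move=> n; rewrite mulr_ge0 // exprn_ge0.
  by have := sums_shift sx; rewrite expr0 mulr1.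
by apply: (sums_le _ sx sy) => n; rewrite ler_wpM2l // lerXn2r.
Qed.

Lemma dcoef_ge0 (c : nat -> R) n : (forall n, 0 <= c n) -> 0 <= dcoef c n.
Proof. by move=> c0; rewrite /dcoef mulr_ge0. Qed.

Lemma is_derive_ext (f g : R -> R) (a b x : R) : is_derive x 1 f a -> f =1 g -> a = b -> is_derive x 1 g b.
Proof. by move=> hf /funext <- <-. Qed.

Lemma is_derive_rps_inv (c : nat -> R) x : has_radius c Q -> Q^-1 < x ->
  is_derive x 1 (fun y => rps c y^-1) (- rps (dcoef c) x^-1 / x ^+ 2).
Proof.
move=> hc xQ; have x0 : 0 < x by apply: lt_trans xQ; rewrite invr_gt0.
have hx : `|x^-1| < Q by rewrite gtr0_norm ?invr_gt0 // -[Q]invrK ltf_pV2 ?posrE ?invr_gt0.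
have h := is_derive1_comp (is_derive_ps_real hc hx) (is_derive_inv (lt0r_neq0 x0)).
by apply: (is_derive_eq h); rewrite /rps; ring.
Qed.

Lemma is_derive_rps (c : nat -> R) x : has_radius c Q -> `|x| < Q ->
  is_derive x 1 (rps c) (rps (dcoef c) x).
Proof. exact: is_derive_ps_real. Qed.

Definition robin_profile' x := (-1 + ln x / (2 * L)) / (2 * x) +
  (rps (dcoef (tcoef Q)) x - rps (dcoef (tcoef Q)) x^-1 / x ^+ 2).

Definition Htilde_profile' x := - (2 * L)^-1 / x ^+ 2 + 2 * (rps (dcoef (dcoef (ecoef Q))) x -
  (rps (dcoef (dcoef (ecoef Q))) x^-1 / x ^+ 4 + 2 * rps (dcoef (ecoef Q)) x^-1 / x ^+ 3)).

Lemma is_derive_robin_profile x : Q^-1 < x < Q -> is_derive x 1 (robin_profile Q L) (robin_profile' x).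
Proof.
move=> /andP[x1 x2]; have x0 : 0 < x by apply: lt_trans x1; rewrite invr_gt0.
have hx : `|x| < Q by rewrite gtr0_norm.
have t : is_derive x 1 (fun y : R => ln y / 2) (x^-1 / 2).
  have h := is_deriveM (is_derive1_ln x0) (is_derive_cst (2^-1 : R) x 1).
  by apply: (is_derive_eq h); rewrite /GRing.scale /= mulr0 add0r mulrC.
have c k := is_derive_cst (k : R) x 1.
have a1 := is_deriveM (is_deriveN (is_deriveD (c L) t)) (c 2^-1).
have a2 := is_deriveM (is_deriveM (is_deriveB t (c L)) (c (2 * L)^-1)) t.
have a3 := is_deriveB (is_deriveD (is_derive_rps hT hx) (is_derive_rps_inv hT x1))
  (c (2 * rps (tcoef Q) Q^-1)).
have h := is_deriveD (is_deriveD a1 a2) a3.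
refine (is_derive_ext h (fun y => erefl) _).
rewrite /GRing.scale /cst /= !fctE /robin_profile'.
move: (rps _ x) (rps _ x^-1) (ln x) => T1 T2 l; have Ln := L0.
by field; rewrite !gt_eqF.
Qed.

Lemma is_derive_Htilde_profile x : Q^-1 < x < Q -> is_derive x 1 (Htilde_profile Q L) (Htilde_profile' x).
Proof.
move=> /andP[x1 x2]; have x0 : 0 < x by apply: lt_trans x1; rewrite invr_gt0.
have hx : `|x| < Q by rewrite gtr0_norm.
have hE1 := has_radius_dcoef hE.
have c k := is_derive_cst (k : R) x 1.
have i := is_derive_inv (lt0r_neq0 x0).
have i2 : is_derive x 1 (fun y : R => (y ^+ 2)^-1) (- 2 / x ^+ 3).
  have x20 : x ^+ 2 != 0 by rewrite expf_neq0 // gt_eqF.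
  have q : is_derive x 1 (fun y : R => y ^+ 2) (2 * x).
    refine (is_derive_ext (is_deriveM (is_derive_id x 1) (is_derive_id x 1)) (fun y => erefl) _).
    by rewrite /GRing.scale /=; ring.
  have h := is_derive1_comp (g := fun y : R => y ^+ 2) (is_derive_inv x20) q.
  refine (is_derive_ext h (fun y => erefl) _).
  by rewrite /GRing.scale /=; field; rewrite gt_eqF.
have a1 := is_deriveM (c (2 * L)^-1) i.
have a2 := is_deriveD (is_derive_rps hE1 hx) (is_deriveM (is_derive_rps_inv hE1 x1) i2).
refine (is_derive_ext (is_deriveD a1 (is_deriveM (c 2) a2)) (fun y => erefl) _).
rewrite /GRing.scale /cst /= ?fctE /Htilde_profile'.
move: (rps _ x) (rps _ x) (rps _ x^-1) (rps _ x^-1) => T1 T2 T3 T4; have Ln := L0.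
by field; rewrite !gt_eqF.
Qed.

(** Trades the factor produced by two differentiations for a geometric one. *)
Lemma consecutive_product_le n : (n.+1 * n.+2 <= 2 ^ n.+2)%N.
Proof.
case: n => // n; elim: n => // n IH; rewrite expnS.
by apply: (leq_trans _ (leq_mul (leqnn 2) IH)); lia.
Qed.

Hypothesis Q_large : 64 * 64 <= Q.

(** Multiplied by x^2, the derivative is at most - 1/(2 L) + 2 x^2 E''(x), with E the series of
    [ecoef]. For x <= Q/256, the bounds e_n <= C Q^-n and (n+1)(n+2) <= 2^(n+2) give x^2 E''(x) <= C
    times the sum of 128^-(n+2), at most 3 / (2 * 127 * 128); twice this is below 1/4096 <= 1/(2
    L). *)
Lemma Htilde_profile'_lt0 x : L <= 32 * 64 -> Q^-1 < x <= Q / (4 * 64) -> Htilde_profile' x < 0.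
Proof.
move=> Lle /andP[x1 x2]; have x0 : 0 < x by apply: lt_trans x1; rewrite invr_gt0.
have xQ : x < Q by apply: (le_lt_trans x2); rewrite ltr_pdivrMr; have := Q0; lra.
have hx : `|x| < Q by rewrite gtr0_norm.
have hE2 := has_radius_dcoef (has_radius_dcoef hE).
have e0 := ecoef_ge0 Q1.
have e1 n : 0 <= dcoef (ecoef Q) n := dcoef_ge0 n e0.
have e2 n : 0 <= dcoef (dcoef (ecoef Q)) n := dcoef_ge0 n e1.
pose C := (1 - Q ^- 2)^-1.
have C32 : C <= 3 / 2.
  have q2 : Q ^- 2 <= 3^-1.
    rewrite lef_pV2 ?posrE ?exprn_gt0 //; have := Q_large; nra.
  by rewrite /C invf_ple ?posrE; lra.
have C0 : 0 <= C by apply: le_trans (ecoef_bound Q1 1); rewrite mulr_ge0 // exprn_ge0 // ltW.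
have second : x ^+ 2 * rps (dcoef (dcoef (ecoef Q))) x <= C / 128 ^+ 2 * (1 - 128^-1)^-1.
  have g : `|128^-1 : R| < 1 by rewrite ger0_norm; lra.
  apply: (sums_le _ (sumsZ (k := x ^+ 2) (ps_real_sums hE2 hx)) (sumsZ (k := C / 128 ^+ 2) (sums_geometric g))).
  move=> n; rewrite /dcoef.
  have -> : x ^+ 2 * (n.+1%:R * (n.+2%:R * ecoef Q n.+2) * x ^+ n) =
     (n.+1 * n.+2)%:R * (ecoef Q n.+2 * x ^+ n.+2).
    by rewrite natrM !exprS; ring.
  have -> : C / 128 ^+ 2 * 128^-1 ^+ n = 2 ^+ n.+2 * (C * ((4 * 64)^-1) ^+ n.+2).
    rewrite (_ : (4 * 64)^-1 = 128^-1 / 2 :> R); last by field.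
    have h : 2 ^+ n.+2 * 2^-1 ^+ n.+2 = 1 :> R by rewrite -exprMn mulfV ?pnatr_eq0 // expr1n.
    rewrite exprMn -exprVn; transitivity (C * 128^-1 ^+ n.+2 * (2 ^+ n.+2 * 2^-1 ^+ n.+2)).
      by rewrite h mulr1 -mulrA -exprD.
    have swap (a b c d : R) : a * b * (c * d) = c * (a * (b * d)) by ring.
    exact: swap.
  apply: ler_pM => //.
  - by rewrite mulr_ge0 // exprn_ge0 // ltW.
  - by rewrite -natrX ler_nat consecutive_product_le.
  - apply: (@le_trans _ _ (ecoef Q n.+2 * (Q / (4 * 64)) ^+ n.+2)).
      rewrite ler_wpM2l // lerXn2r // nnegrE; [exact: ltW|exact: ltW (lt_le_trans x0 x2)].
    by rewrite exprMn mulrA ler_wpM2r ?exprn_ge0 ?invr_ge0 // ecoef_bound.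
have xi0 : 0 <= x^-1 <= x^-1 by rewrite invr_ge0 ltW /=.
have xiQ : x^-1 < Q by rewrite -[Q]invrK ltf_pV2 ?posrE ?invr_gt0.
have /andP[t1 _] := rps_nonneg_le e2 hE2 xi0 xiQ.
have /andP[t2 _] := rps_nonneg_le e1 (has_radius_dcoef hE) xi0 xiQ.
have tail : 0 <= rps (dcoef (dcoef (ecoef Q))) x^-1 / x ^+ 4 + 2 * rps (dcoef (ecoef Q)) x^-1 / x ^+ 3.
  by rewrite addr_ge0 // divr_ge0 ?exprn_ge0 ?(ltW x0) ?mulr_ge0 // ?(le_trans _ t1) ?(le_trans _ t2).
rewrite /Htilde_profile'; have L2 : (64 * 64)^-1 <= (2 * L)^-1 by rewrite lef_pV2 ?posrE; have := L0; lra.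
move: (rps _ x) (_ + _ / x ^+ 3) second tail => E1 E2 s tl.
rewrite -(pmulr_llt0 _ (exprn_gt0 2 x0)).
have -> : (- (2 * L)^-1 / x ^+ 2 + 2 * (E1 - E2)) * x ^+ 2 = - (2 * L)^-1 + 2 * (x ^+ 2 * E1) - 2 * (x ^+ 2 * E2).
  by field; rewrite !gt_eqF.
have : 0 <= x ^+ 2 * E2 by rewrite mulr_ge0 // exprn_ge0 // ltW.
move: (x ^+ 2 * E1) (x ^+ 2 * E2) s => A B s; move: L2; move: (2 * L)^-1 => l L2.
have : C / 128 ^+ 2 * (1 - 128^-1)^-1 <= 3 / 2 / 128 ^+ 2 * (1 - 128^-1)^-1.
  by rewrite ler_wpM2r ?ler_wpM2r //; rewrite ?invr_ge0; lra.
have -> : 3 / 2 / 128 ^+ 2 * (1 - 128^-1)^-1 = 3 / (2 * 127 * 128) :> R by field.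
lra.
Qed.

Lemma robin_profile'1 : robin_profile' 1 = - 2^-1.
Proof. by rewrite /robin_profile' ln1 invr1 expr1n; move: (rps _ _) => T; field; rewrite gt_eqF. Qed.

(** Here [l] plays the role of ln 2 and x = Q/512. Multiplied by [x], the logarithmic part of the
    slope is - 9/8192. The derived series is monotone with constant term at least 1/Q, so it
    contributes at least (x - 1/x)/Q >= 1/512 - 1/32768, which is larger than 9/8192. *)
Lemma robin_profile'_gt0 x (l : R) : 0 < l -> L = 32 * 64 * l -> ln x = (64 * 64 - 9) * l ->
  8 * 64 * x = Q -> 0 < robin_profile' x.
Proof.
move=> l0 Ll xl xQ; have x8 : 8 <= x by have := Q_large; lra.
have x0 : 0 < x by lra.
have d0 n : 0 <= dcoef (tcoef Q) n by rewrite dcoef_ge0 // => k; exact: tcoef_ge0.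
have xi : x^-1 <= 8^-1 by rewrite lef_pV2 ?posrE.
have xi0 : 0 < x^-1 by rewrite invr_gt0.
have xx : 0 <= x^-1 <= x by rewrite ltW //=; lra.
have xQ' : x < Q by lra.
have /andP[t1 t2] := rps_nonneg_le d0 (has_radius_dcoef hT) xx xQ'.
have e1 : Q^-1 <= dcoef (tcoef Q) 0.
  rewrite dcoef_tcoef /ecoef expr1 lef_pV2 ?posrE //; last exact: (ecoef_den Q1 0).
  by rewrite lerBlDr lerDl invr_ge0 ltW.
rewrite -(pmulr_rgt0 _ x0) /robin_profile' xl Ll.
move: (rps _ x) (rps _ x^-1) t1 t2 => T1 T2 t1 t2.
have -> : x * ((-1 + (64 * 64 - 9) * l / (2 * (32 * 64 * l))) / (2 * x) + (T1 - T2 / x ^+ 2)) =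
  - 9 / (64 * 128) + (x * T1 - x^-1 * T2) by field; rewrite !gt_eqF.
have h1 : x * T2 <= x * T1 by rewrite ler_pM2l.
have h2 : (x - x^-1) * Q^-1 <= (x - x^-1) * T2.
  by rewrite ler_wpM2l; [|lra|exact: le_trans e1 t1].
have h3 : x * Q^-1 = (8 * 64)^-1 by rewrite -xQ; field; rewrite gt_eqF.
have h4 : x^-1 * Q^-1 <= 8^-1 * (64 * 64)^-1.
  apply: ler_pM xi _; [exact: ltW|by rewrite invr_ge0 ltW|].
  by rewrite lef_pV2 ?posrE // mulr_gt0.
move: h1 h2 h3 h4; rewrite !mulrBl.
move: (x * T1) (x^-1 * T2) (x * T2) (x * Q^-1) (x^-1 * Q^-1) => u1 u2 u3 u4 u5; lra.
Qed.

End Profiles.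

(** * The annulus as a counterexample *)

Section Counterexample.
Context {R : realType}.
Implicit Types (x y : R) (a p q : R * R).

Variables rho Q L l : R.
Hypothesis rho1 : 1 < rho.
Hypothesis QE : rho ^+ 2 = Q.
Hypothesis LE : ln rho = L.
Hypothesis Q_large : 64 * 64 <= Q.
Hypothesis l01 : 0 < l <= 1.
Hypothesis LlE : L = 32 * 64 * l.
Hypothesis lnK : ln (Q / (8 * 64)) = (64 * 64 - 9) * l.
Let rho0 := rho_gt0 rho1.
Let Q0 := sqr_rho_gt0 rho1 QE.

(* It contains 1 and Q / 512, where [robin_profile] has slopes of opposite signs. *)
Let I := `]2^-1, (Q / (4 * 64))[ : interval R.

Lemma window_sub x : x \in I -> Q^-1 < x < Q.
Proof.
rewrite in_itv /= => /andP[h1 h2]; apply/andP; split; last by have := Q0; lra.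
apply: lt_trans h1; rewrite ltf_pV2 ?posrE //; have := Q_large; lra.
Qed.

Lemma Htilde_profile'_window x : x \in I -> Htilde_profile' Q L x < 0.
Proof.
move=> xI; have /andP[x1 _] := window_sub xI; move: xI; rewrite in_itv /= => /andP[_ x2].
apply: (Htilde_profile'_lt0 rho1 QE LE Q_large); last by rewrite x1 ltW.
by rewrite LlE; case/andP: l01 => _ l1; lra.
Qed.

(** Used in both directions: a nonvanishing derivative makes the profile of Htilde injective, and
    the failure of injectivity gives a critical radius of the Robin function. *)
Lemma window_rolle (f : R -> R) (df : R -> R) : (forall x, x \in I -> is_derive x 1 f (df x)) ->
  ~ {in I &, injective f} -> exists2 c, c \in I & is_derive c 1 f 0.
Proof.
move=> hf ninj.
have [x [y [xI yI xy fxy]]] : exists x y, [/\ x \in I, y \in I, x < y & f x = f y].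
  apply: contrapT => H; apply: ninj => x y xI yI fxy.
  by case: (ltgtP x y) => // h; exfalso; apply: H; [exists x, y|exists y, x].
have sub z : z \in `[x, y] -> z \in I.
  move: xI yI; rewrite !in_itv /= => /andP[x1 x2] /andP[y1 y2] /andP[z1 z2].
  by rewrite (lt_le_trans x1 z1) (le_lt_trans z2 y2).
have [z zxy|||c cxy hc] := @Rolle R f x y xy; last by exists c => //; apply: sub; exact: subset_itv_oo_cc cxy.
- by have [] := hf z (sub z (subset_itv_oo_cc zxy)).
- by apply: derivable_within_continuous => z /sub/hf[].
- exact: fxy.
Qed.

Lemma Htilde_profile_inj : {in I &, injective (Htilde_profile Q L)}.
Proof.
apply: contrapT => ninj.
have dp x : x \in I -> is_derive x 1 (Htilde_profile Q L) (Htilde_profile' Q L x).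
  by move=> /window_sub; exact: (is_derive_Htilde_profile rho1 QE LE).
have [c cI hc] := window_rolle dp ninj.
have := Htilde_profile'_window cI; have [_ <-] := dp c cI; have [_ ->] := hc.
by rewrite ltxx.
Qed.

(** A continuous injective function on an interval is monotone, so its derivative keeps one sign; it
    is - 1/2 at 1 and positive at Q/512. *)
Lemma robin_profile_not_inj : ~ {in I &, injective (robin_profile Q L)}.
Proof.
move=> inj; have Qb := Q_large.
have dp x : x \in I -> is_derive x 1 (robin_profile Q L) (robin_profile' Q L x).
  by move=> /window_sub; exact: (is_derive_robin_profile rho1 QE LE).
have drv : {in [set` I], forall x, derivable (robin_profile Q L) x 1} by move=> x /set_mem/dp[].
have I1 : 1 \in I by rewrite in_itv /=; apply/andP; split; lra.
have IK : Q / (8 * 64) \in I by rewrite in_itv /=; apply/andP; split; lra.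
have cont : {within [set` I], continuous (robin_profile Q L)}.
  by apply: derivable_within_continuous => x /dp[].
have d1 : derive1 (robin_profile Q L) 1 = - 2^-1.
  by rewrite derive1E; have [_ ->] := dp 1 I1; rewrite (robin_profile'1 Q rho1 LE).
have dK : 0 < derive1 (robin_profile Q L) (Q / (8 * 64)).
  rewrite derive1E; have [_ ->] := dp _ IK.
  apply: (robin_profile'_gt0 rho1 QE Q_large _ LlE lnK); first by case/andP: l01.
  by rewrite mulrC divfK // mulf_neq0 ?pnatr_eq0.
have [mono|mono] := itv_continuous_inj_mono cont inj.
  by have := incr_derive1_ge0_itv drv mono I1; rewrite d1; lra.
by have := decr_derive1_le0_itv drv mono IK; rewrite leNgt dK.
Qed.

Lemma radial_point x : x \in I -> annulus rho (Num.sqrt x, 0) /\ sqmod (Num.sqrt x, 0 : R) = x.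
Proof.
move=> /window_sub/andP[x1 x2]; have x0 : 0 < x by apply: lt_trans x1; rewrite invr_gt0.
split; last by rewrite /sqmod /= expr0n addr0 sqr_sqrtr // ltW.
apply/annulusE; rewrite cmod_real ger0_norm ?sqrtr_ge0 //.
have e : Num.sqrt Q = rho by rewrite -QE sqrtr_sqr gtr0_norm.
by rewrite -e -sqrtrV ?(ltW Q0) // !ltr_sqrt // x1 x2.
Qed.

Let annh1 (a xi : R * R) := (annX Q L a xi).1.
Let annh2 (a xi : R * R) := - (annX Q L a xi).2.

Lemma annulus_not_function :
  ~ exists F : R -> R, forall a, annulus rho a -> Htilde annh1 annh2 a = F (robin (annH Q L) a).
Proof.
move=> [F hF]; apply: robin_profile_not_inj => x y xI yI xy; apply: Htilde_profile_inj => //.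
have [a1 e1] := radial_point xI; have [a2 e2] := radial_point yI.
have := hF _ a1; have := hF _ a2.
rewrite !(Htilde_annulus rho1 QE LE) // !(robin_annulus _ _ rho1) //.
by rewrite e1 e2 xy => -> ->.
Qed.

(** No fundamental group is computed: on a simply connected annulus the identity of the first part
    would provide the function F(x) = 2 e^(2x), just excluded. *)
Lemma annulus_not_simply_connected : ~ simply_connected (annulus rho).
Proof.
move=> sc; apply: annulus_not_function; exists (fun x => 2 * expR (2 * x)) => a ha.
have [_ oA _ bA _] := annulus_domain rho1.
exact: (Htilde_simply_connected oA bA sc (annulus_green_data rho1 QE LE) ha).
Qed.

Lemma critical_pointE Omega (f : R * R -> R) a :
  critical_points Omega f a <-> Omega a /\ has_grad f 0 0 a.
Proof.
rewrite /critical_points /has_grad /=.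
by rewrite (_ : (fun h : R * R => _) = cst 0) //; apply/funext => h; rewrite !mul0r addr0.
Qed.

Lemma has_grad_radial (f : R * R -> R) (u : R -> R) (d : R) a : annulus rho a ->
  (forall p, annulus rho p -> f p = u (sqmod p)) -> is_derive (sqmod a) 1 u d ->
  has_grad f (d * (2 * a.1)) (d * (2 * a.2)) a.
Proof.
move=> ha hf hu; apply: has_grad_near (has_grad_comp1 hu (has_grad_sqmod a)).
have := open_nbhs_nbhs (conj (@open_annulus _ rho) ha).
by apply: filterS => p /hf ->.
Qed.

(** By the chain rule through |a|^2, a critical point of the profile gives a critical point of the
    Robin function on the positive real axis, where the gradient of Htilde is a negative number
    times 2 a and thus nonzero. *)
Lemma annulus_critical_points :
  critical_points (annulus rho) (robin (annH Q L)) <> critical_points (annulus rho) (Htilde annh1 annh2).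
Proof.
have dp x : x \in I -> is_derive x 1 (robin_profile Q L) (robin_profile' Q L x).
  by move=> /window_sub; exact: (is_derive_robin_profile rho1 QE LE).
have [c cI hc] := window_rolle dp robin_profile_not_inj.
have [ha e] := radial_point cI; set a := (Num.sqrt c, 0) in ha e.
have gr := @has_grad_radial _ (robin_profile Q L) 0 a ha (fun p hp => robin_annulus Q L rho1 hp) _.
rewrite e in gr; have {}gr := gr hc; rewrite !mul0r in gr.
have dpc : is_derive (sqmod a) 1 (Htilde_profile Q L) (Htilde_profile' Q L c).
  by rewrite e; exact: (is_derive_Htilde_profile rho1 QE LE (window_sub cI)).
have gh := has_grad_radial ha (fun p hp => Htilde_annulus rho1 QE LE hp) dpc.
move=> E; have : critical_points (annulus rho) (robin (annH Q L)) a by apply/critical_pointE.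
rewrite E => /critical_pointE[_ g0].
have := (has_grad_pd1 gh).2; rewrite (has_grad_pd1 g0).2 => /esym/eqP.
have c0 : 0 < c.
  by have /andP[h _] := window_sub cI; apply: lt_trans h; rewrite invr_gt0.
by rewrite !mulf_eq0 pnatr_eq0 /= sqrtr_eq0 leNgt c0 orbF lt_eqF // Htilde_profile'_window.
Qed.

End Counterexample.

(** * Choice of the radius *)

Section LargeAnnulus.
Context {R : realType}.

(** The upper bound is ln (1 + x) <= x at x = 1; it turns L = 2048 ln 2 into L <= 2048. *)
Lemma ln2_bounds : 0 < ln (2 : R) <= 1.
Proof.
rewrite ln_gt0 ?ltr1n //=.
have := @le_ln1Dx R 1; rewrite (_ : 1 + 1 = 2 :> R) //; apply; lra.
Qed.

(* The estimates above hold for ln rho roughly between 800 and 2700; here it is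
   about 1420. *)
Definition large_rho : R := 2 ^+ (32 * 64).

Lemma large_rho_gt : 64 <= large_rho.
Proof.
rewrite /large_rho (_ : 64 = 2 ^+ 6 :> R); last by ring.
by rewrite ler_eXn2l ?ltr1n.
Qed.

Lemma ln_large_rho : ln large_rho = 32 * 64 * ln (2 : R).
Proof.
by rewrite /large_rho lnXn // -[LHS]mulr_natl natrM.
Qed.

Lemma ln_window_end : ln (large_rho ^+ 2 / (8 * 64)) = (64 * 64 - 9) * ln (2 : R).
Proof.
have r0 : 0 < large_rho := lt_le_trans (ltr0n R 64) large_rho_gt.
have e : 8 * 64 = 2 ^+ 9 :> R by ring.
rewrite e ln_div ?posrE ?exprn_gt0 // lnXn // lnXn // ln_large_rho.
move: (ln 2) => l; rewrite -[_ *+ 2]mulr_natl -[_ *+ 9]mulr_natl; ring.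
Qed.

End LargeAnnulus.

Theorem theorem1p1 (R : realType) :
  (forall (Omega : set (R * R)) (G H h1 h2 : R * R -> R * R -> R),
     smooth_bounded_domain Omega -> simply_connected Omega ->
     green_data Omega G H h1 h2 ->
     forall a : R * R, Omega a -> Htilde h1 h2 a = 2 * expR (2 * robin H a))
  /\
  (exists (Omega : set (R * R)) (G H h1 h2 : R * R -> R * R -> R),
     [/\ smooth_bounded_domain Omega, ~ simply_connected Omega,
         green_data Omega G H h1 h2 &
         ~ exists F : R -> R,
             forall a : R * R, Omega a -> Htilde h1 h2 a = F (robin H a)])
  /\
  (exists rho : R, 1 < rho /\
     exists G H h1 h2 : R * R -> R * R -> R,
       green_data (annulus rho) G H h1 h2 /\
       critical_points (annulus rho) (robin H) <>
       critical_points (annulus rho) (Htilde h1 h2)).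
Proof.
have r64 := @large_rho_gt R; have r1 : 1 < @large_rho R by lra.
have Q64 : 64 * 64 <= @large_rho R ^+ 2 by rewrite expr2; apply: ler_pM; lra.
(* The reflexivity proofs instantiate the parameters [Q] and [L] as [rho ^+ 2] and [ln rho]. *)
have gd := annulus_green_data r1 erefl erefl.
split.
  move=> Omega G H h1 h2 [_ oO _ bO _] sc hgd a Oa.
  exact: (Htilde_simply_connected oO bO sc hgd Oa).
split.
  exists (annulus (@large_rho R)); do 4 eexists; split; last 1 first.
  - exact: (annulus_not_function r1 erefl erefl Q64 ln2_bounds ln_large_rho ln_window_end).
  - exact: annulus_domain.
  - exact: (annulus_not_simply_connected r1 erefl erefl Q64 ln2_bounds ln_large_rho ln_window_end).
  - exact: gd.
exists large_rho; split=> //; do 4 eexists; split; first exact: gd.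
exact: (annulus_critical_points r1 erefl erefl Q64 ln2_bounds ln_large_rho ln_window_end).
Qed.
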